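(* Let $M$ be a connected smooth manifold and let $G$ be a closed Lie subgroup of diffeomorphisms of $M$ (closed in the group $\mathrm{Diff}(M)$ of all diffeomorphisms) that preserves either a strictly pseudo-convex $CR$-structure or a conformal Riemannian structure on $M$. Then $G$ acts properly on $M$ if and only if the first differentiable cohomology group $H^1_d\left(G,C^\infty(M,\mathbb{R})\right)$ vanishes.
   Context: A pseudo-Hermitian structure $\{\omega,J\}$ on $M$ consists of a contact form $\omega$ and a complex structure $J$ on $\ker\omega$ such that the Levi form $d\omega(J\cdot,\cdot)$ is a positive definite Hermitian form on $\ker\omega$. A strictly pseudo-convex $CR$-structure on $M$ is a pair $\{D,J\}$ with $D=\ker\omega$ induced by a pseudo-Hermitian structure $\{\omega,J\}$; $\alpha\in\mathrm{Diff}(M)$ preserves it if $\alpha_*D=D$ and $\alpha_*\circ J=J\circ\alpha_*|_D$. A conformal Riemannian structure is the conformal class of a Riemannian metric $g$; $\alpha$ preserves it if $\alpha^*g=f\cdot g$ for some $f\in C^\infty(M,\mathbb{R}^{>0})$. $C^\infty(M,\mathbb{R})$ carries the $C^\infty$-topology and the $G$-action $(\alpha\cdot f)(x)=f(\alpha^{-1}x)$; it is a differentiable $G$-module. For a differentiable $G$-module $W$, $H^r_d(G,W)$ is the cohomology of the complex of smooth inhomogeneous cochains $C^\infty(G^r,W)$ with the coboundary $\partial^0(w)(\alpha)=\alpha\cdot w-w$ and $$\partial^r\lambda(\alpha_1,\dots,\alpha_{r+1})=\alpha_1\cdot\lambda(\alpha_2,\dots,\alpha_{r+1})+\sum_{i=1}^r(-1)^i\lambda(\alpha_1,\dots,\alpha_i\alpha_{i+1},\dots,\alpha_{r+1})+(-1)^{r+1}\lambda(\alpha_1,\dots,\alpha_r).$$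 *)

(* Defs.v *)
From HB Require Import structures.
From mathcomp Require Import all_boot all_order all_algebra all_fingroup.
From mathcomp Require Import all_classical all_reals all_analysis.

Set Implicit Arguments.
Unset Strict Implicit.
Unset Printing Implicit Defensive.

Import Order.TTheory GRing.Theory Num.Theory.
Import numFieldNormedType.Exports.

Local Open Scope classical_set_scope.
Local Open Scope ring_scope.

(* The library declares only the stronger structures on matrices. *)
HB.instance Definition _ (R : realType) (m n : nat) :=
  PreTopologicalLmodule.copy 'M[R]_(m, n) ('M[R]_(m, n) : normedModType R).

(* The library's ['D_v f] needs a normed codomain; [dderiv] is the same limit
   for a codomain that is a topological vector space, such as C^oo(M, R).
   For f on an open subset U of a finite-dimensional V, C^k is expressed by
   iterated directional derivatives; the functions are total on V and their
   values off U are irrelevant. *)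
Section smoothness.
Context {R : realType} {V : normedModType R} {W : preTopologicalLmodType R}.

Definition dderiv (f : V -> W) (x v : V) (l : W) : Prop :=
  (fun h : R => h^-1 *: (f (h *: v + x) - f x)) @ 0^' --> l.

Fixpoint Ck (k : nat) (U : set V) (f : V -> W) : Prop :=
  (forall x, U x -> {for x, continuous f}) /\
  (if k is k'.+1 then
     forall v, exists2 f' : V -> W,
       forall x, U x -> dderiv f x v (f' x) & Ck k' U f'
   else True).

Definition smooth_on (U : set V) (f : V -> W) : Prop := forall k, Ck k U f.

End smoothness.

(* The iterated derivative of f in the directions vs. *)
Definition iterD {R : realType} {V W : normedModType R} (vs : seq V)
    (f : V -> W) : V -> W :=
  foldr (fun v g => 'D_v g) f vs.

Section smooth_on_lemmas.
Context {R : realType} {V W : normedModType R}.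

Lemma smooth_on_cst (U : set V) (w : W) : smooth_on U (fun=> w).
Proof.
move=> k; elim: k w => [|k IH] w; split=> //; do ?by move=> x _; exact: cvg_cst.
move=> v; exists (fun=> 0); last exact: IH.
move=> x _; rewrite /dderiv.
rewrite (_ : (fun _ => _) = fun=> 0); first exact: cvg_cst.
by apply/funext => h; rewrite subrr scaler0.
Qed.

Lemma smooth_on_linear (U : set V) (a : R) (f g : V -> W) :
  smooth_on U f -> smooth_on U g -> smooth_on U (fun x => a *: f x + g x).
Proof.
move=> sf sg k; move: (sf k) (sg k); elim: k f g {sf sg} => [|k IH] f g.
  move=> [cf _] [cg _]; split=> // x Ux; apply: cvgD; last exact: cg.
  by apply: cvgZl_tmp; exact: cf.
move=> [cf df] [cg dg]; split.
  move=> x Ux; apply: cvgD; last exact: cg.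
  by apply: cvgZl_tmp; exact: cf.
move=> v; have [f' ff' sf'] := df v; have [g' gg' sg'] := dg v.
exists (fun x => a *: f' x + g' x); last exact: IH.
move=> x Ux; rewrite /dderiv.
rewrite (_ : (fun _ => _) = fun h : R => a *: (h^-1 *: (f (h *: v + x) - f x))
    + h^-1 *: (g (h *: v + x) - g x)).
  by apply: cvgD; [apply: cvgZl_tmp; exact: ff'|exact: gg'].
apply/funext => h; rewrite opprD addrACA -scalerBr scalerDr !scalerA.
by rewrite (mulrC a).
Qed.

End smooth_on_lemmas.

Record chart (R : realType) (n : nat) (M : topologicalType) := Chart {
  cdom : set M ;
  cmap :> M -> 'rV[R]_n ;
  cinv : 'rV[R]_n -> M ;
  cdom_open : open cdom ;
  crange_open : open (cmap @` cdom) ;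
  cmapK : forall x, cdom x -> cinv (cmap x) = x ;
  cmap_continuous : forall x, cdom x -> {for x, continuous cmap} ;
  cinv_continuous : forall p, (cmap @` cdom) p -> {for p, continuous cinv} }.

Definition crange (R : realType) (n : nat) (M : topologicalType)
  (c : chart R n M) : set 'rV[R]_n := c @` cdom c.

(* The atlas need not be maximal; it generates the smooth structure. *)
HB.mixin Record isManifold (R : realType) (n : nat) M & Topological M := {
  atlas : set (chart R n M) ;
  atlas_cover : forall x, exists2 c, atlas c & cdom c x ;
  atlas_compat : forall c d, atlas c -> atlas d ->
    smooth_on (c @` (cdom c `&` cdom d)) (d \o cinv c) ;
  manifold_hausdorff : hausdorff_space M ;
  manifold_second_countable : @second_countable M }.

#[short(type="manifoldType")]
HB.structure Definition Manifold (R : realType) (n : nat) :=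
  {M of isManifold R n M & Topological M}.

Arguments atlas {R n} M : rename.

Section smooth_maps.
Context {R : realType}.

Definition smooth_into (V : normedModType R) n (N : manifoldType R n)
    (U : set V) (f : V -> N) : Prop :=
  (forall x, U x -> {for x, continuous f}) /\
  forall d, atlas N d -> smooth_on (U `&` f @^-1` cdom d) (d \o f).

Definition smooth_map m n (M : manifoldType R m) (N : manifoldType R n)
    (f : M -> N) : Prop :=
  forall c, atlas M c -> smooth_into (crange c) (f \o cinv c).

(* Smoothness on the product manifold M1 * M2, read in product charts. *)
Definition smooth_map2 m1 m2 n (M1 : manifoldType R m1)
    (M2 : manifoldType R m2) (N : manifoldType R n) (f : M1 -> M2 -> N) : Prop :=
  forall c1 c2, atlas M1 c1 -> atlas M2 c2 ->
    smooth_into (crange c1 `*` crange c2)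
      (fun p => f (cinv c1 p.1) (cinv c2 p.2)).

Definition smooth_fun n (M : manifoldType R n) (f : M -> R) : Prop :=
  forall c, atlas M c -> smooth_on (crange c) (f \o cinv c : _ -> R^o).

End smooth_maps.

HB.mixin Record Manifold_isLieGroup (R : realType) (m : nat) G
    & Manifold R m G & monoid.Group G := {
  smooth_mulg : smooth_map2 (fun x y : G => (x * y)%g) ;
  smooth_invg : smooth_map (fun x : G => (x^-1)%g) }.

#[short(type="lieGroupType")]
HB.structure Definition LieGroup (R : realType) (m : nat) :=
  {G of Manifold_isLieGroup R m G & Manifold R m G & monoid.Group G}.

Section Cinf.
Context {R : realType} {n : nat} (M : manifoldType R n).

Definition smooth_pred : {pred M -> R} := fun f => `[< smooth_fun f >].

Lemma smooth_pred_submod : submod_closed smooth_pred.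
Proof.
split=> [|a f g]; first by apply/asboolP => c _; exact: smooth_on_cst.
move=> /asboolP sf /asboolP sg; apply/asboolP => c Mc.
exact: (smooth_on_linear _ (sf c Mc) (sg c Mc)).
Qed.

HB.instance Definition _ :=
  GRing.isSubmodClosed.Build R (M -> R) smooth_pred smooth_pred_submod.

(* C^oo(M, R) *)
Record Cinf := MkCinf { Cinf_fun :> M -> R ; _ : Cinf_fun \in smooth_pred }.

HB.instance Definition _ := [isSub for Cinf_fun].
HB.instance Definition _ := [Choice of Cinf by <:].
HB.instance Definition _ := [SubChoice_isSubLmodule of Cinf by <:].

(* The C^oo-topology: uniform convergence of all derivatives on compact
   subsets of the charts. *)
Definition Cinf_subbase : set (set Cinf) :=
  [set B | exists (f : Cinf) (c : chart R n M) (K : set M)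
      (vs : seq 'rV[R]_n) (e : R),
    [/\ atlas M c, compact K, K `<=` cdom c, 0 < e &
     B = [set g : Cinf | forall x, K x ->
       `|iterD vs (g \o cinv c : _ -> R^o) (c x)
         - iterD vs (f \o cinv c : _ -> R^o) (c x)| < e]]].

HB.instance Definition _ :=
  @isSubBaseTopological.Build Cinf (set Cinf) Cinf_subbase id.

End Cinf.

Section Diff.
Context {R : realType} {n : nat} (M : manifoldType R n).

Record Diff := MkDiff {
  Diff_fun :> M -> M ;
  Diff_smooth : smooth_map Diff_fun ;
  Diff_inv : exists g : M -> M,
    [/\ smooth_map g, cancel Diff_fun g & cancel g Diff_fun] }.

HB.instance Definition _ := gen_eqMixin Diff.
HB.instance Definition _ := gen_choiceMixin Diff.

(* The C^oo compact-open (weak Whitney) topology on Diff(M). *)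
Definition Diff_subbase : set (set Diff) :=
  [set B | exists (f : Diff) (c d : chart R n M) (K : set M)
      (vs : seq 'rV[R]_n) (e : R),
    [/\ atlas M c /\ atlas M d, compact K, K `<=` cdom c /\ f @` K `<=` cdom d,
     0 < e &
     B = [set g : Diff | g @` K `<=` cdom d /\ forall x, K x ->
       `|iterD vs (d \o g \o cinv c) (c x)
         - iterD vs (d \o f \o cinv c) (c x)| < e]]].

HB.instance Definition _ :=
  @isSubBaseTopological.Build Diff (set Diff) Diff_subbase id.

End Diff.

(* Tensor fields are families of local representatives, one for each chart of
   the atlas, related by the transition maps. Tangent vectors are row vectors
   in a chart, and linear maps act on the right: the differential of f maps v
   to [v *m 'J f p]. *)
Section tensors.
Context {R : realType} {n : nat} {M : manifoldType R n}.
Implicit Types (c d : chart R n M) (f : M -> M) (p u v : 'rV[R]_n).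

Definition local f c d : 'rV[R]_n -> 'rV[R]_n := d \o f \o cinv c.

(* p is the coordinate in c of a point that f maps into the domain of d. *)
Definition meets f c d p : Prop :=
  [/\ atlas M c, atlas M d, crange c p & cdom d (f (cinv c p))].

Definition pull_form f (w : chart R n M -> 'rV[R]_n -> 'cV[R]_n) c d p
    : 'cV[R]_n :=
  'J (local f c d) p *m w d (local f c d p).

Definition pull_bilin f (g : chart R n M -> 'rV[R]_n -> 'M[R]_n) c d p
    : 'M[R]_n :=
  'J (local f c d) p *m g d (local f c d p) *m ('J (local f c d) p)^T.

Definition is_form (w : chart R n M -> 'rV[R]_n -> 'cV[R]_n) : Prop :=
  (forall c, atlas M c -> smooth_on (crange c) (w c)) /\
  (forall c d p, meets idfun c d p -> w c p = pull_form idfun w c d p).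

Definition riemannian (g : chart R n M -> 'rV[R]_n -> 'M[R]_n) : Prop :=
  [/\ forall c, atlas M c -> smooth_on (crange c) (g c),
      forall c d p, meets idfun c d p -> g c p = pull_bilin idfun g c d p &
      forall c p, atlas M c -> crange c p ->
        (g c p)^T = g c p /\
        forall v, v != 0 -> 0 < (v *m g c p *m v^T) ord0 ord0].

Definition preserves_conformal g f : Prop :=
  exists h : M -> R,
    [/\ smooth_fun h, forall x, 0 < h x &
        forall c d p, meets f c d p ->
          pull_bilin f g c d p = h (cinv c p) *: g c p].

Variable w : chart R n M -> 'rV[R]_n -> 'cV[R]_n.

Definition pairing c p v : R := (v *m w c p) ord0 ord0.

(* The exterior derivative: dw(u, v) = u(w(v)) - v(w(u)) for constant u, v. *)
Definition dform c p u v : R :=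
  'D_u (fun q => pairing c q v : R^o) p - 'D_v (fun q => pairing c q u : R^o) p.

(* (w /\ (dw)^m)(u_0, ..., u_2m), up to a positive combinatorial factor. *)
Definition contact_volume (m : nat) c p (u : 'I_m.*2.+1 -> 'rV[R]_n) : R :=
  \sum_(s : 'S_m.*2.+1) (-1) ^+ s * pairing c p (u (s ord0)) *
    \prod_(i < m) dform c p (u (s (inord i.*2.+1))) (u (s (inord i.*2.+2))).

Definition contact_form : Prop :=
  is_form w /\
  exists2 m, n = m.*2.+1 & forall c p, atlas M c -> crange c p ->
    exists u : 'I_m.*2.+1 -> 'rV[R]_n, contact_volume c p u != 0.

(* Only the restriction of [J c p] to the kernel of w is meaningful: it is the
   local expression of an endomorphism of ker w, and the transition law is
   imposed on ker w only. *)
Variable J : chart R n M -> 'rV[R]_n -> 'M[R]_n.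

Definition complex_structure : Prop :=
  [/\ forall c, atlas M c -> smooth_on (crange c) (J c),
      forall c d p v, meets idfun c d p -> pairing c p v = 0 ->
        v *m J c p *m 'J (local idfun c d) p
        = v *m 'J (local idfun c d) p *m J d (local idfun c d p) &
      forall c p v, atlas M c -> crange c p -> pairing c p v = 0 ->
        pairing c p (v *m J c p) = 0 /\ v *m J c p *m J c p = - v].

Definition levi c p u v : R := dform c p (u *m J c p) v.

Definition pseudo_hermitian : Prop :=
  [/\ contact_form, complex_structure &
      forall c p, atlas M c -> crange c p ->
        (forall u v, pairing c p u = 0 -> pairing c p v = 0 ->
           levi c p u v = levi c p v u /\
           levi c p (u *m J c p) (v *m J c p) = levi c p u v) /\
        (forall u, pairing c p u = 0 -> u != 0 -> 0 < levi c p u u)].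

Definition preserves_CR f : Prop :=
  forall c d p, meets f c d p ->
    forall v,
      (pairing c p v = 0 <->
       pairing d (local f c d p) (v *m 'J (local f c d) p) = 0) /\
      (pairing c p v = 0 ->
       v *m J c p *m 'J (local f c d) p
       = v *m 'J (local f c d) p *m J d (local f c d p)).

End tensors.

Section actions.
Context {R : realType} {n m : nat} {M : manifoldType R n}
  {G : lieGroupType R m}.
Variable rho : G -> Diff M.

(* rho identifies the Lie group G with a closed subgroup of Diff(M) carrying
   the subspace topology. *)
Record closed_lie_subgroup : Prop := {
  rhoM : forall a b x, rho (a * b)%g x = rho a (rho b x) ;
  rho_inj : injective rho ;
  rho_embedding : forall A : set G,
    open A <-> exists2 B : set (Diff M), open B & A = rho @^-1` B ;
  rho_closed : closed (range rho) ;
  rho_smooth : smooth_map2 (fun a x => rho a x) }.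

Definition preserves_CR_structure : Prop :=
  exists w J, @pseudo_hermitian R n M w J /\
    forall a, preserves_CR w J (rho a).

Definition preserves_conformal_structure : Prop :=
  exists g, @riemannian R n M g /\ forall a, preserves_conformal g (rho a).

Definition proper_map (X Y : topologicalType) (f : X -> Y) : Prop :=
  continuous f /\ forall K, compact K -> compact (f @^-1` K).

Definition acts_properly : Prop :=
  proper_map (fun p : G * M => (rho p.1 p.2, p.2)).

Definition cochain (r : nat) := ('I_r -> G) -> Cinf M.

(* Smoothness of a map from G^r to the topological vector space C^oo(M, R),
   read in product charts. *)
Definition smooth_cochain r (l : cochain r) : Prop :=
  forall c : 'I_r -> chart R m G, (forall i, atlas G (c i)) ->
    smooth_on [set p : 'M[R]_(r, m) | forall i, crange (c i) (row i p)]
      (fun p => l (fun i => cinv (c i) (row i p))).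

Definition act (a : G) (f : M -> R) : M -> R := fun x => f (rho (a^-1)%g x).

(* (a_0, ..., a_i * a_(i+1), ..., a_r) *)
Definition merge_at r (i : 'I_r) (a : 'I_r.+1 -> G) : 'I_r -> G := fun j =>
  if (j < i)%N then a (widen_ord (leqnSn r) j)
  else if j == i then (a (widen_ord (leqnSn r) j) * a (lift ord0 j))%g
  else a (lift ord0 j).

Definition coboundary r (l : cochain r) (a : 'I_r.+1 -> G) : M -> R := fun x =>
  act (a ord0) (l (fun j => a (lift ord0 j))) x
  + \sum_(i < r) (-1) ^+ i.+1 * l (merge_at i a) x
  + (-1) ^+ r.+1 * l (fun j => a (widen_ord (leqnSn r) j)) x.

Definition is_coboundary r : cochain r -> Prop :=
  if r is r'.+1 then fun l =>
    exists2 k : cochain r', smooth_cochain k &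
      forall a x, l a x = coboundary k a x
  else fun l => forall a x, l a x = 0.

(* H^r_d(G, C^oo(M, R)) = 0 *)
Definition Hd_vanishes (r : nat) : Prop :=
  forall l : cochain r, smooth_cochain l ->
    (forall a x, coboundary l a x = 0) -> is_coboundary l.

End actions.

(* Main.v *)
(* If G preserves a conformal class [g] or a CR structure [ker w], the factors in
   a^* g = h_a g and a^* w = u_a w form multiplicative cocycles, and ln h_a and
   ln u_a^2 are smooth 1-cocycles (up to replacing a by its inverse). When
   H^1_d = 0 such a cocycle is k o a - k, and rescaling by a power of exp k makes
   g invariant, respectively makes w invariant up to sign. In the CR case
   w w^T + d w(J., .), the second term extended by zero along the Reeb field, is
   then an invariant Riemannian metric. So G is a closed group of isometries, and
   such a group acts properly: if a_i x_i and x_i converge along an ultrafilter,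
   the a_i converge pointwise on the connected manifold M; their first derivatives
   are bounded by the Cauchy-Schwarz inequality, and by Koszul's formula all higher
   derivatives are expressions in the first derivatives and the metric. Hence the
   a_i converge in Diff(M), with limit in G.

   Conversely, if G acts properly and l is a smooth 1-cocycle, choose countably many
   bump functions f_i >= 0 covering M and integrate against a left Haar integral I:
     F_i(x) = I(a |-> f_i(a^-1 x)),   K_i(x) = - I(a |-> l(a)(x) f_i(a^-1 x)).
   F_i is invariant and K_i(b^-1 x) = K_i(x) + l(b)(x) F_i(x). With invariant, locally
   finite weights w_i, the function (sum_i w_i K_i) / (sum_i w_i F_i) is smooth and has
   coboundary l. *)

(* Convergence is handled with ultrafilters: one that contains a compact set converges, so neither
   subsequences nor an equicontinuity theorem for function spaces is needed, and it matches
   properness as a statement about compact preimages. Limits are stated as continuous convergence,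
   with index and point moving together along [filter_prod F (nbhs p)]; compactness turns this into
   the uniform estimates that define the topologies of Diff(M) and C^oo(M, R).

   Taking ln u_a^2 forgets the sign of u_a. After rescaling the factor is a locally constant sign s;
   it drops out of w w^T, and s = -1 would negate the Levi form under a map that commutes with J,
   which positivity forbids unless ker w = 0.

   A cochain takes values in a topological vector space, so smooth functions on (chart of G) x M
   have to be turned into smooth C^oo-valued maps; integration over G only asks for a continuous
   parameter. This is why smoothness is developed with a parameter in a topological space.

   The weights w_i stand in for a partition of unity on the quotient M/G: the invariant functions
   F_i cut each other off, and no slice or quotient manifold is constructed. *)
From HB Require Import structures.
Require Import Defs.
From mathcomp Require Import all_boot all_order all_algebra all_fingroup.
From mathcomp Require Import all_classical all_reals all_analysis.
From mathcomp Require Import ring lra.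

Set Implicit Arguments.
Unset Strict Implicit.
Unset Printing Implicit Defensive.

Import Order.TTheory GRing.Theory Num.Theory.
Import numFieldNormedType.Exports.

Local Open Scope classical_set_scope.
Local Open Scope ring_scope.

(** * Smoothness with a continuous parameter *)

Lemma cvg_sumR {R : realType} {T I : Type} (F : set_system T) (r : seq I)
    (f : I -> T -> R) (l : I -> R) : Filter F ->
  (forall i, f i x @[x --> F] --> l i) ->
  \sum_(i <- r) f i x @[x --> F] --> \sum_(i <- r) l i.
Proof.
by move=> FF fl; apply: cvg_big => [|i _]; [exact: add_continuous|exact: fl].
Qed.

(* Stated for a variable topological space: on matrices [filterI] and
   [filter_forall] are unified against the unfolded product filter. *)
Lemma nearI {T : topologicalType} (x : T) (P Q : set T) :
  (\forall y \near x, P y) -> (\forall y \near x, Q y) ->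
  \forall y \near x, P y /\ Q y.
Proof. exact: filterI. Qed.

Lemma near_forall {T : topologicalType} {I : finType} (x : T) (P : I -> set T) :
  (forall i, \forall y \near x, P i y) -> \forall y \near x, forall i, P i y.
Proof. exact: filter_forall. Qed.

Lemma dderivP {R : realType} {V W : normedModType R} (f : V -> W) x v l :
  dderiv f x v l <-> is_derive x v f l.
Proof.
split=> [fl|[/cvg_ex[l' fl'] <-]].
  split; first by apply/cvg_ex; exists l.
  exact/cvg_lim.
by rewrite /dderiv /derive (cvg_lim _ fl').
Qed.

Section lines.
Context {R : realType} {V : normedModType R}.
Implicit Types (f : V -> R) (x v : V).

Lemma is_derive_line f x v r l :
  is_derive (r *: v + x) v f l -> is_derive r (1 : R) (fun s : R => f (s *: v + x)) l.
Proof.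
move=> /dderivP fl; apply/dderivP; rewrite /dderiv.
rewrite (_ : (fun _ => _) = fun h : R =>
  h^-1 *: (f (h *: v + (r *: v + x)) - f (r *: v + x))) //.
by apply/funext => h; rewrite addrA -scalerDl [_%:A]mulr1.
Qed.

(** Both signs of [t] are allowed and the intermediate point is located only by [|s| <= |t|], which
    suits two-sided difference quotients. *)
Lemma mvt_line f x v (t : R) :
  (forall s : R, `|s| <= `|t| -> derivable f (s *: v + x) v) ->
  exists2 s : R, `|s| <= `|t| & f (t *: v + x) - f x = t * 'D_v f (s *: v + x).
Proof.
move=> df; pose g (s : R) := f (s *: v + x).
have dg s : `|s| <= `|t| -> is_derive s (1 : R) g ('D_v f (s *: v + x)).
  by move=> st; apply: is_derive_line; apply/derivableP; exact: df.
have cg s : `|s| <= `|t| -> {for s, continuous g}.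
  move=> /dg dgs; apply: differentiable_continuous; apply/derivable1_diffP.
  exact: ex_derive.
have g0 : g 0 = f x by rewrite /g scale0r add0r.
have [t0|t0] := leP 0 t.
- have st s : s \in `[0, t] -> `|s| <= `|t|.
    by rewrite in_itv/= => /andP[s0 st]; rewrite !ger0_norm.
  have [||s s0t] := @MVT_segment R g (fun s => 'D_v f (s *: v + x)) 0 t t0.
  + move=> s s0t; apply: dg; apply: st.
    by move: s0t; rewrite !in_itv/= => /andP[/ltW-> /ltW->].
  + apply: continuous_in_subspaceT => s; rewrite inE => s0t.
    exact: cg (st _ s0t).
  + rewrite g0 subr0 mulrC => fE; exists s => //; exact: st.
- have st s : s \in `[t, 0] -> `|s| <= `|t|.
    rewrite in_itv/= => /andP[ts s0]; rewrite !ler0_norm ?lerN2//.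
    exact: ltW.
  have [||s s0t] := @MVT_segment R g (fun s => 'D_v f (s *: v + x)) t 0 (ltW t0).
  + move=> s s0t; apply: dg; apply: st.
    by move: s0t; rewrite !in_itv/= => /andP[/ltW-> /ltW->].
  + apply: continuous_in_subspaceT => s; rewrite inE => s0t.
    exact: cg (st _ s0t).
  + rewrite g0 sub0r mulrN => fE; exists s; first exact: st.
    by rewrite -opprB fE opprK mulrC.
Qed.

End lines.

(** * Differentiability of C^1 functions and the chain rule *)

Section row_vectors.
Context {R : realType} {n : nat}.
Implicit Types (p h v : 'rV[R]_n) (i j : 'I_n).

Lemma coord_le_norm v j : `|v ord0 j| <= `|v|.
Proof.
by rewrite [leRHS]/Num.Def.normr/= mx_normrE; exact: (le_bigmax _ _ (ord0, j)).
Qed.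

Lemma norm_le_coord v (e : R) : 0 <= e -> (forall j, `|v ord0 j| <= e) -> `|v| <= e.
Proof.
move=> e0 ve; rewrite [leLHS]/Num.Def.normr/= mx_normrE bigmax_le// => -[i j] _.
by rewrite ord1.
Qed.

Lemma norm_lt_coord v (e : R) : 0 < e -> (forall j, `|v ord0 j| < e) -> `|v| < e.
Proof.
move=> e0 ve; rewrite [ltLHS]/Num.Def.normr/= mx_normrE bigmax_lt// => -[i j] _.
by rewrite ord1.
Qed.

Definition ebase j : 'rV[R]_n := delta_mx ord0 j.

Lemma row_sum_ebase v : v = \sum_j v ord0 j *: ebase j.
Proof. exact: row_sum_delta. Qed.

(* The first [i] coordinates of [h]; the increments of a C^1 function are
   telescoped along these truncations. *)
Definition rtrunc (i : nat) h : 'rV[R]_n := \row_j (if (j < i)%N then h ord0 j else 0).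

Lemma rtrunc0 h : rtrunc 0 h = 0.
Proof. by apply/rowP => j; rewrite !mxE. Qed.

Lemma rtruncn h : rtrunc n h = h.
Proof. by apply/rowP => j; rewrite !mxE ltn_ord. Qed.

Lemma rtruncS i h : rtrunc i.+1 h = h ord0 i *: ebase i + rtrunc i h.
Proof.
apply/rowP => j; rewrite !mxE eqxx/= ltnS leq_eqVlt -val_eqE/= eq_sym.
case: eqP => [/val_inj->|/eqP ij]; first by rewrite ltnn mulr1 addr0.
by rewrite mulr0 add0r.
Qed.

Lemma norm_rtrunc_shift i (s : R) h : `|s| <= `|h ord0 i| ->
  `|s *: ebase i + rtrunc i h| <= `|h|.
Proof.
move=> sh; apply: norm_le_coord => // j; rewrite !mxE eqxx/=.
have [->|ji] := eqVneq j i; last first.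
  by rewrite mulr0 add0r; case: ifP => _; rewrite ?normr0// coord_le_norm.
by rewrite ltnn addr0 mulr1 (le_trans sh)// coord_le_norm.
Qed.

(** The mean value theorem turns the step from one truncation to the next into [h_i] times the i-th
    partial derivative at a point within [|h|] of [p]; continuity of that derivative at [p] makes
    the error small compared with [|h|]. *)
Lemma c1_differentiable (f : 'rV[R]_n -> R) p :
  (\forall x \near p, forall j, derivable f x (ebase j)) ->
  (forall j, {for p, continuous ('D_(ebase j) f)}) ->
  differentiable f p.
Proof.
move=> df cf.
have lin : linear (fun h => \sum_j h ord0 j * 'D_(ebase j) f p : R).
  move=> a u v; rewrite scaler_sumr -big_split/=; apply: eq_bigr => j _.
  by rewrite !mxE mulrDl -mulrA.
pose lM := GRing.isLinear.Build _ _ _ _ _ lin.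
pose L : {linear 'rV[R]_n -> R} := HB.pack (fun h => \sum_j h ord0 j * 'D_(ebase j) f p : R) lM.
have cL : continuous L.
  move=> x.
  apply: (@cvg_sumR R _ _ (nbhs x) _ (fun j (h : 'rV_n) => h ord0 j * 'D_(ebase j) f p)) => j. apply: cvgMr_tmp; exact: coord_continuous.
have E : f \o shift p = cst (f p) + L +o_ 0 id.
  apply/eqaddoP => e e0.
  (* An error [e / n.+1] for each coordinate adds up to at most [e * |h|], and [n.+1] is nonzero
     even when [n = 0]. *)
  have [d d0 dP] : exists2 d : R, 0 < d & forall y, `|y| < d ->
     (forall j, derivable f (y + p) (ebase j)) /\
     forall j, `|'D_(ebase j) f (y + p) - 'D_(ebase j) f p| <= e / n.+1%:R.
    have N : \forall y \near p, (forall j, derivable f y (ebase j)) /\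
        forall j, `|'D_(ebase j) f y - 'D_(ebase j) f p| <= e / n.+1%:R.
      apply: nearI; first exact: df.
      apply: near_forall => j.
      have /cvgrPdist_le /(_ (e / n.+1%:R)) := cf j.
      rewrite divr_gt0// => /(_ isT); apply: filterS => y.
      by rewrite distrC.
    have /nbhs_ballP[d d0 dP] := N; exists d => // y yd.
    by apply: dP; rewrite -ball_normE/= opprD addrCA subrr addr0 normrN.
  have N0 : \forall h \near (0 : 'rV[R]_n), `|h| < d by exact: nbhs0_lt.
  near=> h.
  have hd : `|h| < d by near: h; exact: N0.
  have step (i : 'I_n) : `|f (rtrunc i.+1 h + p) - f (rtrunc i h + p)
      - h ord0 i * 'D_(ebase i) f p| <= `|h| * (e / n.+1%:R).
    rewrite rtruncS -(addrA (h ord0 i *: ebase i)).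
    have [|s sh ->] := @mvt_line R _ f (rtrunc i h + p) (ebase i) (h ord0 i).
      move=> s /norm_rtrunc_shift sh; rewrite addrA.
      exact: (dP _ (le_lt_trans sh hd)).1.
    rewrite addrA -mulrBr normrM ler_pM// ?coord_le_norm//.
    exact: (dP _ (le_lt_trans (norm_rtrunc_shift sh) hd)).2.
  have tele k : (k <= n)%N -> `|f (rtrunc k h + p) - f p
      - \sum_(i < n | (i < k)%N) h ord0 i * 'D_(ebase i) f p|
      <= (\sum_(i < n | (i < k)%N) `|h| * (e / n.+1%:R)).
    elim: k => [_|k IH kn].
      by rewrite rtrunc0 add0r subrr !big_pred0// subr0 normr0.
    have ik (P : 'I_n -> R) : \sum_(i < n | (i < k.+1)%N) P i =
        P (Ordinal kn) + \sum_(i < n | (i < k)%N) P i.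
      rewrite (bigD1 (Ordinal kn))//=; congr (_ + _); apply: eq_bigl => i.
      by rewrite ltnS -val_eqE/= ltn_neqAle andbC.
    rewrite !ik; have := step (Ordinal kn) => /= st.
    apply: le_trans (lerD st (IH (ltnW kn))); apply: le_trans (ler_normD _ _).
    rewrite le_eqVlt; apply/orP; left; apply/eqP; congr (`|_|); ring.
  have := tele n (leqnn n); rewrite rtruncn.
  under eq_bigl do rewrite ltn_ord.
  under [X in _ <= X -> _]eq_bigl do rewrite ltn_ord.
  rewrite sumr_const card_ord => H.
  rewrite /=; apply: le_trans (le_trans H _).
    by rewrite !fctE/= opprD addrA.
  rewrite -[leLHS]mulr_natr -!mulrA [leRHS]mulrC ler_wpM2l//.
  have n1 : n.+1%:R^-1 * n%:R <= 1 :> R.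
    by rewrite mulrC ler_pdivrMr// mul1r ler_nat.
  by apply: (le_trans (ler_wpM2l (ltW e0) n1)); rewrite mulr1.
have dL := diff_unique cL E.
apply/diff_locallyP; rewrite dL; split => //.
Unshelve. all: by end_near. Qed.

End row_vectors.

Lemma differentiable_D {R : realType} {n : nat} (g : 'rV[R]_n -> R) p v :
  differentiable g p -> 'D_v g p = \sum_j v ord0 j * 'D_(ebase j) g p.
Proof.
move=> dg; rewrite deriveE// {1}(row_sum_ebase v) linear_sum.
by apply: eq_bigr => j _; rewrite linearZ/= deriveE.
Qed.

Lemma is_derive_line0 {R : realType} {V W : normedModType R} (f : V -> W) x v l :
  is_derive x v f l <->
  is_derive (0 : R) (1 : R) (fun s : R => f (s *: v + x)) l.
Proof.
have E : (fun h : R => h^-1 *: (f (h *: v + x) - f x)) =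
    (fun h : R => h^-1 *: (f ((h *: (1 : R) + 0) *: v + x) - f (0 *: v + x))).
  by apply/funext => h; rewrite addr0 scale0r add0r [_%:A]mulr1.
by split=> /dderivP; rewrite /dderiv => H; apply/dderivP; rewrite /dderiv;
  [rewrite -E|rewrite E].
Qed.

(** Derivability of [f] along the single direction [v] is enough: on the line through [x],
    one-variable derivability is differentiability, so the chain rule for differentials applies to
    [g] and the curve [c]. *)
Lemma chain_rule {R : realType} {n : nat} {V : normedModType R}
    (g : 'rV[R]_n -> R) (f : V -> 'rV[R]_n) x v :
  differentiable g (f x) -> (forall j, derivable (fun y => f y ord0 j) x v) ->
  is_derive x v (g \o f)
    (\sum_j 'D_v (fun y => f y ord0 j) x * 'D_(ebase j) g (f x)).
Proof.
move=> dg dfj; have df : derivable f x v.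
  by apply/derivable_mxP => i j; rewrite ord1.
pose c (h : R) := f (h *: v + x).
have c0 : c 0 = f x by rewrite /c scale0r add0r.
have dc : differentiable c 0.
  by apply/derivable1_diffP; move/derivable1P : df.
have dg0 : differentiable g (c 0) by rewrite c0.
have dgc : differentiable (g \o c) 0 by exact: (differentiable_comp dc dg0).
have dgf : derivable (g \o f) x v.
  by apply/(derivable1P (g \o f)); apply/derivable1_diffP.
have cE : is_derive (0 : R) (1 : R) c ('D_v f x).
  exact: (iffLR (is_derive_line0 f x v _) (derivableP df)).
have gfE : is_derive (0 : R) (1 : R) (g \o c) ('D_v (g \o f) x).
  exact: (iffLR (is_derive_line0 (g \o f) x v _) (derivableP dgf)).
apply: DeriveDef => //; rewrite -(@derive_val _ _ _ _ _ _ _ gfE).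
rewrite deriveE// diff_comp//= -(deriveE _ dc) (@derive_val _ _ _ _ _ _ _ cE).
rewrite -deriveE// c0 differentiable_D//; apply: eq_bigr => j _.
by rewrite derive_mx// mxE.
Qed.

Lemma continuous_near_eq {S : topologicalType} {W : topologicalType}
    (f g : S -> W) (z : S) :
  (\forall y \near z, f y = g y) -> {for z, continuous f} ->
  {for z, continuous g}.
Proof.
move=> fg cf; rewrite /prop_for/continuous_at -(nbhs_singleton fg).
by apply: cvg_trans cf; exact: near_eq_cvg.
Qed.

Lemma pair_continuous {S A B : topologicalType} (f : S -> A) (g : S -> B) z :
  {for z, continuous f} -> {for z, continuous g} ->
  {for z, continuous (fun s => (f s, g s))}.
Proof. by move=> cf cg; exact: cvg_pair. Qed.

Section parametric.
Context {R : realType} {T : topologicalType} {V : normedModType R}.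
Implicit Types (U : set (T * V)) (f g : T -> V -> R).

Definition pcont U f :=
  forall z, U z -> {for z, continuous (fun z : T * V => f z.1 z.2)}.

(* C^k in the second variable, with all derivatives continuous in both; the
   first variable is a mere parameter in a topological space. *)
Fixpoint pCk (k : nat) U f : Prop :=
  pcont U f /\
  if k is k'.+1 then
    forall v, (forall z, U z -> derivable (f z.1) z.2 v) /\
              pCk k' U (fun t => 'D_v (f t))
  else True.

Definition psm U f := forall k, pCk k U f.

Lemma near_slice U z : open U -> U z -> \forall y \near z.2, U (z.1, y).
Proof.
move=> oU Uz; have : nbhs z U by exact: open_nbhs_nbhs.
rewrite {1}(surjective_pairing z) => -[[A B] [/= Az Bz] AB].
by apply: filterS Bz => y By; apply: AB; split => //=; exact: nbhs_singleton.
Qed.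

Lemma slice_continuous t y : {for y, continuous (fun y : V => (t, y) : T * V)}.
Proof. by apply: cvg_pair => //=; exact: cvg_cst. Qed.

Lemma pcont_slice U f z : U z -> pcont U f -> {for z.2, continuous (f z.1)}.
Proof.
move=> Uz cf; apply: (@continuous_comp _ _ _ (fun y : V => (z.1, y))
  (fun z : T * V => f z.1 z.2)); first exact: slice_continuous.
by rewrite -surjective_pairing; exact: cf.
Qed.

Lemma pcont_ext U f g : open U -> (forall z, U z -> f z.1 z.2 = g z.1 z.2) ->
  pcont U f -> pcont U g.
Proof.
move=> oU fg cf z Uz; apply: continuous_near_eq (cf z Uz).
by apply: filterS (open_nbhs_nbhs (conj oU Uz)) => y; exact: fg.
Qed.

Lemma pCk_cont k U f : pCk k U f -> pcont U f.
Proof. by case: k => [|k] []. Qed.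

Lemma near_slice_eq U f g z : open U -> U z ->
  (forall z, U z -> f z.1 z.2 = g z.1 z.2) ->
  \forall y \near z.2, f z.1 y = g z.1 y.
Proof.
by move=> oU Uz fg; apply: filterS (near_slice oU Uz) => y /fg.
Qed.

Lemma pCk_ext k U f g : open U -> (forall z, U z -> f z.1 z.2 = g z.1 z.2) ->
  pCk k U f -> pCk k U g.
Proof.
move=> oU; elim: k f g => [|k IH] f g fg /= [cf df].
  by split => //; exact: pcont_ext fg cf.
split; first exact: pcont_ext fg cf.
move=> v; have [dfv kf] := df v; split.
  move=> z Uz; apply: near_eq_derivable (dfv z Uz).
  exact: near_slice_eq fg.
apply: IH kf => z Uz; apply: near_eq_derive.
exact: near_slice_eq fg.
Qed.

Lemma pCk_sub k U U' f : U' `<=` U -> pCk k U f -> pCk k U' f.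
Proof.
move=> UU; elim: k f => [|k IH] f /= [cf df].
  by split=> // z /UU; exact: cf.
split=> [z /UU|v]; first exact: cf.
by have [dfv kf] := df v; split=> [z /UU|]; [exact: dfv|exact: IH].
Qed.

(** [pCk] iterates the total operator ['D_v] instead of choosing derivatives for each domain, so
    local statements glue. *)
Lemma pCk_local k U f :
  (forall z, U z -> exists2 U', U' z & pCk k U' f) -> pCk k U f.
Proof.
elim: k f => [|k IH] f /= H.
  by split => // z /H[U' U'z [cf _]]; exact: cf.
split => [z /H[U' U'z [cf _]]|v]; first exact: cf.
split => [z /H[U' U'z [_ /(_ v)[df _]]]|]; first exact: df.
by apply: IH => z /H[U' U'z [_ /(_ v)[_ kf]]]; exists U'.
Qed.

Lemma pCkS_intro k U f : open U -> pcont U f ->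
  (forall v, exists2 f' : T -> V -> R,
    forall z, U z -> is_derive z.2 v (f z.1) (f' z.1 z.2) & pCk k U f') ->
  pCk k.+1 U f.
Proof.
move=> oU cf df; split => // v; have [f' ff' kf'] := df v; split.
  by move=> z /ff'[].
by apply: pCk_ext kf' => // z /ff'[].
Qed.

Lemma pCkS_der k U f z v : pCk k.+1 U f -> U z ->
  is_derive z.2 v (f z.1) ('D_v (f z.1) z.2).
Proof. by move=> [_ /(_ v)[df _]] Uz; apply/derivableP; exact: df. Qed.

Lemma pCkS_D k U f v : pCk k.+1 U f -> pCk k U (fun t => 'D_v (f t)).
Proof. by move=> [_ /(_ v)[]]. Qed.

Lemma pCkW k U f : pCk k.+1 U f -> pCk k U f.
Proof.
elim: k f => [|k IH] f; first by case=> cf _; split.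
move=> [cf df]; split => // v; have [dfv kf] := df v; split => //.
exact: IH.
Qed.

Lemma psm_D U f v : psm U f -> psm U (fun t => 'D_v (f t)).
Proof. by move=> sf k; exact: pCkS_D (sf k.+1). Qed.

Lemma psm_der U f z v : psm U f -> U z ->
  is_derive z.2 v (f z.1) ('D_v (f z.1) z.2).
Proof. by move=> sf; exact: pCkS_der (sf 1). Qed.

Lemma psm_cont U f : psm U f -> pcont U f.
Proof. by move=> sf; exact: pCk_cont (sf 0). Qed.

Lemma psm_ext U f g : open U -> (forall z, U z -> f z.1 z.2 = g z.1 z.2) ->
  psm U f -> psm U g.
Proof. by move=> oU fg sf k; exact: pCk_ext (sf k). Qed.

Lemma psm_sub U U' f : U' `<=` U -> psm U f -> psm U' f.
Proof. by move=> UU sf k; exact: pCk_sub (sf k). Qed.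

Lemma psm_local U f :
  (forall z, U z -> exists2 U', U' z & psm U' f) -> psm U f.
Proof.
by move=> H k; apply: pCk_local => z /H[U' U'z sf]; exists U'.
Qed.

Lemma pCk_par k U (c : T -> R) : open U ->
  (forall z, U z -> {for z.1, continuous c}) -> pCk k U (fun t _ => c t).
Proof.
move=> oU; elim: k c => [|k IH] c cc.
  split=> // z Uz; apply: (@continuous_comp _ _ _ fst c); last exact: cc.
  exact: cvg_fst.
apply: pCkS_intro => //; first exact: pCk_cont (IH c cc).
move=> v; exists (fun _ _ => 0) => [z _|]; first exact: is_derive_cst.
by apply: IH => z _; exact: cvg_cst.
Qed.

Lemma pCk_cst k U (c : R) : open U -> pCk k U (fun _ _ => c).
Proof. by move=> oU; apply: pCk_par => // z _; exact: cvg_cst. Qed.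

Lemma pCkD k U f g : open U -> pCk k U f -> pCk k U g ->
  pCk k U (fun t x => f t x + g t x).
Proof.
move=> oU; elim: k f g => [|k IH] f g kf kg.
  split=> // z Uz; apply: cvgD.
    exact: pCk_cont kf _ Uz.
  exact: pCk_cont kg _ Uz.
apply: pCkS_intro => // [z Uz|v].
  by apply: cvgD; [exact: pCk_cont kf _ Uz|exact: pCk_cont kg _ Uz].
exists (fun t x => 'D_v (f t) x + 'D_v (g t) x).
  move=> z Uz; have := pCkS_der v kf Uz; have := pCkS_der v kg Uz.
  by move=> dg df; exact: is_deriveD.
by apply: IH; exact: pCkS_D.
Qed.

Lemma pCkM k U f g : open U -> pCk k U f -> pCk k U g ->
  pCk k U (fun t x => f t x * g t x).
Proof.
move=> oU; elim: k f g => [|k IH] f g kf kg.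
  split=> // z Uz; apply: cvgM.
    exact: pCk_cont kf _ Uz.
  exact: pCk_cont kg _ Uz.
apply: pCkS_intro => // [z Uz|v].
  by apply: cvgM; [exact: pCk_cont kf _ Uz|exact: pCk_cont kg _ Uz].
exists (fun t x => f t x * 'D_v (g t) x + g t x * 'D_v (f t) x).
  move=> z Uz; have := pCkS_der v kf Uz; have := pCkS_der v kg Uz.
  by move=> dg df; exact: is_deriveM.
by apply: pCkD => //; apply: IH; [exact: pCkW|exact: pCkS_D|exact: pCkW|exact: pCkS_D].
Qed.

Lemma pCk_sum k U (I : Type) (r : seq I) (P : pred I) (f : I -> T -> V -> R) :
  open U -> (forall i, P i -> pCk k U (f i)) ->
  pCk k U (fun t x => \sum_(i <- r | P i) f i t x).
Proof.
move=> oU kf; elim: r => [|i r IH].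
  apply: pCk_ext (pCk_cst k 0 oU) => // z _; by rewrite big_nil.
case Pi : (P i).
  apply: pCk_ext (pCkD oU (kf i Pi) IH) => // z _.
  by rewrite big_cons Pi.
by apply: pCk_ext IH => // z _; rewrite big_cons Pi.
Qed.

Lemma pCk_prod k U (I : Type) (r : seq I) (P : pred I) (f : I -> T -> V -> R) :
  open U -> (forall i, P i -> pCk k U (f i)) ->
  pCk k U (fun t x => \prod_(i <- r | P i) f i t x).
Proof.
move=> oU kf; elim: r => [|i r IH].
  apply: pCk_ext (pCk_cst k 1 oU) => // z _; by rewrite big_nil.
case Pi : (P i).
  apply: pCk_ext (pCkM oU (kf i Pi) IH) => // z _.
  by rewrite big_cons Pi.
by apply: pCk_ext IH => // z _; rewrite big_cons Pi.
Qed.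

(* Composition with functions of one real variable taken from a family [P]
   that is stable under derivation on [D]. *)
Lemma pCk_comp_family (P : set (R -> R)) (D : set R) k U f :
  open U -> (forall h, P h -> forall x, D x -> {for x, continuous h}) ->
  (forall h, P h -> exists2 h', P h' &
     forall x, D x -> is_derive x (1 : R) h (h' x)) ->
  (forall z, U z -> D (f z.1 z.2)) -> pCk k U f ->
  forall h, P h -> pCk k U (fun t x => h (f t x)).
Proof.
move=> oU cP dP fD; elim: k => [|k IH] kf h Ph.
  split => // z Uz; apply: (@continuous_comp _ _ _ (fun z => f z.1 z.2) h).
    exact: pCk_cont kf _ Uz.
  by apply: cP => //; exact: fD.
apply: pCkS_intro => // [z Uz|v].
  apply: (@continuous_comp _ _ _ (fun z => f z.1 z.2) h).
    exact: pCk_cont kf _ Uz.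
  by apply: cP => //; exact: fD.
have [h' Ph' hh'] := dP h Ph.
exists (fun t x => h' (f t x) * 'D_v (f t) x).
  move=> z Uz; have dfz := pCkS_der v kf Uz; have dh := hh' _ (fD _ Uz).
  apply: (iffRL (is_derive_line0 (fun x => h (f z.1 x)) _ _ _)).
  apply: (@is_derive1_comp _ h (fun s : R => f z.1 (s *: v + z.2))).
    by rewrite scale0r add0r.
  exact: (iffLR (is_derive_line0 _ _ _ _)).
by apply: pCkM => //; [exact: IH (pCkW kf) _ Ph'|exact: pCkS_D].
Qed.

End parametric.

Lemma cvg_row {R : realType} n {S : Type} (F : set_system S) (f : S -> 'rV[R]_n)
    (l : 'rV[R]_n) : Filter F ->
  (forall j, f x ord0 j @[x --> F] --> l ord0 j) -> f x @[x --> F] --> l.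
Proof.
move=> FF fl; apply/cvgrPdist_le => e e0.
have H : \forall x \near F, forall j, `|l ord0 j - f x ord0 j| <= e.
  apply: (@filter_forall _ _ (fun j x => `|l ord0 j - f x ord0 j| <= e)) => j.
  by move/cvgrPdist_le : (fl j); exact.
by apply: filterS H => x H; apply: norm_le_coord (ltW e0) _ => j; rewrite !mxE.
Qed.

(** Induction on [k] through the chain rule: the derivative of the composite is a sum of products in
    which a partial derivative of [g], of one order of smoothness less, is again composed with
    [f]. *)
Lemma pCk_comp {R : realType} {T : topologicalType} {V : normedModType R} n k
    (W : set (T * 'rV[R]_n)) (U : set (T * V)) (g : T -> 'rV[R]_n -> R)
    (f : T -> V -> 'rV[R]_n) : open W -> open U ->
  pCk k W g -> (forall j, pCk k U (fun t x => f t x ord0 j)) ->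
  (forall z, U z -> W (z.1, f z.1 z.2)) -> pCk k U (fun t x => g t (f t x)).
Proof.
move=> oW oU kg kf fUW.
have cfg k' g' : pCk k' W g' -> pcont U (fun t x => g' t (f t x)).
  move=> kg' z Uz.
  apply: (@continuous_comp _ _ _ (fun z => (z.1, f z.1 z.2))
    (fun z : T * 'rV[R]_n => g' z.1 z.2)); last exact: pCk_cont kg' _ (fUW z Uz).
  apply: (@pair_continuous _ _ _ fst (fun z => f z.1 z.2)); first exact: cvg_fst.
  apply: (@cvg_row _ _ _ (nbhs z) (fun z => f z.1 z.2)) => j.
  exact: pCk_cont (kf j) _ Uz.
elim: k g kg kf => [|k IH] g kg kf; first by split=> //; exact: cfg kg.
apply: pCkS_intro => //; first exact: cfg kg.
move=> v.
exists (fun t x => \sum_j 'D_v (fun y => f t y ord0 j) x *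
                          'D_(ebase j) (g t) (f t x)).
  move=> z Uz; apply: chain_rule.
    have Wz := fUW z Uz; apply: c1_differentiable.
      apply: filterS (near_slice oW Wz) => y Wy j.
      by have [] := pCkS_der (ebase j) kg Wy.
    by move=> j; exact: (pcont_slice Wz (pCk_cont (pCkS_D (ebase j) kg))).
  by move=> j; have [] := pCkS_der v (kf j) Uz.
apply: pCk_sum => // j _; apply: pCkM => //; first exact: pCkS_D (kf j).
by apply: (IH (fun t => 'D_(ebase j) (g t))) => [|i]; [exact: pCkS_D|exact: pCkW].
Qed.

(** * The exponential cutoff and its derivatives *)

Section flat_functions.
Context {R : realType}.
Implicit Types (j : nat) (t : R).

(** [theta 0] is the classical smooth function that is flat at 0; the powers of [t^-1] are those
    that differentiation produces. *)
Definition theta j t : R := if 0 < t then t^-1 ^+ j * expR (- t^-1) else 0.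

Lemma theta_ge0 j t : 0 <= theta j t.
Proof.
rewrite /theta; case: ifP => // t0.
by rewrite mulr_ge0 ?expR_ge0// exprn_ge0// invr_ge0 ltW.
Qed.

Lemma theta_gt0 j t : (0 < theta j t) = (0 < t).
Proof.
rewrite /theta; case: ifP => [t0|]; last by rewrite ltxx.
by rewrite mulr_gt0 ?expR_gt0// exprn_gt0// invr_gt0.
Qed.

(** From the exponential series, [expR x] is at least [x^(j+1) / (j+1)!], here with [x = t^-1]. The
    linear bound yields the derivative 0 at the origin. *)
Lemma theta_le j t : theta j t <= j.+1`!%:R * `|t|.
Proof.
rewrite /theta; case: ifPn => [t0|_]; last by rewrite mulr_ge0.
have := @expR_ge1Dxn R t^-1 j; rewrite invr_ge0 (ltW t0) => /(_ isT) H.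
rewrite expRN ler_pdivrMr ?expR_gt0// gtr0_norm//.
rewrite -mulrA [t * _]mulrC mulrA -ler_pdivrMr//.
rewrite -ler_pdivrMl; last by rewrite ltr0n fact_gt0.
apply: le_trans H; rewrite mulrC -[_ / t]exprSr.
by rewrite lerDr.
Qed.

(** A family stable under derivation, as [pCk_comp_family] demands: [theta j] differentiates to a
    combination of the next two members. *)
Inductive flat : (R -> R) -> Prop :=
| flat_theta j : flat (theta j)
| flat_lin (a : R) h1 h2 : flat h1 -> flat h2 -> flat (fun x => a * h1 x + h2 x).

Lemma is_derive_theta j t :
  is_derive t (1 : R) (theta j) (- j%:R * theta j.+1 t + theta j.+2 t).
Proof.
have [t0|t0|->] := ltgtP t 0.
- have -> : - j%:R * theta j.+1 t + theta j.+2 t = 0.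
    by rewrite /theta !ltNge (ltW t0)/= mulr0 addr0.
  apply: (@near_eq_is_derive _ _ _ (cst 0)).
  near=> y; rewrite /theta /cst ltNge ltW//.
  by near: y; exact: lt_nbhsl.
- apply: (@near_eq_is_derive _ _ _ (fun t => t^-1 ^+ j * expR (- t^-1))).
    near=> y; rewrite /theta [(0 < y)%R](_ : _ = true)//.
    by near: y; exact: lt_nbhsr.
  have dV : is_derive t (1 : R) (fun y : R => y^-1) (- t^-1 ^+ 2).
    have := @is_deriveV R id t 1 1; rewrite gt_eqF// => /(_ isT (is_derive_id _ _)).
    by rewrite exprVn /= -[_ *: 1]/(_ * 1) mulr1.
  have dX := @is_deriveX _ _ (fun y : R => y^-1) j t 1 _ dV.
  have dN := @is_deriveN _ _ _ (fun y : R => y^-1) t 1 _ dV.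
  have dE := @is_derive1_comp _ expR _ t _ _ (is_derive_expR _) dN.
  have := is_deriveM dX dE.
  rewrite !exprfctE /theta t0; set s := t^-1 => H.
  match type of H with is_derive _ _ _ ?l => suff <- : l =
    - j%:R * (s ^+ j.+1 * expR (- s)) + s ^+ j.+2 * expR (- s) by exact: H end.
  rewrite /GRing.scale/= !fctE -/s opprK.
  case: (j) => [|i].
    by rewrite !expr0 mul0r !mul0r mulr0 addr0 oppr0 mul0r add0r mul1r mulrC.
  by rewrite /= !exprS; ring.
- have -> : - j%:R * theta j.+1 0 + theta j.+2 0 = 0 :> R.
    by rewrite /theta ltxx mulr0 addr0.
  apply/dderivP; rewrite /dderiv /theta ltxx.
  apply/cvgrPdist_le => e e0; near=> h.
  rewrite sub0r normrN subr0 [_%:A]mulr1 addr0.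
  (* Dividing by [h] raises the index, so the difference quotient at 0 is [theta j.+1 h], and
     [theta_le] sends it to 0. *)
  have -> : h^-1 *: (if 0 < h then h^-1 ^+ j * expR (- h^-1) else 0 : R) = theta j.+1 h.
    rewrite /theta; case: ifP => _; last by rewrite scaler0.
    by rewrite exprS -mulrA.
  rewrite ger0_norm ?theta_ge0//; apply: le_trans (theta_le _ _) _.
  rewrite -ler_pdivlMl ?ltr0n ?fact_gt0//.
  near: h; apply: dnbhs0_le; rewrite mulr_gt0// invr_gt0 ltr0n fact_gt0//.
Unshelve. all: by end_near. Qed.

Lemma flat_derive h : flat h ->
  exists2 h', flat h' & forall x, is_derive x (1 : R) h (h' x).
Proof.
elim=> [j|a h1 h2 _ [h1' fh1 dh1] _ [h2' fh2 dh2]].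
  exists (fun x => - j%:R * theta j.+1 x + theta j.+2 x).
    by apply: flat_lin; exact: flat_theta.
  by move=> x; exact: is_derive_theta.
exists (fun x => a * h1' x + h2' x); first exact: flat_lin.
move=> x; apply: is_deriveD.
Qed.

End flat_functions.

Lemma is_derive_continuous {R : realType} (h : R -> R) (x l : R) :
  is_derive x (1 : R) h l -> {for x, continuous h}.
Proof. by case=> dh _; exact/differentiable_continuous/derivable1_diffP. Qed.

Section psm_compositions.
Context {R : realType} {T : topologicalType} {V : normedModType R}.
Implicit Types (U : set (T * V)) (f g : T -> V -> R).

Lemma psm_theta U f j : open U -> psm U f -> psm U (fun t x => theta j (f t x)).
Proof.
move=> oU sf k; apply: (pCk_comp_family (P := flat) (D := setT)) => //.
- by move=> h /flat_derive[h' _ dh] x _; exact: is_derive_continuous (dh x).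
- by move=> h /flat_derive[h' fh' dh]; exists h'.
- exact: flat_theta.
Qed.

Lemma psm_exp U f : open U -> psm U f -> psm U (fun t x => expR (f t x)).
Proof.
move=> oU sf k; apply: (pCk_comp_family (P := [set expR]) (D := setT)) => //.
- by move=> h -> x _; exact: continuous_expR.
- by move=> h ->; exists expR => // x _; exact: is_derive_expR.
Qed.

Lemma pCk_inv k U f : open U -> (forall z, U z -> f z.1 z.2 != 0) ->
  pCk k U f -> pCk k U (fun t x => (f t x)^-1).
Proof.
move=> oU f0; elim: k => [|k IH] kf.
  by split=> // z Uz; apply: cvgV; [exact: f0|exact: pCk_cont kf _ Uz].
apply: pCkS_intro => // [z Uz|v].
  by apply: cvgV; [exact: f0|exact: pCk_cont kf _ Uz].
exists (fun t x => -1 * ((f t x)^-1 * (f t x)^-1) * 'D_v (f t) x).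
  move=> z Uz; have [dfz _] := pCkS_der v kf Uz.
  split; first by apply: derivableV => //; exact: f0.
  rewrite deriveV//; last exact: f0.
  by rewrite /GRing.scale/= -exprVn expr2 mulN1r.
have kV := IH (pCkW kf).
apply: pCkM => //; last exact: pCkS_D.
by apply: pCkM; [|exact: pCk_cst|exact: pCkM].
Qed.

Lemma psm_inv U f : open U -> (forall z, U z -> f z.1 z.2 != 0) ->
  psm U f -> psm U (fun t x => (f t x)^-1).
Proof. by move=> oU f0 sf k; apply: pCk_inv. Qed.

Lemma psm_ln U f : open U -> (forall z, U z -> 0 < f z.1 z.2) ->
  psm U f -> psm U (fun t x => ln (f t x)).
Proof.
move=> oU f0 sf k; have cl : pcont U (fun t x => ln (f t x)).
  move=> z Uz; apply: (@continuous_comp _ _ _ (fun z => f z.1 z.2) (@ln R)).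
    exact: psm_cont sf _ Uz.
  by apply: continuous_ln; exact: f0.
case: k => [//|k]; apply: pCkS_intro => // v.
exists (fun t x => (f t x)^-1 * 'D_v (f t) x).
  move=> z Uz; apply: (iffRL (is_derive_line0 (fun x => ln (f z.1 x)) _ _ _)).
  apply: (@is_derive1_comp _ (@ln R) (fun s : R => f z.1 (s *: v + z.2))).
    by rewrite scale0r add0r; apply: is_derive1_ln; exact: f0.
  exact: (iffLR (is_derive_line0 _ _ _ _) (psm_der v sf Uz)).
apply: pCkM => //; last exact: psm_D sf _.
by apply: pCk_inv => // z /f0; exact: lt0r_neq0.
Qed.

Lemma psmD U f g : open U -> psm U f -> psm U g -> psm U (fun t x => f t x + g t x).
Proof. by move=> oU sf sg k; exact: pCkD. Qed.

Lemma psmM U f g : open U -> psm U f -> psm U g -> psm U (fun t x => f t x * g t x).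
Proof. by move=> oU sf sg k; exact: pCkM. Qed.

Lemma psm_cst U c : open U -> psm U (fun _ _ => c).
Proof. by move=> oU k; exact: pCk_cst. Qed.

Lemma psmZ U a f : open U -> psm U f -> psm U (fun t x => a * f t x).
Proof. by move=> oU sf; apply: psmM => //; exact: psm_cst. Qed.

Lemma psmN U f : open U -> psm U f -> psm U (fun t x => - f t x).
Proof.
move=> oU sf; apply: psm_ext (psmZ (-1) oU sf) => // z _.
by rewrite mulN1r.
Qed.

Lemma psmB U f g : open U -> psm U f -> psm U g -> psm U (fun t x => f t x - g t x).
Proof. by move=> oU sf sg; apply: psmD => //; exact: psmN. Qed.

Lemma psm_sum U (I : Type) (r : seq I) (P : pred I) (f : I -> T -> V -> R) :
  open U -> (forall i, P i -> psm U (f i)) ->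
  psm U (fun t x => \sum_(i <- r | P i) f i t x).
Proof. by move=> oU sf k; apply: pCk_sum => // i /sf. Qed.

Lemma psm_prod U (I : Type) (r : seq I) (P : pred I) (f : I -> T -> V -> R) :
  open U -> (forall i, P i -> psm U (f i)) ->
  psm U (fun t x => \prod_(i <- r | P i) f i t x).
Proof. by move=> oU sf k; apply: pCk_prod => // i /sf. Qed.

Lemma psm_additive U (l : V -> R) : open U -> continuous l ->
  (forall (h : R) u v, l (h *: u + v) = h * l u + l v) -> psm U (fun _ x => l x).
Proof.
move=> oU cl ll k; have cU : pcont U (fun _ => l).
  move=> z _; apply: (@continuous_comp _ _ _ snd l); last exact: cl.
  exact: cvg_snd.
case: k => [//|k]; apply: pCkS_intro => // v.
exists (fun _ _ => l v); last exact: pCk_cst.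
move=> z _; apply/dderivP; rewrite /dderiv.
apply/cvgrPdist_le => e e0; near=> h.
rewrite ll addrK [_ *: _](_ : _ = h^-1 * (h * l v))// mulKf ?subrr ?normr0 ?ltW//.
by near: h; exact: nbhs_dnbhs_neq.
Unshelve. all: by end_near. Qed.

Lemma psm_iterD U f vs : psm U f -> psm U (fun t => Defs.iterD vs (f t)).
Proof. by move=> sf; elim: vs => [//|v vs IH] /=; exact: psm_D. Qed.

End psm_compositions.

Lemma psm_comp {R : realType} {T : topologicalType} {V : normedModType R} n
    (W : set (T * 'rV[R]_n)) (U : set (T * V)) (g : T -> 'rV[R]_n -> R)
    (f : T -> V -> 'rV[R]_n) : open W -> open U ->
  psm W g -> (forall j, psm U (fun t x => f t x ord0 j)) ->
  (forall z, U z -> W (z.1, f z.1 z.2)) -> psm U (fun t x => g t (f t x)).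
Proof.
move=> oW oU sg sf UW k; apply: (pCk_comp oW oU (sg k)) => // j.
exact: sf.
Qed.

Lemma psm_reparam {R : realType} {S T : topologicalType} {V : normedModType R}
    (s : S -> T) (U : set (T * V)) (f : T -> V -> R) : continuous s ->
  psm U f -> psm [set z | U (s z.1, z.2)] (fun a => f (s a)).
Proof.
move=> cs sf k; elim: k f sf => [|k IH] f sf.
  split=> // z Uz; apply: (@continuous_comp _ _ _ (fun z => (s z.1, z.2))
    (fun z : T * V => f z.1 z.2)); last exact: psm_cont sf _ Uz.
  apply: pair_continuous; last exact: cvg_snd.
  by apply: continuous_comp; [exact: cvg_fst|exact: cs].
split; first exact: pCk_cont (IH f sf).
move=> v; split=> [z Uz|]; first by have [] := psm_der v sf Uz.
by apply: (IH (fun t => 'D_v (f t))); exact: psm_D.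
Qed.

Lemma dist_half {R : realType} (e a b c : R) :
  `|a - c| <= e / 2 -> `|b - c| <= e / 2 -> `|a - b| <= e.
Proof.
move=> ac bc; rewrite (splitr e) -(subrKA c).
by rewrite (le_trans (ler_normD _ _))// lerD// distrC.
Qed.

(** * Symmetry of second derivatives *)

Section schwarz.
Context {R : realType} {V : normedModType R}.
Implicit Types (f : V -> R) (x u v : V).

Lemma near_box (P : set V) x u v : (\forall y \near x, P y) ->
  exists2 h : R, 0 < h & forall s t : R, `|s| <= h -> `|t| <= h ->
    P (s *: u + (t *: v + x)).
Proof.
move=> /nbhs_ballP[d /= d0 dP]; pose c := `|u| + `|v| + 1.
have c0 : 0 < c by rewrite ltr_wpDl// addr_ge0.
exists (d / c); first by rewrite divr_gt0.
move=> s t sh th; apply: dP; rewrite -ball_normE/= addrA opprD addrCA subrr addr0.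
rewrite normrN (le_lt_trans (ler_normD _ _))// !normrZ.
apply: (@le_lt_trans _ _ (d / c * (`|u| + `|v|))).
  by rewrite mulrDr lerD// ler_wpM2r.
by rewrite mulrAC ltr_pdivrMr// ltr_pM2l// /c ltrDl.
Qed.

Lemma is_derive_shift_dom f (a x u : V) (l : R) : is_derive (a + x) u f l ->
  is_derive x u (fun y => f (a + y)) l.
Proof.
move=> /dderivP H; apply/dderivP; move: H; rewrite /dderiv => H.
rewrite (_ : (fun _ => _) = fun h : R => h^-1 *: (f (h *: u + (a + x)) - f (a + x)))//.
by apply/funext => h; rewrite addrCA.
Qed.

Lemma mixed_difference f x u v (h : R) : 0 < h ->
  (forall s t : R, `|s| <= h -> `|t| <= h ->
    derivable f (s *: u + (t *: v + x)) u /\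
    derivable ('D_u f) (s *: u + (t *: v + x)) v) ->
  exists s t : R, [/\ `|s| <= h, `|t| <= h &
    f (h *: u + (h *: v + x)) - f (h *: u + x) - (f (h *: v + x) - f x)
    = h * (h * 'D_v ('D_u f) (s *: u + (t *: v + x)))].
Proof.
move=> h0 H; have hh : `|h| = h by rewrite gtr0_norm.
have H0 s : `|s| <= h -> is_derive (s *: u + x) u f ('D_u f (s *: u + x)).
  move=> sh; apply: derivableP; have := (H s 0 sh _).1.
  by rewrite scale0r add0r normr0 => /(_ (ltW h0)).
pose g y := f (h *: v + y) - f y.
have dg s : `|s| <= h -> is_derive (s *: u + x) u g
    ('D_u f (h *: v + (s *: u + x)) - 'D_u f (s *: u + x)).
  move=> sh; apply: is_deriveB; last exact: H0.
  apply: is_derive_shift_dom; apply: derivableP.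
  by rewrite addrCA; apply: (H s h sh _).1; rewrite hh.
have [s|s sh E1] := @mvt_line R V g x u h; first by rewrite hh => /dg[].
rewrite hh in sh; rewrite (@derive_val _ _ _ _ _ _ _ (dg s sh)) in E1.
have [t|t th E2] := @mvt_line R V ('D_u f) (s *: u + x) v h.
  by rewrite hh addrCA => th; exact: (H s t sh th).2.
rewrite hh in th; exists s, t; split => //.
rewrite [s *: u + (_ + _)]addrCA -E2 -E1 /g.
by rewrite [h *: v + (_ + _)]addrCA.
Qed.

(** The second difference is symmetric in [u] and [v], so [mixed_difference] equates values of the
    two mixed derivatives at points arbitrarily close to [x]; continuity does the rest. *)
Lemma schwarz f x u v :
  (\forall y \near x, (derivable f y u /\ derivable ('D_u f) y v) /\
     (derivable f y v /\ derivable ('D_v f) y u)) ->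
  {for x, continuous ('D_v ('D_u f))} -> {for x, continuous ('D_u ('D_v f))} ->
  'D_v ('D_u f) x = 'D_u ('D_v f) x.
Proof.
move=> df cvu cuv; apply/eqP; rewrite -subr_eq0 -normr_le0; apply/ler_addgt0Pl => e e0.
have e20 : 0 < e / 2 by rewrite divr_gt0.
move/cvgrPdist_le : cvu => /(_ _ e20) cvu.
move/cvgrPdist_le : cuv => /(_ _ e20) cuv.
have [h h0 hP] := near_box u v (nearI df (nearI cvu cuv)).
have [|s [t [sh th E1]]] := @mixed_difference f x u v h h0.
  by move=> s t sh th; exact: (hP s t sh th).1.1.
have [|t' [s' [th' sh' E2]]] := @mixed_difference f x v u h h0.
  by move=> t' s' th' sh'; rewrite addrCA; exact: (hP s' t' sh' th').1.2.
have hn0 : h != 0 by rewrite gt_eqF.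
have E : 'D_v ('D_u f) (s *: u + (t *: v + x)) = 'D_u ('D_v f) (t' *: v + (s' *: u + x)).
  apply: (mulfI hn0); apply: (mulfI hn0).
  apply: etrans (esym E1) _; apply: etrans _ E2.
  rewrite [h *: u + (h *: v + _)]addrCA.
  have aux (a b c d : R) : a - b - (c - d) = a - c - (b - d) by ring.
  exact: aux.
have [_ [+ _]] := hP _ _ sh th; rewrite E => A1.
have [_ [_]] := hP _ _ sh' th'; rewrite [s' *: u + _]addrCA => A2.
by rewrite addr0; exact: dist_half A1 A2.
Qed.

End schwarz.

Section plain_smoothness.
Context {R : realType}.

(* Plain smoothness is parametric smoothness with a trivial parameter. *)
Definition usm {V : normedModType R} (U : set V) (f : V -> R) : Prop :=
  psm [set z : bool * V | U z.2] (fun=> f).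

Lemma open_snd {T S : topologicalType} (U : set S) :
  open U -> open [set z : T * S | U z.2].
Proof. by move=> oU; apply: open_comp => // z _; exact: cvg_snd. Qed.

Lemma open_slice {T S : topologicalType} (t : T) (U : set (T * S)) :
  open U -> open [set y | U (t, y)].
Proof.
move=> oU; apply: (@open_comp _ _ (fun y => (t, y))) => // y _.
by apply: pair_continuous; [exact: cvg_cst|exact: cvg_id].
Qed.

Section usm.
Context {V : normedModType R}.
Implicit Types (U : set V) (f g : V -> R).

Lemma usm_psm {T : topologicalType} U f :
  usm U f -> psm [set z : T * V | U z.2] (fun=> f).
Proof. by move=> sf; apply: (psm_reparam (s := fun=> true) _ sf) => ?; exact: cvg_cst. Qed.

Lemma psm_usm {T : topologicalType} (U : set (T * V)) (f : T -> V -> R) t :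
  psm U f -> usm [set y | U (t, y)] (f t).
Proof. by move=> sf; apply: (psm_reparam (s := fun=> t) _ sf) => ?; exact: cvg_cst. Qed.

Lemma usm_cont U f x : usm U f -> U x -> {for x, continuous f}.
Proof.
move=> sf Ux; exact: (@pcont_slice _ _ _ _ _ (true, x) Ux (psm_cont sf)).
Qed.

Lemma usm_der U f x v : usm U f -> U x -> is_derive x v f ('D_v f x).
Proof. by move=> sf Ux; exact: (@psm_der _ _ _ _ _ (true, x) v sf Ux). Qed.

Lemma usm_D U f v : usm U f -> usm U ('D_v f).
Proof. exact: psm_D. Qed.

Lemma usm_iterD U f vs : usm U f -> usm U (Defs.iterD vs f).
Proof. exact: psm_iterD. Qed.

Lemma usm_ext U f g : open U -> (forall x, U x -> f x = g x) -> usm U f -> usm U g.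
Proof. by move=> oU fg; apply: psm_ext => [|z /fg]; first exact: open_snd. Qed.

Lemma usm_sub U U' f : U' `<=` U -> usm U f -> usm U' f.
Proof. by move=> UU; apply: psm_sub => z /UU. Qed.

Lemma usm_local U f : (forall x, U x -> exists2 U', U' x & usm U' f) -> usm U f.
Proof.
move=> H; apply: psm_local => -[b x] /= /H[U' U'x sf].
by exists [set z | U' z.2].
Qed.

Lemma usm_cst U c : open U -> usm U (fun=> c).
Proof. by move=> oU; apply: psm_cst; exact: open_snd. Qed.

Lemma usmD U f g : open U -> usm U f -> usm U g -> usm U (fun x => f x + g x).
Proof. by move=> oU; apply: psmD; exact: open_snd. Qed.

Lemma usmM U f g : open U -> usm U f -> usm U g -> usm U (fun x => f x * g x).
Proof. by move=> oU; apply: psmM; exact: open_snd. Qed.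

Lemma usmZ U a f : open U -> usm U f -> usm U (fun x => a * f x).
Proof. by move=> oU; apply: psmZ; exact: open_snd. Qed.

Lemma usmB U f g : open U -> usm U f -> usm U g -> usm U (fun x => f x - g x).
Proof. by move=> oU; apply: psmB; exact: open_snd. Qed.

Lemma usm_inv U f : open U -> (forall x, U x -> f x != 0) -> usm U f ->
  usm U (fun x => (f x)^-1).
Proof. by move=> oU f0; apply: psm_inv => [|z /f0]; first exact: open_snd. Qed.

Lemma usm_exp U f : open U -> usm U f -> usm U (fun x => expR (f x)).
Proof. by move=> oU; apply: psm_exp; exact: open_snd. Qed.

Lemma usm_ln U f : open U -> (forall x, U x -> 0 < f x) -> usm U f ->
  usm U (fun x => ln (f x)).
Proof. by move=> oU f0; apply: psm_ln => [|z /f0]; first exact: open_snd. Qed.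

Lemma usm_theta U f j : open U -> usm U f -> usm U (fun x => theta j (f x)).
Proof. by move=> oU; apply: psm_theta; exact: open_snd. Qed.

Lemma usm_sum U (I : Type) (r : seq I) (P : pred I) (f : I -> V -> R) :
  open U -> (forall i, P i -> usm U (f i)) ->
  usm U (fun x => \sum_(i <- r | P i) f i x).
Proof. by move=> oU sf; apply: psm_sum => //; exact: open_snd. Qed.

Lemma usm_prod U (I : Type) (r : seq I) (P : pred I) (f : I -> V -> R) :
  open U -> (forall i, P i -> usm U (f i)) ->
  usm U (fun x => \prod_(i <- r | P i) f i x).
Proof. by move=> oU sf; apply: psm_prod => //; exact: open_snd. Qed.

Lemma usm_additive U (l : V -> R) : open U -> continuous l ->
  (forall (h : R) u v, l (h *: u + v) = h * l u + l v) -> usm U l.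
Proof. by move=> oU cl ll; apply: psm_additive => //; exact: open_snd. Qed.

Lemma usm_schwarz U f x u v : open U -> usm U f -> U x ->
  'D_v ('D_u f) x = 'D_u ('D_v f) x.
Proof.
move=> oU sf Ux; apply: schwarz; last 2 first.
- by apply: (@usm_cont U) => //; do 2 apply: usm_D.
- by apply: (@usm_cont U) => //; do 2 apply: usm_D.
apply: filterS (open_nbhs_nbhs (conj oU Ux)) => y Uy.
have [df _] := usm_der u sf Uy; have [dg _] := usm_der v sf Uy.
have [ddf _] := usm_der v (usm_D u sf) Uy.
have [ddg _] := usm_der u (usm_D v sf) Uy.
exact: conj (conj df ddf) (conj dg ddg).
Qed.

End usm.

Lemma usm_comp {V : normedModType R} n (W : set 'rV[R]_n) (U : set V)
    (g : 'rV[R]_n -> R) (f : V -> 'rV[R]_n) : open W -> open U ->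
  usm W g -> (forall j, usm U (fun x => f x ord0 j)) ->
  (forall x, U x -> W (f x)) -> usm U (g \o f).
Proof.
move=> oW oU sg sf UW.
by apply: (psm_comp (open_snd oW) (open_snd oU) sg) => // z; exact: UW.
Qed.

Lemma usm_differentiable n (U : set 'rV[R]_n) (g : 'rV[R]_n -> R) x :
  open U -> usm U g -> U x -> differentiable g x.
Proof.
move=> oU sg Ux; apply: c1_differentiable.
  apply: filterS (open_nbhs_nbhs (conj oU Ux)) => y Uy j.
  by have [] := usm_der (ebase j) sg Uy.
by move=> j; apply: usm_cont (usm_D _ sg) Ux.
Qed.

(** Derivatives in the second variable are derivatives in the directions [(0, v)], which are
    continuous in both variables. *)
Lemma usm_curry {V1 V2 : normedModType R} (U : set (V1 * V2)) (f : V1 * V2 -> R) :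
  open U -> usm U f -> psm U (fun t x => f (t, x)).
Proof.
move=> oU sf k; elim: k f sf => [|k IH] f sf.
  split=> // -[t x] Ux /=.
  rewrite (_ : (fun z : V1 * V2 => f (z.1, z.2)) = f); first exact: usm_cont Ux.
  by apply/funext => -[].
apply: pCkS_intro => //; first exact: pCk_cont (IH f sf).
move=> v; exists (fun t x => 'D_(0, v) f (t, x)); last first.
  by apply: (IH ('D_(0, v) f)); exact: usm_D.
move=> [t x] Ux /=; have /dderivP H := usm_der (0, v) sf Ux; apply/dderivP.
move: H; rewrite /dderiv => H.
rewrite (_ : (fun _ => _) = fun h : R => h^-1 *: (f (h *: (0, v) + (t, x)) - f (t, x)))//.
apply/funext => h; congr (_ *: (f _ - _)).
by rewrite [RHS]surjective_pairing /= scaler0 add0r.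
Qed.

End plain_smoothness.

Section matrix_valued.
Context {R : realType}.

Lemma norm_mx_le m n (M : 'M[R]_(m, n)) (e : R) : 0 <= e ->
  (forall i j, `|M i j| <= e) -> `|M| <= e.
Proof.
move=> e0 Me; rewrite [leLHS]/Num.Def.normr/= mx_normrE bigmax_le//.
Qed.

Lemma cvg_mx m n {S : Type} (F : set_system S) (f : S -> 'M[R]_(m, n))
    (l : 'M[R]_(m, n)) :
  Filter F -> (forall i j, f x i j @[x --> F] --> l i j) -> f x @[x --> F] --> l.
Proof.
move=> FF fl; apply/cvgrPdist_le => e e0.
have H : \forall x \near F, forall i j, `|l i j - f x i j| <= e.
  apply: (@filter_forall _ _ (fun i x => forall j, `|l i j - f x i j| <= e)) => i.
  apply: (@filter_forall _ _ (fun j x => `|l i j - f x i j| <= e)) => j.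
  by move/cvgrPdist_le : (fl i j); exact.
by apply: filterS H => x H; apply: norm_mx_le (ltW e0) _ => i j; rewrite !mxE.
Qed.

Lemma is_derive_mxP {V : normedModType R} m n (f : V -> 'M[R]_(m, n)) x v l :
  is_derive x v f l <-> forall i j, is_derive x v (fun y => f y i j) (l i j).
Proof.
split=> [[df <-] i j|H].
  split; first by move/derivable_mxP : df; exact.
  by rewrite derive_mx// mxE.
have df : derivable f x v by apply/derivable_mxP => i j; have [] := H i j.
split=> //; rewrite derive_mx//; apply/matrixP => i j; rewrite mxE.
by have [] := H i j.
Qed.

(** [smooth_on] leaves the derivatives existential and unconstrained off [U], while [usm] iterates
    the total operator ['D_v]; on an open set, where a derivative depends only on nearby values, the
    two agree entry by entry. *)
Lemma smooth_on_mxP {V : normedModType R} m n (U : set V) (f : V -> 'M[R]_(m, n)) :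
  open U -> smooth_on U f <-> forall i j, usm U (fun x => f x i j).
Proof.
move=> oU; split=> [sf i j k|sf k].
  have := sf k => {sf}; elim: k f => [|k IH] f [cf df].
    split=> // -[b x] /= Ux.
    apply: (@continuous_comp _ _ _ snd (fun x => f x i j)); first exact: cvg_snd.
    apply: (@continuous_comp _ _ _ f (fun M : 'M[R]_(m, n) => M i j)).
      exact: cf.
    exact: coord_continuous.
  apply: (pCkS_intro (open_snd oU)).
    move=> -[b x] /= Ux.
    apply: (@continuous_comp _ _ _ snd (fun x => f x i j)); first exact: cvg_snd.
    apply: (@continuous_comp _ _ _ f (fun M : 'M[R]_(m, n) => M i j)).
      exact: cf.
    exact: coord_continuous.
  move=> v; have [f' ff' kf'] := df v; exists (fun _ x => f' x i j).
    move=> -[b x] /= Ux.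
    exact: (iffLR (is_derive_mxP _ _ _ _) (iffLR (dderivP _ _ _ _) (ff' x Ux)) i j).
  exact: IH.
elim: k f sf => [|k IH] f sf.
  split=> // x Ux; apply: cvg_mx => i j; exact: usm_cont (sf i j) Ux.
split; first by move=> x Ux; apply: cvg_mx => i j; exact: usm_cont (sf i j) Ux.
move=> v; exists (fun x => \matrix_(i, j) 'D_v (fun y => f y i j) x).
  move=> x Ux; apply/dderivP/is_derive_mxP => i j; rewrite mxE.
  exact: usm_der (sf i j) Ux.
apply: IH => i j; rewrite (_ : (fun _ => _) = 'D_v (fun y => f y i j)).
  exact: usm_D.
by apply/funext => x; rewrite mxE.
Qed.

Lemma smooth_on_RP {V : normedModType R} (U : set V) (f : V -> R) :
  open U -> smooth_on U (f : V -> R^o) <-> usm U f.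
Proof.
move=> oU; split=> [sf k|sf k].
  have := sf k => {sf}; elim: k f => [|k IH] f [cf df].
    split=> // -[b x] /= Ux.
    by apply: (@continuous_comp _ _ _ snd f); [exact: cvg_snd|exact: cf].
  apply: (pCkS_intro (open_snd oU)).
    move=> -[b x] /= Ux.
    by apply: (@continuous_comp _ _ _ snd f); [exact: cvg_snd|exact: cf].
  move=> v; have [f' ff' kf'] := df v; exists (fun _ x => f' x).
    by move=> -[b x] /= /ff' /dderivP.
  exact: IH.
elim: k f sf => [|k IH] f sf.
  by split=> // x Ux; exact: usm_cont sf Ux.
split; first by move=> x Ux; exact: usm_cont sf Ux.
move=> v; exists ('D_v f); last by apply: IH; exact: usm_D.
by move=> x Ux; apply/dderivP; exact: usm_der sf Ux.
Qed.

Lemma iterD_mx {V : normedModType R} m n (U : set V) (f : V -> 'M[R]_(m, n)) vs x i j :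
  open U -> (forall i j, usm U (fun x => f x i j)) -> U x ->
  Defs.iterD vs f x i j = Defs.iterD vs (fun x => f x i j : R^o) x.
Proof.
move=> oU sf; elim: vs x i j => [//|v vs IH] x i j Ux.
pose g y : 'M[R]_(m, n) := \matrix_(k, l) Defs.iterD vs (fun x => f x k l : R^o) y.
have E : \forall y \near x, g y = Defs.iterD vs f y.
  apply: filterS (open_nbhs_nbhs (conj oU Ux)) => y Uy.
  by apply/matrixP => k l; rewrite mxE IH.
have D : is_derive x v g (\matrix_(k, l) 'D_v (Defs.iterD vs (fun x => f x k l : R^o)) x).
  apply/is_derive_mxP => k l; rewrite mxE.
  rewrite (_ : (fun y => g y k l) = Defs.iterD vs (fun x => f x k l : R^o)).
    exact: usm_der (usm_iterD vs (sf k l)) Ux.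
  by apply/funext => y; rewrite mxE.
have D' := near_eq_is_derive E D.
by rewrite /= (@derive_val _ _ _ _ _ _ _ D') mxE.
Qed.

Lemma usm_coord n (U : set 'rV[R]_n) j : open U -> usm U (fun x => x ord0 j).
Proof.
move=> oU; apply: usm_additive => //; first exact: coord_continuous.
by move=> h u v; rewrite !mxE.
Qed.

End matrix_valued.

(** * Smooth functions and maps in charts *)

Lemma near_open {S : topologicalType} (P : set S) :
  (forall x, P x -> \forall y \near x, P y) -> open P.
Proof. by rewrite openE. Qed.

Lemma open_near {S : topologicalType} (P : set S) x : open P -> P x ->
  \forall y \near x, P y.
Proof. by move=> oP Px; exact: open_nbhs_nbhs. Qed.

Lemma dist_continuous {R : realType} {V : normedModType R} (a : V) :
  continuous (fun q => `|q - a|).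
Proof.
by move=> q; apply: cvg_norm; apply: cvgB; [exact: cvg_id|exact: cvg_cst].
Qed.

Section charts.
Context {R : realType} {n : nat} {M : manifoldType R n}.
Implicit Types (c d : chart R n M) (x y : M) (p q : 'rV[R]_n).

Lemma crange_open' c : open (crange c).
Proof. exact: crange_open. Qed.
Arguments crange_open' c : clear implicits.

Lemma crange_cmap c x : cdom c x -> crange c (c x).
Proof. by move=> cx; exists x. Qed.

Lemma cdom_cinv c p : crange c p -> cdom c (cinv c p).
Proof. by move=> [x cx <-]; rewrite cmapK. Qed.

Lemma cinvK c p : crange c p -> c (cinv c p) = p.
Proof. by move=> [x cx <-]; rewrite cmapK. Qed.

Lemma near_cdom c x : cdom c x -> \forall y \near x, cdom c y.
Proof. by move=> cx; apply: open_near => //; exact: cdom_open. Qed.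

Lemma near_crange c p : crange c p -> \forall q \near p, crange c q.
Proof. by move=> cp; apply: open_near => //; exact: crange_open'. Qed.

Lemma cinv_cts c p : crange c p -> {for p, continuous (cinv c)}.
Proof. exact: cinv_continuous. Qed.

Lemma near_cmap c x (P : set M) : cdom c x ->
  (\forall y \near x, P y) -> \forall p \near c x, P (cinv c p).
Proof.
move=> cx Px; apply: (cinv_cts (crange_cmap cx)).
by rewrite cmapK.
Qed.

Lemma near_cinv c x (P : set 'rV[R]_n) : cdom c x ->
  (\forall p \near c x, P p) -> \forall y \near x, P (c y).
Proof. by move=> cx Px; exact: (cmap_continuous cx). Qed.

Lemma chart_at x : exists2 c, atlas M c & cdom c x.
Proof. exact: atlas_cover. Qed.

Lemma open_chart_set {T : topologicalType} c (U : set (T * M)) : open U ->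
  open [set z : T * 'rV[R]_n | crange c z.2 /\ U (z.1, cinv c z.2)].
Proof.
move=> oU; apply: near_open => z [cz Uz].
apply: nearI.
  exact: (@open_near _ _ z (open_snd (crange_open' c)) cz).
have : {for z, continuous (fun z : T * 'rV[R]_n => (z.1, cinv c z.2))}.
  apply: (@pair_continuous _ _ _ fst (fun z : T * 'rV[R]_n => cinv c z.2)).
    exact: cvg_fst.
  apply: (@continuous_comp _ _ _ snd (cinv c)); first exact: cvg_snd.
  exact: cinv_cts.
by move=> H; exact: (H U (@open_near _ U _ oU Uz)).
Qed.
Arguments open_chart_set {T} c {U}.

Lemma open_chart_set1 c (U : set M) : open U -> open [set p | crange c p /\ U (cinv c p)].
Proof.
move=> oU; apply: near_open => p [cp Up].
apply: nearI; first exact: near_crange.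
exact: (cinv_cts cp (@open_near _ U _ oU Up)).
Qed.
Arguments open_chart_set1 c {U}.

Lemma transition_usm c d j : atlas M c -> atlas M d ->
  usm [set p | crange c p /\ cdom d (cinv c p)] (fun p => d (cinv c p) ord0 j).
Proof.
move=> Mc Md; have E : [set p | crange c p /\ cdom d (cinv c p)] =
    c @` (cdom c `&` cdom d).
  apply/seteqP; split=> p.
    by move=> [[x cx <-]]; rewrite cmapK// => dx; exists x.
  by move=> [x [cx dx] <-]; split; [exact: crange_cmap|rewrite cmapK].
have oE : open (c @` (cdom c `&` cdom d)).
  by rewrite -E; exact: (open_chart_set1 c (@cdom_open _ _ _ d)).
rewrite E; apply: (iffLR (smooth_on_mxP (d \o cinv c) oE)).
exact: atlas_compat.
Qed.

(** The neighbourhood is the image under [cinv] of a closed ball, with half the radius of a ball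
    known to lie in the chart. *)
Lemma locally_compactM x (P : set M) : (\forall y \near x, P y) ->
  exists K : set M, [/\ compact K, (\forall y \near x, K y) & K `<=` P].
Proof.
move=> Px; have [c Mc cx] := chart_at x.
have := nearI (near_crange (crange_cmap cx)) (near_cmap cx Px).
move=> /nbhs_ballP[r /= r0 rP].
pose B : set 'rV[R]_n := [set q | `|q - c x| <= r / 2].
have BP q : B q -> crange c q /\ P (cinv c q).
  move=> Bq; apply: rP; rewrite -ball_normE/= distrC (le_lt_trans Bq)//.
  by rewrite ltr_pdivrMr// ltr_pMr// ltr1n.
have cB : compact B.
  apply: bounded_closed_compact.
    exists (`|c x| + r / 2); split; first exact: num_real.
    move=> y yb q Bq; apply: le_trans (ltW yb).
    by rewrite -[q](subrK (c x)) addrC (le_trans (ler_normD _ _))// lerD2l.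
  apply: (@closed_comp _ _ (fun q : 'rV[R]_n => `|q - c x|) [set z | z <= r / 2]).
    by move=> q _; exact: dist_continuous.
  exact: closed_le.
exists (cinv c @` B); split.
- apply: continuous_compact => //.
  apply: continuous_in_subspaceT => q; rewrite inE => /BP[cq _].
  exact: cinv_cts.
- have : \forall y \near x, cdom c y /\ B (c y).
    apply: nearI; first exact: near_cdom.
    apply: near_cinv => //; apply/nbhs_ballP; exists (r / 2); first by rewrite /= divr_gt0.
    by move=> q; rewrite -ball_normE/= /B/= distrC => /ltW.
  by apply: filterS => y [cy By]; exists (c y) => //; rewrite cmapK.
- by move=> _ [q /BP[_ ?] <-].
Qed.

Lemma compact_closedM (K : set M) : compact K -> closed K.
Proof. by apply: compact_closed; exact: manifold_hausdorff. Qed.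

End charts.

Arguments crange_open' {R n M} c.
Arguments open_chart_set {R n M T} c {U}.
Arguments open_chart_set1 {R n M} c {U}.

Section psmooth.
Context {R : realType} {n : nat} {M : manifoldType R n} {T : topologicalType}.
Implicit Types (U : set (T * M)) (F : T -> M -> R).

Definition psmooth U F := forall c, atlas M c ->
  psm [set z | crange c z.2 /\ U (z.1, cinv c z.2)] (fun t p => F t (cinv c p)).

Lemma psmooth_chart U F d : open U -> atlas M d -> (forall z, U z -> cdom d z.2) ->
  psm [set z | crange d z.2 /\ U (z.1, cinv d z.2)] (fun t p => F t (cinv d p)) ->
  psmooth U F.
Proof.
move=> oU Md Ud sF c Mc.
have oc := open_chart_set c oU; have od := open_chart_set d oU.
have H : psm [set z | crange c z.2 /\ U (z.1, cinv c z.2)]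
    (fun t p => F t (cinv d (d (cinv c p)))).
  apply: (psm_comp (g := fun t p => F t (cinv d p)) (f := fun=> d \o cinv c) od oc sF).
    move=> j; apply: psm_sub (usm_psm (transition_usm j Mc Md)) => z [cz Uz].
    by split => //; exact: (Ud _ Uz).
  move=> z [cz Uz] /=; have dz := Ud _ Uz.
  by rewrite cmapK//; split => //; exact: crange_cmap.
apply: psm_ext H => // z [cz Uz]; rewrite cmapK//; exact: (Ud _ Uz).
Qed.

Lemma psmooth_local U F :
  (forall z, U z -> exists2 U', U' z & psmooth U' F) -> psmooth U F.
Proof.
move=> H c Mc; apply: psm_local => -[t p] /= [cp Utp].
have [U' U'z sF] := H _ Utp.
by exists [set z | crange c z.2 /\ U' (z.1, cinv c z.2)] => //; exact: sF.
Qed.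

Lemma psmooth_sub U U' F : U' `<=` U -> psmooth U F -> psmooth U' F.
Proof.
by move=> UU sF c Mc; apply: psm_sub (sF c Mc) => z [cz /UU Uz].
Qed.

Lemma psmooth_ext U F F' : open U -> (forall z, U z -> F z.1 z.2 = F' z.1 z.2) ->
  psmooth U F -> psmooth U F'.
Proof.
move=> oU FF sF c Mc; apply: psm_ext (sF c Mc); first exact: open_chart_set.
by move=> z [_ /FF].
Qed.

Lemma psmooth_cst U (r : R) : open U -> psmooth U (fun _ _ => r).
Proof. by move=> oU c Mc; apply: psm_cst; exact: open_chart_set. Qed.

Lemma psmoothD U F F' : open U -> psmooth U F -> psmooth U F' ->
  psmooth U (fun t x => F t x + F' t x).
Proof.
by move=> oU s s' c Mc; apply: psmD; [exact: open_chart_set|exact: s|exact: s'].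
Qed.

Lemma psmoothM U F F' : open U -> psmooth U F -> psmooth U F' ->
  psmooth U (fun t x => F t x * F' t x).
Proof.
by move=> oU s s' c Mc; apply: psmM; [exact: open_chart_set|exact: s|exact: s'].
Qed.

Lemma psmoothN U F : open U -> psmooth U F -> psmooth U (fun t x => - F t x).
Proof. by move=> oU s c Mc; apply: psmN; [exact: open_chart_set|exact: s]. Qed.

Lemma psmooth_inv U F : open U -> (forall z, U z -> F z.1 z.2 != 0) ->
  psmooth U F -> psmooth U (fun t x => (F t x)^-1).
Proof.
move=> oU F0 s c Mc; apply: psm_inv; [exact: open_chart_set| |exact: s].
by move=> z [_ /F0].
Qed.

Lemma psmooth_theta U F j : open U -> psmooth U F ->
  psmooth U (fun t x => theta j (F t x)).
Proof. by move=> oU s c Mc; apply: psm_theta; [exact: open_chart_set|exact: s]. Qed.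

Lemma psmooth_sum U (I : Type) (r : seq I) (P : pred I) (F : I -> T -> M -> R) :
  open U -> (forall i, P i -> psmooth U (F i)) ->
  psmooth U (fun t x => \sum_(i <- r | P i) F i t x).
Proof.
move=> oU s c Mc; apply: psm_sum; first exact: open_chart_set.
by move=> i Pi; exact: s.
Qed.

Lemma psmooth_prod U (I : Type) (r : seq I) (P : pred I) (F : I -> T -> M -> R) :
  open U -> (forall i, P i -> psmooth U (F i)) ->
  psmooth U (fun t x => \prod_(i <- r | P i) F i t x).
Proof.
move=> oU s c Mc; apply: psm_prod; first exact: open_chart_set.
by move=> i Pi; exact: s.
Qed.

Lemma psmooth_cont U F : psmooth U F ->
  forall z, U z -> {for z, continuous (fun z => F z.1 z.2)}.
Proof.
move=> sF [t x] Uz; have [c Mc cx] := chart_at x.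
have cts : {for (t, x), continuous
    ((fun z : T * 'rV[R]_n => F z.1 (cinv c z.2)) \o (fun z : T * M => (z.1, c z.2)))}.
  apply: continuous_comp.
    apply: (@pair_continuous _ _ _ fst (fun z : T * M => c z.2)); first exact: cvg_fst.
    apply: (@continuous_comp _ _ _ snd c); first exact: cvg_snd.
    exact: cmap_continuous.
  apply: (psm_cont (sF c Mc)) => /=; rewrite cmapK//.
  by split=> //; exact: crange_cmap.
apply: continuous_near_eq cts.
have : \forall y \near (t, x), cdom c y.2.
  exact: (@open_near _ _ (t, x) (open_snd (@cdom_open _ _ _ c)) cx).
by apply: filterS => -[s y] /= cy; rewrite cmapK.
Qed.

End psmooth.

Section smooth_functions.
Context {R : realType} {n : nat} {M : manifoldType R n}.

Lemma smooth_funP (f : M -> R) :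
  smooth_fun f <-> psmooth [set: bool * M] (fun=> f).
Proof.
have E c : [set z : bool * 'rV[R]_n | crange c z.2 /\ [set: bool * M] (z.1, cinv c z.2)]
    = [set z | crange c z.2].
  by apply/seteqP; split=> z //= -[].
split=> sf c Mc.
  rewrite E; apply/smooth_on_RP; first exact: crange_open'.
  exact: sf.
have := sf c Mc; rewrite E => s; apply/smooth_on_RP; first exact: crange_open'.
exact: s.
Qed.

Lemma smooth_fun_usm (f : M -> R) c : smooth_fun f -> atlas M c ->
  usm (crange c) (f \o cinv c).
Proof. by move=> sf Mc; apply/smooth_on_RP; [exact: crange_open'|exact: sf]. Qed.

Lemma smooth_fun_cont (f : M -> R) : smooth_fun f -> continuous f.
Proof.
move=> /smooth_funP sf x.
have := psmooth_cont sf (z := (true, x)) I => H.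
apply: (@continuous_comp _ _ _ (fun y : M => (true, y)) (fun z : bool * M => f z.2)).
  by apply: pair_continuous; [exact: cvg_cst|exact: cvg_id].
exact: H.
Qed.

(** A cutoff of the Euclidean distance in a chart, extended by zero. It vanishes off a compact set
    inside the chart domain; this set is closed since [M] is Hausdorff, so smoothness can be checked
    on two open sets that cover [M]. *)
Lemma bump x (P : set M) : (\forall y \near x, P y) ->
  exists f : M -> R, [/\ smooth_fun f, (forall y, 0 <= f y), 0 < f x &
    exists K : set M, [/\ compact K, K `<=` P & forall y, ~ K y -> f y = 0]].
Proof.
move=> Px; have [c Mc cx] := chart_at x.
have [K [cK Kx KP]] := locally_compactM (nearI Px (near_cdom cx)).
have := nearI (near_crange (crange_cmap cx)) (near_cmap cx Kx).
move=> /nbhs_ballP[r /= r0 rK].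
(* The norm of ['rV[R]_n] is the sup norm, which is not smooth; the Euclidean square is, and its
   ball of radius [r] lies in the sup-norm ball. *)
pose sq (q : 'rV[R]_n) := \sum_j (q ord0 j - c x ord0 j) ^+ 2.
pose f y := if `[< cdom c y >] then theta 0 (r ^+ 2 - sq (c y)) else 0.
have clK : closed K by exact: compact_closedM.
have fK y : ~ K y -> f y = 0.
  move=> nKy; rewrite /f; case: asboolP => // cy.
  have [/= sr|sr] := ltP (sq (c y)) (r ^+ 2); last first.
    by rewrite /theta ltNge subr_le0 sr.
  exfalso; apply: nKy; rewrite -(cmapK cy).
  apply: (rK _ _).2; rewrite -ball_normE/= distrC; apply: norm_lt_coord => // j.
  rewrite !mxE -ltr_sqr ?nnegrE ?normr_ge0 ?ltW// real_normK ?num_real//.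
  apply: le_lt_trans sr; rewrite /sq (bigD1 j)//= lerDl sumr_ge0// => i _.
  exact: sqr_ge0.
exists f; split.
- apply/smooth_funP; apply: psmooth_local => -[b y] _.
  have [cy|ncy] := pselect (cdom c y); last first.
    have oK : open [set z : bool * M | (~` K) z.2] := open_snd (closed_openC clK).
    exists [set z | (~` K) z.2]; first by move=> /KP[].
    apply: (@psmooth_ext _ _ _ _ _ (fun _ _ => 0)).
    + exact: oK.
    + by move=> z /= nK; rewrite fK.
    + exact: psmooth_cst.
  exists [set z | cdom c z.2] => //.
  have oc : open [set z : bool * M | cdom c z.2] by exact: open_snd (@cdom_open _ _ _ c).
  apply: (psmooth_chart (d := c)) => //.
  have oW := open_chart_set c oc.
  have -> : [set z | crange c z.2 /\ [set z : bool * M | cdom c z.2] (z.1, cinv c z.2)]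
      = [set z : bool * 'rV[R]_n | crange c z.2].
    by apply/seteqP; split=> z /= => [[]//|cz]; split => //; exact: cdom_cinv.
  have or := crange_open' c.
  apply: (@usm_ext _ _ _ (fun q => theta 0 (r ^+ 2 - sq q))) => //.
    move=> q cq; rewrite /f; case: asboolP => [_|]; first by rewrite cinvK.
    by move/(_ (cdom_cinv cq)).
  apply: usm_theta => //; apply: usmB => //; first exact: usm_cst.
  apply: usm_sum => // j _.
  have sj : usm (crange c) (fun q : 'rV[R]_n => q ord0 j - c x ord0 j).
    by apply: usmB => //; [exact: usm_coord|exact: usm_cst].
  rewrite (_ : (fun _ => _) = fun q : 'rV[R]_n =>
    (q ord0 j - c x ord0 j) * (q ord0 j - c x ord0 j)); first exact: usmM.
  by apply/funext => q; rewrite expr2.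
- by move=> y; rewrite /f; case: ifP => // _; exact: theta_ge0.
- rewrite /f; case: asboolP => // _; rewrite theta_gt0 /sq big1 ?subr0 ?exprn_gt0// => j _.
  by rewrite subrr expr0n.
- by exists K; split => // y /KP[].
Qed.

End smooth_functions.

(** * The topologies of Diff(M) and C^oo(M) *)

Lemma cvg_subbase {X : topologicalType} (S : set (set X)) {T : Type}
    (F : set_system T) (f : T -> X) (l : X) : Filter F ->
  (forall A, open A -> exists2 D : set (set X), D `<=` finI_from S id &
     A = \bigcup_(B in D) B) ->
  (forall B, S B -> B l -> F (f @^-1` B)) -> f @ F --> l.
Proof.
move=> FF oS H A; rewrite nbhsE => -[B [oB Bl] BA].
apply: (@filterS _ F _ (f @^-1` B)); first by move=> t /BA.
have [D DS E] := oS B oB; rewrite E in Bl *.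
have [C DC Cl] := Bl; apply: (@filterS _ F _ (f @^-1` C)).
  by move=> t Ct; exists C.
have [A' A'S CE] := DS _ DC; rewrite -CE in Cl *.
rewrite preimage_bigcap; apply: filter_bigI => B' B'A.
apply: H; last exact: Cl.
by have := A'S _ B'A; rewrite inE.
Qed.

Lemma cvg_near_eq {S : Type} {X : topologicalType} (F : set_system S)
    (f g : S -> X) (l : X) : Filter F ->
  (\forall s \near F, f s = g s) -> f @ F --> l -> g @ F --> l.
Proof.
move=> FF fg fl P Pl; apply: filterS2 fg (fl P Pl) => s /= fgs.
by rewrite fgs.
Qed.

Lemma cvg_prod_snd {S : Type} {X Y : topologicalType} (F : set_system S)
    (h : X -> Y) x : Filter F -> {for x, continuous h} ->
  (fun z : S * X => h z.2) @ filter_prod F (nbhs x) --> h x.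
Proof.
move=> FF ch P Px; exists (setT, h @^-1` P) => /=.
  by split; [exact: filterT|exact: ch].
by move=> [s y] [].
Qed.

Lemma near_prod_snd {S : Type} {X : topologicalType} (F : set_system S) (x : X)
    (P : set X) : Filter F -> (\forall y \near x, P y) ->
  \forall z \near filter_prod F (nbhs x), P z.2.
Proof.
by move=> FF Px; exists (setT, P) => /=; [split => //; exact: filterT|case=> s y []].
Qed.

Lemma psm_of_iterD {R : realType} {T : topologicalType} {V : normedModType R}
    (U : set (T * V)) (f : T -> V -> R) : open U ->
  (forall t, usm [set y | U (t, y)] (f t)) ->
  (forall vs, pcont U (fun t => Defs.iterD vs (f t : V -> R^o))) -> psm U f.
Proof.
move=> oU sf cf k; suff H vs : pCk k U (fun t => Defs.iterD vs (f t : V -> R^o)).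
  exact: (H [::]).
elim: k vs => [|k IH] vs; first by split => //; exact: cf.
split; first exact: cf.
move=> v; split; last exact: (IH (v :: vs)).
move=> [t x] Ux /=; have [] := usm_der v (usm_iterD vs (sf t)) Ux.
by [].
Qed.

Section diffeomorphisms.
Context {R : realType} {n : nat} {M : manifoldType R n}.
Implicit Types (c d : chart R n M) (f : M -> M).

Definition ldom f c d : set 'rV[R]_n := [set p | crange c p /\ cdom d (f (cinv c p))].

Lemma smooth_map_cont f : smooth_map f -> continuous f.
Proof.
move=> sf x; have [c Mc cx] := chart_at x.
have [cf _] := sf c Mc.
have H : {for x, continuous ((f \o cinv c) \o c)}.
  apply: continuous_comp; first exact: cmap_continuous.
  exact/cf/crange_cmap.
apply: continuous_near_eq H; apply: filterS (near_cdom cx) => y cy /=.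
by rewrite cmapK.
Qed.

Lemma open_ldom f c d : continuous f -> open (ldom f c d).
Proof.
move=> cf; apply: (@open_chart_set1 _ _ _ c (f @^-1` cdom d)).
by apply: open_comp => [x _|]; [exact: cf|exact: cdom_open].
Qed.

#[local] Arguments open_ldom {f} c d.

Lemma local_usm f c d j : smooth_map f -> atlas M c -> atlas M d ->
  usm (ldom f c d) (fun p => local f c d p ord0 j).
Proof.
move=> sf Mc Md; have [_ /(_ d Md) sd] := sf c Mc.
have oL := open_ldom c d (smooth_map_cont sf).
exact: (iffLR (smooth_on_mxP (d \o (f \o cinv c)) oL) sd ord0 j).
Qed.

Lemma iterD_local f c d vs p j : smooth_map f -> atlas M c -> atlas M d ->
  ldom f c d p -> Defs.iterD vs (local f c d) p ord0 j =
    Defs.iterD vs (fun q => local f c d q ord0 j : R^o) p.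
Proof.
move=> sf Mc Md Lp; have oL := open_ldom c d (smooth_map_cont sf).
apply: (iterD_mx vs ord0 j oL) => // i k; rewrite ord1.
exact: local_usm.
Qed.

Lemma Diff_open (A : set (Diff M)) : open A <->
  exists2 D : set (set (Diff M)), D `<=` finI_from (@Diff_subbase R n M) id &
    \bigcup_(B in D) B = A.
Proof. by []. Qed.

Lemma Diff_subbase_open (B : set (Diff M)) : Diff_subbase B -> open B.
Proof.
move=> SB; apply/Diff_open; exists [set B]; last by rewrite bigcup_set1.
by move=> _ ->; exact: finI_from1.
Qed.

Lemma Cinf_open (A : set (Cinf M)) : open A <->
  exists2 D : set (set (Cinf M)), D `<=` finI_from (@Cinf_subbase R n M) id &
    \bigcup_(B in D) B = A.
Proof. by []. Qed.

Lemma Cinf_subbase_open (B : set (Cinf M)) : Cinf_subbase B -> open B.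
Proof.
move=> SB; apply/Cinf_open; exists [set B]; last by rewrite bigcup_set1.
by move=> _ ->; exact: finI_from1.
Qed.

Lemma near_prod_chart {S : Type} (F : set_system S) c x (P : S -> 'rV[R]_n -> Prop) :
  Filter F -> cdom c x -> (\forall z \near filter_prod F (nbhs (c x)), P z.1 z.2) ->
  \forall y \near x & s \near F, P s (c y).
Proof.
move=> FF cx [[A B] [/= FA Bc] AB]; exists (c @^-1` B, A) => /=.
  by split => //; exact: near_cinv.
by move=> -[y s] [/= By As]; exact: (AB (s, c y)).
Qed.

(** The hypothesis is local, with map and point varying together; covering compactness turns it into
    the uniform estimates on [K] that define the subbasic open sets. *)
Lemma cvg_Diff {T : Type} (F : set_system T) (A : T -> Diff M) (f : Diff M) :
  Filter F ->
  (forall c d p, atlas M c -> atlas M d -> ldom f c d p ->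
    (\forall z \near filter_prod F (nbhs p), ldom (A z.1) c d z.2) /\
    forall vs j, (fun z => Defs.iterD vs (fun q => local (A z.1) c d q ord0 j : R^o) z.2)
      @ filter_prod F (nbhs p) --> Defs.iterD vs (fun q => local f c d q ord0 j : R^o) p) ->
  A @ F --> f.
Proof.
move=> FF H; apply: (@cvg_subbase _ (@Diff_subbase R n M)) => [B /Diff_open[D DS <-]|B].
  by exists D.
move=> [f0 [c [d [K [vs [e [[Mc Md] cK [Kc fK] e0 ->]]]]]]] [fKd Kf].
have H2 : \forall t \near F, K `<=` fun x => cdom d (A t x) /\
    `|Defs.iterD vs (d \o A t \o cinv c) (c x) -
      Defs.iterD vs (d \o f0 \o cinv c) (c x)| < e.
  apply: (iffLR (compact_near_coveringP K) cK) => x Kx.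
  have cx := Kc _ Kx; have xE := cmapK cx.
  have Lp : ldom f c d (c x).
    by split; [exact: crange_cmap|rewrite xE; apply: fKd; exists x].
  have L0p : ldom f0 c d (c x).
    by split; [exact: crange_cmap|rewrite xE; apply: fK; exists x].
  have [nL cL] := H c d (c x) Mc Md Lp.
  have C : (fun z : T * 'rV[R]_n => Defs.iterD vs (d \o A z.1 \o cinv c) z.2 -
      Defs.iterD vs (d \o f0 \o cinv c) z.2) @ filter_prod F (nbhs (c x)) -->
      Defs.iterD vs (d \o f \o cinv c) (c x) - Defs.iterD vs (d \o f0 \o cinv c) (c x).
    apply: cvg_mx => i j; rewrite ord1 {i} !mxE.
    rewrite (iterD_local vs j (Diff_smooth f) Mc Md Lp).
    rewrite (iterD_local vs j (Diff_smooth f0) Mc Md L0p).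
    have c0 : {for c x, continuous (Defs.iterD vs (fun q => local f0 c d q ord0 j : R^o))}.
      exact: usm_cont (usm_iterD vs (local_usm j (Diff_smooth f0) Mc Md)) L0p.
    have c1 := cvg_prod_snd FF c0.
    have cB := cvgB (cL vs j) c1.
    have nL0 : \forall z \near filter_prod F (nbhs (c x)), ldom f0 c d z.2.
      have of0 := open_ldom c d (smooth_map_cont (Diff_smooth f0)).
      exact: (near_prod_snd FF (open_near of0 L0p)).
    have FP : Filter (filter_prod F (nbhs (c x))) by exact: filter_prod_filter.
    apply: (cvg_near_eq FP _ (cB FP)).
    apply: filterS2 nL nL0 => z Lz L0z; rewrite !mxE/=.
    rewrite (iterD_local vs j (Diff_smooth f0) Mc Md L0z).
    by rewrite (iterD_local vs j (Diff_smooth (A z.1)) Mc Md Lz).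
  have nC : \forall z \near filter_prod F (nbhs (c x)),
      `|Defs.iterD vs (d \o A z.1 \o cinv c) z.2 -
        Defs.iterD vs (d \o f0 \o cinv c) z.2| < e.
    exact: (cvgr_lt _ (cvg_norm C) _ (Kf _ Kx)).
  have := @near_prod_chart _ F c x (fun s q => ldom (A s) c d q /\
    `|Defs.iterD vs (d \o A s \o cinv c) q -
      Defs.iterD vs (d \o f0 \o cinv c) q| < e) FF cx (filterI nL nC).
  have n1 := near_cdom cx; move=> [[P Q] [/= Px Fq] PQ].
  exists (P `&` cdom c, Q) => /=; first by split => //; exact: filterI.
  move=> -[y s] [/= [Py cy] Qs]; have [[_ +] ?] := PQ (y, s) (conj Py Qs).
  by rewrite /= cmapK.
apply: filterS H2 => t H2; split; first by move=> _ [x Kx <-]; exact: (H2 x Kx).1.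
by move=> x Kx; exact: (H2 x Kx).2.
Unshelve. all: by end_near. Qed.

Section continuous_families.
Context {T : topologicalType} (A : T -> Diff M) (cA : continuous A).

Definition pdom c d : set (T * 'rV[R]_n) := [set z | ldom (A z.1) c d z.2].

(** A compact neighbourhood of [cinv c z.2] gives a subbasic neighbourhood of [A z.1]. The estimate
    compares [A w.1] with [A z.1] at the same point [w.2]; the openness of [pdom] comes with it. *)
Lemma continuous_Diff_near c d z vs (e : R) : atlas M c -> atlas M d -> 0 < e ->
  pdom c d z -> \forall w \near z, pdom c d w /\
    `|Defs.iterD vs (local (A w.1) c d) w.2 - Defs.iterD vs (local (A z.1) c d) w.2| < e.
Proof.
move=> Mc Md e0 [cz dz]; have [t p] := z.
have cf := smooth_map_cont (Diff_smooth (A z.1)).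
have N : \forall y \near cinv c z.2, cdom c y /\ cdom d (A z.1 y).
  apply: nearI; first exact: near_cdom (cdom_cinv cz).
  exact: (cf _ _ (near_cdom dz)).
have [K [cK Kz KP]] := locally_compactM N.
pose B := [set g : Diff M | g @` K `<=` cdom d /\ forall x, K x ->
       `|Defs.iterD vs (d \o g \o cinv c) (c x)
         - Defs.iterD vs (d \o A z.1 \o cinv c) (c x)| < e].
have SB : Diff_subbase B.
  exists (A z.1), c, d, K, vs, e; split => //.
  by split=> [y /KP[]//|_ [y /KP[_ ?] <-]].
have nB : \forall t \near z.1, B (A t).
  apply: cA; apply: (@open_near _ B); first exact: Diff_subbase_open.
  split; first by move=> _ [y /KP[_ ?] <-].
  by move=> x _; rewrite subrr normr0.
have nK : \forall q \near z.2, crange c q /\ K (cinv c q).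
  by apply: nearI; [exact: near_crange|exact: (cinv_cts cz)].
rewrite [z]surjective_pairing; exists ([set t | B (A t)], [set q | crange c q /\ K (cinv c q)]) => //.
move=> -[s q] [/= [Bd Be] [cq Kq]]; split.
  by split => //=; apply: Bd; exists (cinv c q).
by have := Be _ Kq; rewrite cinvK.
Qed.

Lemma open_pdom c d : atlas M c -> atlas M d -> open (pdom c d).
Proof.
move=> Mc Md; apply: near_open => z Uz.
by apply: filterS (continuous_Diff_near [::] Mc Md ltr01 Uz) => w [].
Qed.

Lemma local_psm c d j : atlas M c -> atlas M d ->
  psm (pdom c d) (fun t p => local (A t) c d p ord0 j).
Proof.
move=> Mc Md; have oU := open_pdom Mc Md.
apply: psm_of_iterD => // [t|vs z Uz].
  exact: (local_usm j (Diff_smooth (A t)) Mc Md).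
have cz : {for z.2, continuous
    (Defs.iterD vs (fun q => local (A z.1) c d q ord0 j : R^o))}.
  exact: usm_cont (usm_iterD vs (local_usm j (Diff_smooth (A z.1)) Mc Md)) Uz.
have cz2 : {for z, continuous
    (fun w : T * 'rV[R]_n => Defs.iterD vs (fun q => local (A z.1) c d q ord0 j : R^o) w.2)}.
  apply: (@continuous_comp _ _ _ snd
    (Defs.iterD vs (fun q => local (A z.1) c d q ord0 j : R^o))); last exact: cz.
  exact: cvg_snd.
(* Half of the error is for the change of map at a fixed point, half for the change of point under
   the fixed map [A z.1]. *)
apply/cvgrPdist_lt => e e0; have e20 : 0 < e / 2 by rewrite divr_gt0.
have N := continuous_Diff_near vs Mc Md e20 Uz.
move/cvgrPdist_lt : cz2 => /(_ _ e20) N2.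
have N3 : \forall w \near z, ldom (A z.1) c d w.2.
  have oL := open_ldom c d (smooth_map_cont (Diff_smooth (A z.1))).
  exact: (@open_near _ _ z (open_snd oL) Uz).
apply: filterS (nearI N3 (nearI N N2)) => w [L3 [[Uw Hw] H2]].
have Hj : `|Defs.iterD vs (fun q => local (A w.1) c d q ord0 j : R^o) w.2 -
    Defs.iterD vs (fun q => local (A z.1) c d q ord0 j : R^o) w.2| < e / 2.
  rewrite -(iterD_local vs j (Diff_smooth _) Mc Md Uw).
  rewrite -(iterD_local vs j (Diff_smooth _) Mc Md L3).
  have := coord_le_norm (Defs.iterD vs (local (A w.1) c d) w.2 -
    Defs.iterD vs (local (A z.1) c d) w.2) j.
  by rewrite !mxE => /le_lt_trans; apply.
rewrite (splitr e) -(subrKA (Defs.iterD vs (fun q => local (A z.1) c d q ord0 j : R^o) w.2)).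
by rewrite (le_lt_trans (ler_normD _ _))// ltrD// distrC.
Qed.

End continuous_families.
End diffeomorphisms.
Arguments open_ldom {R n M f} c d.

Lemma near_pair {S X : topologicalType} (z : S * X) (A : set S) (B : set X)
    (P : set (S * X)) : (\forall s \near z.1, A s) -> (\forall x \near z.2, B x) ->
  (forall s x, A s -> B x -> P (s, x)) -> \forall w \near z, P w.
Proof.
case: z => s x /= As Bx AB; exists (A, B) => // -[s' x'] [/= As' Bx'].
exact: AB.
Qed.

Section iterated.
Context {R : realType}.

Lemma iterD_ext {V : normedModType R} (U : set V) (f g : V -> R) vs x : open U ->
  (forall y, U y -> f y = g y) -> U x ->
  Defs.iterD vs (f : V -> R^o) x = Defs.iterD vs (g : V -> R^o) x.
Proof.
move=> oU fg; elim: vs x => [x /fg//|v vs IH] x Ux /=.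
by apply: near_eq_derive; apply: filterS (open_near oU Ux) => y; exact: IH.
Qed.

Lemma iterD_scaleB {V : normedModType R} (U : set V) (f g : V -> R) a vs x : open U ->
  usm U f -> usm U g -> U x ->
  Defs.iterD vs (fun x => a * (f x - g x) : R^o) x =
  a * (Defs.iterD vs (f : V -> R^o) x - Defs.iterD vs (g : V -> R^o) x).
Proof.
move=> oU sf sg; elim: vs x => [//|v vs IH] x Ux /=.
have df := usm_der v (usm_iterD vs sf) Ux; have dg := usm_der v (usm_iterD vs sg) Ux.
have D : is_derive x v (a \*: (Defs.iterD vs (f : V -> R^o) - Defs.iterD vs (g : V -> R^o)))
    (a *: ('D_v (Defs.iterD vs (f : V -> R^o)) x - 'D_v (Defs.iterD vs (g : V -> R^o)) x)).
  exact: is_deriveZ (is_deriveB df dg).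
apply: etrans _ (@derive_val _ _ _ _ _ _ _ D); apply: near_eq_derive.
by apply: filterS (open_near oU Ux) => y Uy; rewrite IH.
Qed.

(** By Schwarz the innermost direction moves outermost, one commutation for each member of [vs]. *)
Lemma iterD_D {V : normedModType R} (U : set V) (f : V -> R) v vs x : open U ->
  usm U f -> U x ->
  Defs.iterD vs ('D_v f : V -> R^o) x = 'D_v (Defs.iterD vs (f : V -> R^o)) x.
Proof.
move=> oU sf; elim: vs x => [//|w vs IH] x Ux /=.
rewrite (usm_schwarz (U := U) w v oU (usm_iterD vs sf) Ux).
by apply: near_eq_derive; apply: filterS (open_near oU Ux) => y; exact: IH.
Qed.

Lemma is_derive_pair2 {V1 V2 W : normedModType R} (f : V1 * V2 -> W) x y v l :
  is_derive (x, y) (0, v) f l -> is_derive y v (fun y => f (x, y)) l.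
Proof.
move=> /dderivP H; apply/dderivP; move: H; rewrite /dderiv => H.
rewrite (_ : (fun _ => _) = fun h : R => h^-1 *: (f (h *: (0, v) + (x, y)) - f (x, y)))//.
apply/funext => h; congr (_ *: (f _ - _)).
by rewrite [RHS]surjective_pairing /= scaler0 add0r.
Qed.

Lemma is_derive_pair1 {V1 V2 W : normedModType R} (f : V1 * V2 -> W) x y v l :
  is_derive (x, y) (v, 0) f l -> is_derive x v (fun x => f (x, y)) l.
Proof.
move=> /dderivP H; apply/dderivP; move: H; rewrite /dderiv => H.
rewrite (_ : (fun _ => _) = fun h : R => h^-1 *: (f (h *: (v, 0) + (x, y)) - f (x, y)))//.
apply/funext => h; congr (_ *: (f _ - _)).
by rewrite [RHS]surjective_pairing /= scaler0 add0r.
Qed.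

Lemma iterD_pair {V1 V2 : normedModType R} (U : set (V1 * V2)) (f : V1 * V2 -> R)
    vs x y : open U -> usm U f -> U (x, y) ->
  Defs.iterD vs (fun y => f (x, y) : R^o) y =
  Defs.iterD [seq (0, v) | v <- vs] (f : _ -> R^o) (x, y).
Proof.
move=> oU sf; elim: vs y => [//|v vs IH] y Uy /=.
have D := usm_der (0, v) (usm_iterD [seq (0, v) | v <- vs] sf) Uy.
rewrite -(@derive_val _ _ _ _ _ _ _ (is_derive_pair2 D)).
apply: near_eq_derive.
apply: filterS (open_near (open_slice x oU) Uy) => z; exact: IH.
Qed.

End iterated.

Section Cinf_topology.
Context {R : realType} {n : nat} {M : manifoldType R n}.
Implicit Types (c d : chart R n M).

Lemma Cinf_smooth (f : Cinf M) : smooth_fun f.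
Proof. by case: f => f /= /asboolP. Qed.

Lemma near_cover_chart {S : Type} (F : set_system S) c (K : set M)
    (P : S -> 'rV[R]_n -> Prop) : Filter F -> compact K -> K `<=` cdom c ->
  (forall x, K x -> \forall z \near filter_prod F (nbhs (c x)), P z.1 z.2) ->
  \forall s \near F, forall x, K x -> P s (c x).
Proof.
move=> FF cK Kc H; apply: (iffLR (compact_near_coveringP K) cK) => x Kx.
exact: near_prod_chart (Kc _ Kx) (H x Kx).
Qed.

Lemma cvg_Cinf {T : Type} (F : set_system T) (A : T -> Cinf M) (f : Cinf M) :
  Filter F ->
  (forall c p vs, atlas M c -> crange c p ->
    (fun z => Defs.iterD vs (A z.1 \o cinv c : _ -> R^o) z.2) @ filter_prod F (nbhs p)
      --> Defs.iterD vs (f \o cinv c : _ -> R^o) p) ->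
  A @ F --> f.
Proof.
move=> FF H; apply: (@cvg_subbase _ (@Cinf_subbase R n M)) => [B /Cinf_open[D DS <-]|B].
  by exists D.
move=> [f0 [c [K [vs [e [Mc cK Kc e0 ->]]]]]] Kf.
pose P (t : T) q := `|Defs.iterD vs (A t \o cinv c : _ -> R^o) q -
      Defs.iterD vs (f0 \o cinv c : _ -> R^o) q| < e.
suff : \forall t \near F, forall x, K x -> P t (c x) by [].
apply: (@near_cover_chart _ F c K P FF cK Kc) => x Kx; have cp := crange_cmap (Kc _ Kx).
have c0 : {for c x, continuous (Defs.iterD vs (f0 \o cinv c : _ -> R^o))}.
  exact: usm_cont (usm_iterD vs (smooth_fun_usm (Cinf_smooth f0) Mc)) cp.
have FP : Filter (filter_prod F (nbhs (c x))) by exact: filter_prod_filter.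
have C : (fun z : T * 'rV[R]_n => Defs.iterD vs (A z.1 \o cinv c : _ -> R^o) z.2 -
      Defs.iterD vs (f0 \o cinv c : _ -> R^o) z.2) @ filter_prod F (nbhs (c x)) -->
    Defs.iterD vs (f \o cinv c : _ -> R^o) (c x) -
      Defs.iterD vs (f0 \o cinv c : _ -> R^o) (c x).
  exact: cvgB (H c (c x) vs Mc cp) (cvg_prod_snd FF c0).
exact: (cvgr_lt _ (cvg_norm C) _ (Kf _ Kx)).
Qed.

Lemma Cinf_psmooth {T : topologicalType} (A : T -> Cinf M) : continuous A ->
  psmooth [set: T * M] (fun t => A t).
Proof.
move=> cA c Mc.
have oU := open_chart_set c (@openT (T * M)%type).
apply: psm_of_iterD => // [t|vs z [cz _]].
  by apply: usm_sub (smooth_fun_usm (Cinf_smooth (A t)) Mc) => p [].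
have cf t : usm (crange c) (Defs.iterD vs (A t \o cinv c : _ -> R^o)).
  exact: usm_iterD (smooth_fun_usm (Cinf_smooth (A t)) Mc).
apply/cvgrPdist_lt => e e0; have e20 : 0 < e / 2 by rewrite divr_gt0.
have [K [cK Kz KP]] := locally_compactM (near_cdom (cdom_cinv cz)).
pose B := [set g : Cinf M | forall x, K x ->
       `|Defs.iterD vs (g \o cinv c : _ -> R^o) (c x)
         - Defs.iterD vs (A z.1 \o cinv c : _ -> R^o) (c x)| < e / 2].
have SB : Cinf_subbase B by exists (A z.1), c, K, vs, (e / 2); split.
have nB : \forall t \near z.1, B (A t).
  apply: cA; apply: (@open_near _ B); first exact: Cinf_subbase_open.
  by move=> x _; rewrite subrr normr0.
have nK : \forall q \near z.2, crange c q /\ K (cinv c q).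
  by apply: nearI; [exact: near_crange|exact: (cinv_cts cz)].
have nC : \forall q \near z.2,
    `|Defs.iterD vs (A z.1 \o cinv c : _ -> R^o) z.2 -
      Defs.iterD vs (A z.1 \o cinv c : _ -> R^o) q| < e / 2.
  by move/cvgrPdist_lt : (usm_cont (cf z.1) cz); exact.
apply: (near_pair nB (nearI nK nC)) => t q Bt [[cq Kq] H]; have := Bt _ Kq; rewrite cinvK// => H2.
rewrite (splitr e) -(subrKA (Defs.iterD vs (A z.1 \o cinv c : _ -> R^o) q)).
by rewrite (le_lt_trans (ler_normD _ _))// ltrD// distrC.
Qed.

(** * The exponential law: smooth functions on U x M as smooth maps from U to C^oo(M, R) *)

Section exponential_law.
Context {V : normedModType R} (U : set V) (oU : open U).

Definition jointly_smooth (f : V -> M -> R) := forall c, atlas M c ->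
  usm (U `*` crange c) (fun z : V * 'rV[R]_n => f z.1 (cinv c z.2)).

Lemma openX {S1 S2 : topologicalType} (A : set S1) (B : set S2) :
  open A -> open B -> open (A `*` B).
Proof.
move=> oA oB; apply: near_open => -[x y] [/= Ax By]; exists (A, B) => //=.
by split; exact: open_near.
Qed.

Let oUc c : open (U `*` crange c) := openX oU (crange_open' c).

Lemma jointly_smooth_cont (f : V -> Cinf M) : jointly_smooth (fun q => f q) ->
  forall q, U q -> {for q, continuous f}.
Proof.
move=> sf q Uq; apply: cvg_Cinf => c p vs Mc cp.
have H := psm_iterD vs (usm_curry (@oUc c) (sf c Mc)).
exact: (psm_cont H (z := (q, p))).
Qed.

Lemma jointly_smooth_D (f : V -> M -> R) v : jointly_smooth f ->
  jointly_smooth (fun q x => 'D_v (f ^~ x) q).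
Proof.
move=> sf c Mc; apply: usm_ext (usm_D (v, 0) (sf c Mc)) => //.
move=> [q p] Uqp /=; have D := usm_der (v, 0) (sf c Mc) Uqp.
by rewrite (@derive_val _ _ _ _ _ _ _ (is_derive_pair1 D)).
Qed.

Lemma jointly_smooth_slice (f : V -> M -> R) q : jointly_smooth f -> U q ->
  smooth_fun (f q).
Proof.
move=> sf Uq c Mc; apply/smooth_on_RP; first exact: crange_open'.
apply: usm_sub (psm_usm q (usm_curry (@oUc c) (sf c Mc))).
by move=> p cp; split.
Qed.

(** Convergence in C^oo has to be checked on every iterated derivative in a chart. With [G] that
    derivative of the two-variable function, the mean value theorem writes the difference quotient
    as a nearby value of the continuous function ['D_(v, 0) G]. *)
Lemma jointly_smooth_dderiv (f : V -> Cinf M) (f' : Cinf M) q v :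
  jointly_smooth (fun q => f q) -> U q ->
  (forall x, f' x = 'D_v (fun q => f q x) q) -> dderiv f q v f'.
Proof.
move=> sf Uq f'E; apply: cvg_Cinf => c p vs Mc cp.
pose F z := f z.1 (cinv c z.2); have sF : usm (U `*` crange c) F := sf c Mc.
pose ws := [seq (0 : V, v) | v <- vs].
pose G := Defs.iterD ws (F : _ -> R^o); have sG : usm (U `*` crange c) G := usm_iterD ws sF.
have Uqp : (U `*` crange c) (q, p) by [].
(* The direction [(v, 0)] is moved past all the directions in [ws]. *)
have -> : Defs.iterD vs (f' \o cinv c : _ -> R^o) p = 'D_(v, 0) G (q, p).
  rewrite -(iterD_D (v, 0) ws (@oUc c) sF Uqp).
  rewrite -(iterD_pair vs (@oUc c) (usm_D (v, 0) sF) Uqp).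
  apply: (iterD_ext _ (crange_open' c)) cp => p' cp'.
  have D := usm_der (v, 0) sF (conj Uq cp' : (U `*` crange c) (q, p')).
  by rewrite /= f'E (@derive_val _ _ _ _ _ _ _ (is_derive_pair1 D)).
have cD : {for (q, p), continuous ('D_(v, 0) G)} := usm_cont (usm_D (v, 0) sG) Uqp.
have GE q' p' : U q' -> crange c p' ->
    Defs.iterD vs (f q' \o cinv c : _ -> R^o) p' = G (q', p').
  move=> Uq' cp'; have Uqp' : (U `*` crange c) (q', p') by [].
  exact: (iterD_pair vs (@oUc c) sF Uqp').
apply/cvgrPdist_lt => e e0; move/cvgrPdist_lt : cD => /(_ _ e0) cD.
have [[A B] [/= Aq Bp] AB] := nearI (open_near (@oUc c) Uqp) cD.
have nA : \forall h \near (0 : R), forall s : R, `|s| <= `|h| -> A (s *: v + q).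
  have /nbhs_ballP[r /= r0 rA] := Aq.
  have v1 : 0 < `|v| + 1 by rewrite ltr_wpDl.
  have N : \forall h \near (0 : R), `|h| < r / (`|v| + 1).
    by apply: nbhs0_lt; rewrite divr_gt0.
  apply: filterS N => h hr s sh; apply: rA; rewrite -ball_normE/= opprD addrCA subrr addr0.
  rewrite normrN normrZ (@le_lt_trans _ _ (`|h| * (`|v| + 1)))//.
    by apply: ler_pM => //; rewrite lerDl.
  by rewrite -ltr_pdivlMr.
have nA2 : \forall h \near (0 : R)^', h != 0 /\
    forall s : R, `|s| <= `|h| -> A (s *: v + q).
  exact: (filterI (nbhs_dnbhs_neq (0 : R)) (nbhs_dnbhs nA)).
exists ([set h : R | h != 0 /\ forall s : R, `|s| <= `|h| -> A (s *: v + q)],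
   B `&` crange c) => /=.
  by split; [exact: nA2|exact: (nearI Bp (near_crange cp))].
move=> [h p'] [/= [h0 hA] [Bp' cp']].
have Uh s : `|s| <= `|h| -> U (s *: v + q).
  by move=> sh; have := AB (s *: v + q, p') (conj (hA s sh) Bp'); case=> -[].
have Uq' : U (h *: v + q) := Uh h (lexx _).
have sfc q' : U q' -> usm (crange c) (f q' \o cinv c).
  by move=> _; exact: smooth_fun_usm (Cinf_smooth (f q')) Mc.
have -> : Defs.iterD vs (h^-1 *: (f (h *: v + q) - f q) \o cinv c : _ -> R^o) p' =
    h^-1 * (G (h *: v + q, p') - G (q, p')).
  rewrite -!GE// -(iterD_scaleB _ _ (crange_open' c) (sfc _ Uq') (sfc _ Uq) cp').
  by [].
have [|s sh E] := @mvt_line R _ G (q, p') (v, 0) h.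
  move=> s sh; have Us : (U `*` crange c) (s *: (v, 0) + (q, p')).
    by split => /=; [exact: Uh|rewrite scaler0 add0r].
  by have [] := usm_der (v, 0) sG Us.
have E2 (s' : R) : s' *: (v, 0) + (q, p') = (s' *: v + q, p').
  by rewrite [LHS]surjective_pairing /= scaler0 add0r.
rewrite !E2 in E; rewrite E mulKf//.
exact: (AB (s *: v + q, p') (conj (hA s sh) Bp')).2.
Qed.

Lemma jointly_smooth_on (f : V -> Cinf M) : jointly_smooth (fun q => f q) ->
  smooth_on U f.
Proof.
move=> sf k; elim: k f sf => [|k IH] f sf.
  by split => //; exact: jointly_smooth_cont.
split; first exact: jointly_smooth_cont.
move=> v; have sD := jointly_smooth_D v sf.
have ex q : exists f' : Cinf M, U q -> forall x, f' x = 'D_v (fun q => f q x) q.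
  (* Off [U] the slice derivative need not be smooth, so an arbitrary element of [Cinf M] stands
     in. *)
  have [Uq|nU] := pselect (U q); last by exists (f q).
  have sfq := jointly_smooth_slice sD Uq.
  have P : (fun x => 'D_v (fun q => f q x) q) \in @smooth_pred _ _ M by apply/asboolP.
  by exists (MkCinf P).
pose f' q := sval (cid (ex q)).
have f'E q : U q -> forall x, f' q x = 'D_v (fun q => f q x) q := svalP (cid (ex q)).
exists f'; first by move=> q Uq; apply: jointly_smooth_dderiv => //; exact: f'E.
apply: IH => c Mc; apply: usm_ext (sD c Mc) => //.
by move=> [q p] [/= Uq cp]; rewrite f'E.
Qed.

End exponential_law.
End Cinf_topology.

(** * Limits of isometries *)

Section positive_definite.
Context {R : realType} {n : nat}.
Implicit Types (b : 'M[R]_n) (u v x : 'rV[R]_n).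

Definition bform b u v : R := (u *m b *m v^T) ord0 ord0.

Definition posdef b := b^T = b /\ forall v, v != 0 -> 0 < bform b v v.

Lemma bformE b u v : bform b u v = \sum_k \sum_l u ord0 k * b k l * v ord0 l.
Proof.
rewrite /bform mxE; under eq_bigr do rewrite !mxE mulr_suml.
by rewrite exchange_big.
Qed.

Lemma bform_sym b u v : b^T = b -> bform b u v = bform b v u.
Proof.
move=> bT; rewrite /bform -[in LHS](trmxK (u *m b *m v^T)) mxE.
by rewrite !trmx_mul trmxK bT mulmxA.
Qed.

Lemma bformBl b u v x a : bform b (u - a *: v) x = bform b u x - a * bform b v x.
Proof. by rewrite /bform !mulmxBl -!scalemxAl !mxE. Qed.

Lemma posdef_ge0 b v : posdef b -> 0 <= bform b v v.
Proof.
move=> [_ pb]; have [->|/pb/ltW//] := eqVneq v 0.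
by rewrite /bform !mul0mx mxE.
Qed.

Lemma posdef_cauchy b u v : posdef b -> bform b u v ^+ 2 <= bform b u u * bform b v v.
Proof.
move=> pb; have [bT b0] := pb; have [->|u0] := eqVneq u 0.
  by rewrite /bform !mul0mx mxE expr0n mul0r.
have uu := b0 _ u0; set a := bform b u v / bform b u u.
have := posdef_ge0 (v - a *: u) pb.
rewrite bformBl [bform b v (v - _)]bform_sym// [bform b u (v - _)]bform_sym// !bformBl.
rewrite [bform b v u]bform_sym// /a => H.
have uu0 : bform b u u != 0 by rewrite gt_eqF.
rewrite mulrC -ler_pdivrMr//.
move: H; rewrite divfK// subrr mulr0 subr0 subr_ge0 => H.
by apply: le_trans H; rewrite expr2 mulrAC.
Qed.

Lemma posdef_unit b : posdef b -> b \in unitmx.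
Proof.
move=> [_ b0]; rewrite -row_free_unit -kermx_eq0; apply/eqP/row_matrixP => i.
rewrite row0; apply/eqP; apply: contraT => /b0.
rewrite /bform -row_mul mulmx_ker row0 mul0mx mxE ltxx.
by [].
Qed.

(** The coordinate [x_j] is the inner product of [x] with [u = e_j b^-1], whose square length is the
    j-th diagonal entry of [b^-1]; then Cauchy-Schwarz. *)
Lemma posdef_coord b x j : posdef b ->
  x ord0 j ^+ 2 <= invmx b j j * bform b x x.
Proof.
move=> pb; have ub := posdef_unit pb; have [bT _] := pb.
pose u : 'rV[R]_n := delta_mx ord0 j *m invmx b.
have uE (y : 'rV[R]_n) : bform b u y = y ord0 j.
  by rewrite /bform /u mulmxKV// -rowE !mxE.
have <- : bform b u u = invmx b j j by rewrite uE /u -rowE mxE.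
by rewrite -{1}(uE x); exact: posdef_cauchy.
Qed.

End positive_definite.

Section smooth_matrices.
Context {R : realType} {V : normedModType R} {U : set V} (oU : open U).

Lemma usm_det n (A : V -> 'M[R]_n) : (forall i j, usm U (fun x => A x i j)) ->
  usm U (fun x => \det (A x)).
Proof.
move=> sA; apply: usm_sum => // s _; apply: usmM => //; first exact: usm_cst.
by apply: usm_prod => // i _; exact: sA.
Qed.

Lemma usm_invmx n (A : V -> 'M[R]_n) i j : (forall i j, usm U (fun x => A x i j)) ->
  (forall x, U x -> A x \in unitmx) -> usm U (fun x => invmx (A x) i j).
Proof.
move=> sA uA.
apply: (@usm_ext _ _ _ (fun x => (\det (A x))^-1 * ((-1) ^+ (j + i) *
    \det (row' j (col' i (A x)))))) => //.
  by move=> x Ux; rewrite /invmx uA// !mxE.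
apply: usmM => //.
  apply: usm_inv => //; last exact: usm_det.
  by move=> x /uA; rewrite unitmxE unitfE.
apply: usmM => //; first exact: usm_cst.
apply: usm_det => k l; rewrite (_ : (fun _ => _) = fun x => A x (lift j k) (lift i l)).
  exact: sA.
by apply/funext => x; rewrite !mxE.
Qed.

End smooth_matrices.

Section jacobians.
Context {R : realType} {n : nat} {M : manifoldType R n}.
Implicit Types (c d : chart R n M) (f : M -> M).

Lemma differentiable_row {V : normedModType R} m (f : V -> 'rV[R]_m) x :
  (forall j, differentiable (fun y => f y ord0 j) x) -> differentiable f x.
Proof.
move=> df; rewrite (_ : f = \sum_j (fun y => f y ord0 j *: ebase j)).
  apply: differentiable_sum => j; exact: differentiableZl.
apply/funext => y; rewrite fct_sumE; exact: row_sum_ebase.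
Qed.

Context (f : M -> M) (c d : chart R n M) (sf : smooth_map f) (Mc : atlas M c) (Md : atlas M d).

Lemma local_coord_differentiable p j : ldom f c d p ->
  differentiable (fun q => local f c d q ord0 j) p.
Proof.
by apply: usm_differentiable; [exact: open_ldom (smooth_map_cont sf)|exact: local_usm].
Qed.

Lemma local_differentiable p : ldom f c d p -> differentiable (local f c d) p.
Proof. by move=> Lp; apply: differentiable_row => j; exact: local_coord_differentiable. Qed.

Lemma jacobian_entry p i j : ldom f c d p ->
  jacobian (local f c d) p i j = 'D_(ebase i) (fun q => local f c d q ord0 j) p.
Proof.
move=> Lp; have dL := local_differentiable Lp.
have := deriveEjacobian (ebase i) dL; rewrite -rowE => H.
have df : derivable (local f c d) p (ebase i) by exact: diff_derivable.
by have := congr1 (fun v : 'rV[R]_n => v ord0 j) H; rewrite derive_mx// !mxE => <-.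
Qed.

Lemma D_local p v j : ldom f c d p ->
  'D_v (fun q => local f c d q ord0 j) p = (v *m jacobian (local f c d) p) ord0 j.
Proof.
move=> Lp; have dL := local_differentiable Lp.
rewrite -(deriveEjacobian v dL) derive_mx ?mxE//; exact: diff_derivable.
Qed.

Lemma meets_ldom p : Defs.meets f c d p <-> ldom f c d p.
Proof. by split=> [[_ _ ? ?]|[]]; split. Qed.

Lemma D_comp_local (h : M -> R) p v : smooth_fun h -> ldom f c d p ->
  is_derive p v (h \o f \o cinv c)
    ('D_(v *m jacobian (local f c d) p) (h \o cinv d) (local f c d p)).
Proof.
move=> sh Lp; have Lq : crange d (local f c d p) by apply: crange_cmap; case: Lp.
have dh : differentiable (h \o cinv d) (local f c d p).
  exact: usm_differentiable (crange_open' d) (smooth_fun_usm sh Md) Lq.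
have D := @chain_rule R n _ (h \o cinv d) (local f c d) p v dh
  (fun j => @diff_derivable _ _ _ _ _ v (local_coord_differentiable j Lp)).
have E : \forall q \near p, ((h \o cinv d) \o local f c d) q = (h \o f \o cinv c) q.
  have oL := open_ldom c d (smooth_map_cont sf).
  by apply: filterS (open_near oL Lp) => q [cq dq]; rewrite /= /local/= cmapK.
have := near_eq_is_derive E D; congr is_derive.
rewrite (differentiable_D _ dh); apply: eq_bigr => j _.
by rewrite D_local.
Qed.

End jacobians.

Lemma fmap_ultra {T S : Type} (F : set_system T) (f : T -> S) :
  UltraFilter F -> UltraFilter (f @ F).
Proof.
move=> UF; split; first exact: fmap_proper_filter.
move=> G PG FG; apply/seteqP; split=> // P GP.
have [//|nP] := in_ultra_setVsetC (f @^-1` P) UF.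
have GnP : G (~` P) by apply: FG.
by have [x [Px nPx]] := filter_ex (filterI GP GnP).
Qed.

Lemma continuous_near_le {R : realType} {V : topologicalType} (h : V -> R) p :
  (forall e : R, 0 < e -> \forall q \near p, `|h p - h q| <= e) ->
  {for p, continuous h}.
Proof. by move=> H; apply/cvgrPdist_le. Qed.

Lemma cvg_dist_le {R : realType} {T : Type} (F : set_system T) (u : T -> R) (l a e : R) :
  ProperFilter F -> u @ F --> l -> (\forall t \near F, `|a - u t| <= e) -> `|a - l| <= e.
Proof.
move=> PF /cvgrPdist_le ul ua; apply/ler_addgt0Pr => b b0.
have [t [at_ lt_]] := filter_ex (filterI ua (ul _ b0)).
rewrite -(subrKA (u t)); apply: le_trans (ler_normD _ _) _.
by rewrite lerD// distrC.
Qed.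

Lemma pcont_snd {R : realType} {T : topologicalType} {V : normedModType R}
    (U : set V) (h : V -> R) : (forall x, U x -> {for x, continuous h}) ->
  pcont [set z : T * V | U z.2] (fun=> h).
Proof.
move=> ch z Uz; apply: (@continuous_comp _ _ _ snd h); last exact: ch.
exact: cvg_snd.
Qed.

Section is_derive_pointwise.
Context {R : realType} {V : normedModType R}.
Implicit Types (f g : V -> R) (x v : V) (df dg : R).

Lemma is_derive_mulf f g x v df dg : is_derive x v f df -> is_derive x v g dg ->
  is_derive x v (fun y => f y * g y) (df * g x + f x * dg).
Proof.
move=> Df Dg; have := is_deriveM Df Dg; congr is_derive.
by rewrite addrC mulrC.
Qed.

Lemma is_derive_addf f g x v df dg : is_derive x v f df -> is_derive x v g dg ->
  is_derive x v (fun y => f y + g y) (df + dg).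
Proof. by move=> Df Dg; exact: is_deriveD Df Dg. Qed.

Lemma is_derive_sumf (I : Type) (r : seq I) (f : I -> V -> R) x v (df : I -> R) :
  (forall i, is_derive x v (f i) (df i)) ->
  is_derive x v (fun y => \sum_(i <- r) f i y) (\sum_(i <- r) df i).
Proof.
move=> Df; elim: r => [|i r IH].
  rewrite big_nil (_ : (fun _ => _) = cst 0); first exact: is_derive_cst.
  by apply/funext => y; rewrite big_nil.
rewrite big_cons (_ : (fun _ => _) = fun y => f i y + \sum_(i <- r) f i y).
  exact: is_derive_addf.
by apply/funext => y; rewrite big_cons.
Qed.

Lemma near_segment (P : set V) x v : (\forall y \near x, P y) ->
  \forall h \near (0 : R), forall s : R, `|s| <= `|h| -> P (s *: v + x).
Proof.
move=> /near_box => /(_ v 0)[h h0 hP].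
have N : \forall k \near (0 : R), `|k| < h by exact: nbhs0_lt.
apply: filterS N => k kh s sk; have := hP s 0 (le_trans sk (ltW kh)).
by rewrite normr0 scale0r add0r => /(_ (ltW h0)).
Qed.

End is_derive_pointwise.

Section isometries.
Context {R : realType} {n : nat} {M : manifoldType R n}.
Variable g : chart R n M -> 'rV[R]_n -> 'M[R]_n.
Hypothesis rg : riemannian g.
Implicit Types (c d : chart R n M).

Definition isom (f : M -> M) := forall c d p, Defs.meets f c d p ->
  pull_bilin f g c d p = g c p.

Lemma metric_posdef c p : atlas M c -> crange c p -> posdef (g c p).
Proof. by move=> Mc cp; have [_ _ H] := rg; have [] := H c p Mc cp. Qed.

Lemma metric_usm c i j : atlas M c -> usm (crange c) (fun p => g c p i j).
Proof.
move=> Mc; have [H _ _] := rg.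
exact: (iffLR (smooth_on_mxP (g c) (crange_open' c)) (H c Mc)).
Qed.

Lemma metric_inv_usm c i j : atlas M c -> usm (crange c) (fun p => invmx (g c p) i j).
Proof.
move=> Mc; apply: usm_invmx; [exact: crange_open'|by move=> k l; exact: metric_usm|].
by move=> p cp; apply: posdef_unit; exact: metric_posdef.
Qed.

Section two_charts.
Context (c d : chart R n M) (Mc : atlas M c) (Md : atlas M d).

Section one_isometry.
Variables (f : M -> M) (sf : smooth_map f) (isof : isom f).
Local Notation phi := (local f c d).

Definition jac (p : 'rV[R]_n) i j := 'D_(ebase i) (fun q => phi q ord0 j) p.

Definition hess (p : 'rV[R]_n) k i j :=
  'D_(ebase k) ('D_(ebase i) (fun q => phi q ord0 j)) p.

Local Notation J := jac.
Local Notation S := hess.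

Lemma isom_entries p i j : ldom f c d p ->
  g c p i j = \sum_l \sum_m J p i l * g d (phi p) l m * J p j m.
Proof.
move=> Lp; rewrite -(isof (c := c) (d := d) (p := p)); last exact/meets_ldom.
rewrite /pull_bilin; have := jacobian_entry sf Mc Md _ _ Lp.
move: (jacobian _ _) => Jm JmE.
rewrite mxE; under eq_bigr do rewrite !mxE mulr_suml.
rewrite exchange_big; apply: eq_bigr => l _; apply: eq_bigr => m _.
by rewrite !JmE.
Qed.

(** What remains of the derivative along [ebase k] of the isometry equation once the terms with
    second derivatives of the isometry are removed; only its 1-jet occurs. *)
Definition defect (p : 'rV[R]_n) (k i j : 'I_n) : R :=
  'D_(ebase k) (fun q => g c q i j) p -
  \sum_l \sum_m J p i l * (\sum_r J p k r *
     'D_(ebase r) (fun y => g d y l m) (phi p)) * J p j m.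

Lemma coord_usm j : usm (ldom f c d) (fun q => phi q ord0 j).
Proof. exact: local_usm. Qed.

Let oL : open (ldom f c d) := open_ldom c d (smooth_map_cont sf).

Lemma phi_crange p : ldom f c d p -> crange d (phi p).
Proof. by move=> [_ dp]; exact: crange_cmap. Qed.

Lemma targ_is_derive (b : 'rV[R]_n -> R) p v : usm (crange d) b -> ldom f c d p ->
  is_derive p v (b \o phi) (\sum_r 'D_v (fun q => phi q ord0 r) p *
    'D_(ebase r) b (phi p)).
Proof.
move=> sb Lp; apply: chain_rule.
  exact: usm_differentiable (crange_open' d) sb (phi_crange Lp).
by move=> j; have [] := usm_der v (coord_usm j) Lp.
Qed.

(* [gamma p k i j] is the inner product of the second derivative of the
   isometry in the directions k, i with its first derivative in direction j. *)
Definition gamma p k i j := \sum_l \sum_m S p k i l * g d (phi p) l m * J p j m.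

Lemma gamma_sym p k i j : ldom f c d p -> gamma p k i j = gamma p i k j.
Proof.
move=> Lp; apply: eq_bigr => l _; apply: eq_bigr => m _.
have E : S p k i l = S p i k l := usm_schwarz (ebase i) (ebase k) oL (coord_usm l) Lp.
by rewrite E.
Qed.

Lemma gamma_defect p k i j : ldom f c d p ->
  gamma p k i j + gamma p k j i = defect p k i j.
Proof.
move=> Lp; have dp := phi_crange Lp.
have DJ i' l : is_derive p (ebase k) (fun q => J q i' l) (S p k i' l).
  exact: usm_der (usm_D _ (coord_usm l)) Lp.
have DE := is_derive_sumf (index_enum 'I_n) (fun l =>
  is_derive_sumf (index_enum 'I_n) (fun m =>
    is_derive_mulf (is_derive_mulf (DJ i l) (targ_is_derive (ebase k) (metric_usm l m Md) Lp)) (DJ j m))).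
have E : \forall q \near p, \sum_l \sum_m J q i l * (g d (phi q) l m) * J q j m = g c q i j.
  by apply: filterS (open_near oL Lp) => q Lq; rewrite isom_entries.
have DE' := near_eq_is_derive E DE.
rewrite /defect (@derive_val _ _ _ _ _ _ _ DE').
have -> : gamma p k j i = \sum_l \sum_m J p i l * g d (phi p) l m * S p k j m.
  rewrite /gamma exchange_big; apply: eq_bigr => m _; apply: eq_bigr => l _.
  have [bT _] := metric_posdef Md dp; rewrite -[g d (phi p) in RHS]bT mxE; ring.
rewrite /gamma -sumrB -big_split/=; apply: eq_bigr => l _.
rewrite -sumrB -big_split/=; apply: eq_bigr => m _.
have aux (s b u x w t : R) : (s * b + u * x) * w + u * b * t - u * x * w =
    s * b * w + u * b * t by ring.
exact: (esym (aux _ _ _ _ _ _)).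
Qed.

(* Koszul's trick: the symmetry of the second derivatives determines them from
   the first derivatives of the metric. *)
Lemma gammaE p k i j : ldom f c d p ->
  gamma p k i j = 2^-1 * (defect p k i j + defect p i k j - defect p j k i).
Proof.
move=> Lp; rewrite -!gamma_defect// (gamma_sym i k j Lp) (gamma_sym i j k Lp).
rewrite (gamma_sym j k i Lp).
have aux (x y z : R) : x = 2^-1 * (x + y + (x + z) - (y + z)) by field.
exact: aux.
Qed.

(** In matrices, [gamma] is [S g_d J^T] while [g_c = J g_d J^T]; multiplying by [g_c^-1 J] therefore
    recovers [S]. *)
Lemma second_derivative p k i s : ldom f c d p ->
  S p k i s = \sum_j \sum_r gamma p k i j * invmx (g c p) j r * J p r s.
Proof.
move=> Lp; pose Jm : 'M[R]_n := \matrix_(i, j) J p i j.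
pose Sv : 'rV[R]_n := \row_l S p k i l.
have cp : crange c p by case: Lp.
have ag : g c p = Jm *m g d (phi p) *m Jm^T.
  apply/matrixP => a b; rewrite isom_entries// mxE.
  under [RHS]eq_bigr do rewrite !mxE mulr_suml.
  rewrite exchange_big; apply: eq_bigr => l _; apply: eq_bigr => m _.
  by rewrite !mxE.
have inv1 : g d (phi p) *m Jm^T *m invmx (g c p) *m Jm = 1%:M.
  apply: mulmx1C; rewrite !mulmxA -ag mulmxV//; apply: posdef_unit.
  exact: metric_posdef.
have : Sv = (\row_j gamma p k i j) *m invmx (g c p) *m Jm.
  have -> : \row_j gamma p k i j = Sv *m g d (phi p) *m Jm^T.
    apply/rowP => j; rewrite !mxE /gamma exchange_big; apply: eq_bigr => m _.
    rewrite !mxE mulr_suml; apply: eq_bigr => l _; by rewrite !mxE.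
  by rewrite -!mulmxA (mulmxA (g d _)) (mulmxA (_ *m Jm^T)) inv1 mulmx1.
move=> /rowP /(_ s); rewrite !mxE => ->.
rewrite exchange_big; apply: eq_bigr => r _; rewrite !mxE mulr_suml.
by apply: eq_bigr => j _; rewrite !mxE.
Qed.

(** Row i of the Jacobian, measured by the target metric, has the square length [g_ii] of [ebase i];
    [posdef_coord] bounds each of its entries. *)
Lemma jac_bound p i j : ldom f c d p ->
  J p i j ^+ 2 <= invmx (g d (phi p)) j j * g c p i i.
Proof.
move=> Lp; have := posdef_coord (\row_j J p i j) j (metric_posdef Md (phi_crange Lp)).
rewrite mxE => /le_trans; apply; rewrite isom_entries// bformE.
rewrite le_eqVlt; apply/orP; left; apply/eqP; congr (_ * _).
by apply: eq_bigr => l _; apply: eq_bigr => m _; rewrite !mxE.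
Qed.

End one_isometry.
End two_charts.

(** * Jets along an ultrafilter of isometries *)

Section limits.
Context {T : Type} (A : T -> Diff M) (isoA : forall t, isom (A t)).
Context (F : set_system T) {UF : UltraFilter F}.
Context (f : M -> M) (cf : continuous f).
Hypothesis Af : forall x,
  (fun z : T * M => A z.1 z.2) @ filter_prod F (nbhs x) --> f x.

Context (c d : chart R n M) (Mc : atlas M c) (Md : atlas M d).

(** Continuous convergence at [p], the form in which [cvg_Diff] expects its hypotheses. *)
Definition cconv (E : T -> 'rV[R]_n -> R) (p : 'rV[R]_n) (l : R) :=
  (fun z : T * 'rV[R]_n => E z.1 z.2) @ filter_prod F (nbhs p) --> l.

(* Expressions in the 1-jet of the isometries, with smooth coefficients that
   do not depend on the isometry. *)
Inductive jet_expr : (T -> 'rV[R]_n -> R) -> Prop :=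
| jet_source a : usm (crange c) a -> jet_expr (fun _ => a)
| jet_target b : usm (crange d) b -> jet_expr (fun t p => b (local (A t) c d p))
| jet_jac i j : jet_expr (fun t p => jac c d (A t) p i j)
| jet_add E1 E2 : jet_expr E1 -> jet_expr E2 -> jet_expr (fun t p => E1 t p + E2 t p)
| jet_mul E1 E2 : jet_expr E1 -> jet_expr E2 -> jet_expr (fun t p => E1 t p * E2 t p).

Lemma jet_cst a : jet_expr (fun _ _ => a).
Proof. by apply: jet_source; apply: usm_cst; exact: crange_open'. Qed.

Lemma jet_sum (I : Type) (r : seq I) (E : I -> T -> 'rV[R]_n -> R) :
  (forall i, jet_expr (E i)) -> jet_expr (fun t p => \sum_(i <- r) E i t p).
Proof.
move=> HE; elim: r => [|i r IH].
  rewrite (_ : (fun _ _ => _) = (fun _ _ => 0)); first exact: jet_cst.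
  by apply/funext => t; apply/funext => p; rewrite big_nil.
rewrite (_ : (fun _ _ => _) = (fun t p => E i t p + \sum_(i <- r) E i t p)).
  exact: jet_add.
by apply/funext => t; apply/funext => p; rewrite big_cons.
Qed.

Lemma jet_opp E : jet_expr E -> jet_expr (fun t p => - E t p).
Proof.
move=> HE; rewrite (_ : (fun _ _ => _) = (fun t p => -1 * E t p)).
  by apply: jet_mul => //; exact: jet_cst.
by apply/funext => t; apply/funext => p; rewrite mulN1r.
Qed.

Lemma jet_defect k i j : jet_expr (fun t p => defect c d (A t) p k i j).
Proof.
apply: jet_add.
  by apply: jet_source; apply: usm_D; exact: metric_usm.
apply: jet_opp; apply: jet_sum => l; apply: jet_sum => m.
apply: jet_mul; last exact: jet_jac.
apply: jet_mul; first exact: jet_jac.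
apply: jet_sum => r; apply: jet_mul; first exact: jet_jac.
by apply: (jet_target (b := 'D_(ebase r) (fun y => g d y l m))); apply: usm_D; exact: metric_usm.
Qed.

(** Koszul's formula closes the system: second derivatives are again expressions in the 1-jet. The
    class [jet_expr] is thus stable under derivation, and bounds on the 1-jet control every
    order. *)
Lemma jet_hess k i s : exists2 E, jet_expr E &
  forall t p, ldom (A t) c d p -> hess c d (A t) p k i s = E t p.
Proof.
exists (fun t p => \sum_j \sum_r 2^-1 * (defect c d (A t) p k i j +
   defect c d (A t) p i k j - defect c d (A t) p j k i) * invmx (g c p) j r *
   jac c d (A t) p r s).
  apply: jet_sum => j; apply: jet_sum => r; apply: jet_mul; last exact: jet_jac.
  apply: jet_mul; last by apply: jet_source; exact: metric_inv_usm.
  apply: jet_mul; first exact: jet_cst.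
  apply: jet_add; last exact: jet_opp (jet_defect _ _ _).
  by apply: jet_add; exact: jet_defect.
move=> t p Lp; rewrite (second_derivative Mc Md (Diff_smooth (A t)) (@isoA t))//.
apply: eq_bigr => j _; apply: eq_bigr => r _.
by rewrite (gammaE Mc Md (Diff_smooth (A t)) (@isoA t)).
Qed.

Lemma jet_derive E v : jet_expr E -> exists2 E', jet_expr E' &
  forall t p, ldom (A t) c d p -> is_derive p v (E t) (E' t p).
Proof.
have Dphi t p r : ldom (A t) c d p -> 'D_v (fun q => local (A t) c d q ord0 r) p =
    \sum_i v ord0 i * jac c d (A t) p i r.
  move=> Lp; apply: differentiable_D.
  exact: local_coord_differentiable (Diff_smooth (A t)) Mc Md _ _ Lp.
elim=> [a sa|b sb|i j|E1 E2 _ [E1' J1 D1] _ [E2' J2 D2]|E1 E2 H1 [E1' J1 D1] H2 [E2' J2 D2]].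
- exists (fun _ => 'D_v a); first by apply: jet_source; exact: usm_D.
  by move=> t p [cp _]; exact: usm_der sa cp.
- exists (fun t p => \sum_r (\sum_i v ord0 i * jac c d (A t) p i r) *
      'D_(ebase r) b (local (A t) c d p)).
    apply: jet_sum => r; apply: jet_mul; last exact: jet_target (usm_D _ sb).
    apply: jet_sum => i; apply: jet_mul; [exact: jet_cst|exact: jet_jac].
  move=> t p Lp; have := targ_is_derive Mc Md (Diff_smooth (A t)) v sb Lp.
  by congr is_derive; apply: eq_bigr => r _; rewrite Dphi.
- pose Eh k := s2val (cid2 (jet_hess k i j)).
  exists (fun t p => \sum_k v ord0 k * Eh k t p).
    apply: jet_sum => k; apply: jet_mul; first exact: jet_cst.
    exact: (s2valP (cid2 (jet_hess k i j))).
  move=> t p Lp; have sj := usm_D (ebase i) (local_usm j (Diff_smooth (A t)) Mc Md).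
  have := usm_der v sj Lp; congr is_derive.
  have oL := open_ldom c d (smooth_map_cont (Diff_smooth (A t))).
  rewrite (differentiable_D _ (usm_differentiable oL sj Lp)); apply: eq_bigr => k _.
  by rewrite /Eh -(s2valP' (cid2 (jet_hess k i j)) t p Lp).
- exists (fun t p => E1' t p + E2' t p); first exact: jet_add.
  by move=> t p Lp; apply: is_derive_addf; [exact: D1|exact: D2].
- exists (fun t p => E1' t p * E2 t p + E1 t p * E2' t p).
    by apply: jet_add; exact: jet_mul.
  by move=> t p Lp; apply: is_derive_mulf; [exact: D1|exact: D2].
Qed.

Let FP (p : 'rV[R]_n) : ProperFilter (filter_prod F (nbhs p)).
Proof. exact: filter_prod_proper. Qed.

Lemma cconv_point E p l : cconv E p l -> E ^~ p @ F --> l.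
Proof.
move=> El P Pl; have [[A0 B0] [/= FA Bp] AB] := El P Pl.
by apply: (@filterS _ F _ A0) FA => t At; exact: (AB (t, p) (conj At (nbhs_singleton Bp))).
Qed.

Lemma near_ldom p : ldom f c d p ->
  \forall z \near filter_prod F (nbhs p), ldom (A z.1) c d z.2.
Proof.
move=> [cp dp]; have [[A0 B0] [/= FA Bp] AB] := Af (near_cdom dp).
exists (A0, (cinv c @^-1` B0) `&` crange c) => /=.
  split=> //; exact: (@nearI _ p (cinv c @^-1` B0) (crange c)
    (cinv_cts cp Bp) (near_crange cp)).
move=> [t q] [/= At [Bq cq]]; split => //.
exact: (AB (t, cinv c q) (conj At Bq)).
Qed.

Lemma cconv_local p : ldom f c d p ->
  (fun z : T * 'rV[R]_n => local (A z.1) c d z.2) @ filter_prod F (nbhs p)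
    --> local f c d p.
Proof.
move=> [cp dp] P Pl; have [[A0 B0] [/= FA Bp] AB] := Af (near_cinv dp Pl).
exists (A0, cinv c @^-1` B0) => /=; first by split => //; exact: (cinv_cts cp).
by move=> [t q] [/= At Bq]; exact: (AB (t, cinv c q) (conj At Bq)).
Qed.

Lemma cconv_target b p : usm (crange d) b -> ldom f c d p ->
  cconv (fun t p => b (local (A t) c d p)) p (b (local f c d p)).
Proof.
move=> sb Lp; apply: cvg_comp (cconv_local Lp) _.
by apply: usm_cont sb _; case: Lp => _; exact: crange_cmap.
Qed.

Lemma cconv_source a p : usm (crange c) a -> ldom f c d p ->
  cconv (fun _ => a) p (a p).
Proof. by move=> sa [cp _]; apply: cvg_prod_snd; exact: usm_cont sa cp. Qed.

Lemma cconv_bounded E p l : cconv E p l ->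
  \forall z \near filter_prod F (nbhs p), `|E z.1 z.2| <= `|l| + 1.
Proof.
rewrite /cconv => El; have H : `|l| < `|l| + 1 by rewrite ltrDl.
by apply: filterS (cvgr_lt _ (cvg_norm El) _ H) => z /ltW.
Qed.

Lemma jet_bounded E p : jet_expr E -> ldom f c d p ->
  exists C, \forall z \near filter_prod F (nbhs p), `|E z.1 z.2| <= C.
Proof.
move=> HE Lp; elim: HE => [a sa|b sb|i j|E1 E2 _ [C1 H1] _ [C2 H2]|E1 E2 _ [C1 H1] _ [C2 H2]].
- by have := cconv_bounded (cconv_source sa Lp); exists (`|a p| + 1).
- by have := cconv_bounded (cconv_target sb Lp); exists (`|b (local f c d p)| + 1).
- have B1 := cconv_bounded (cconv_target (metric_inv_usm j j Md) Lp).
  have B2 := cconv_bounded (cconv_source (metric_usm i i Mc) Lp).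
  set C1 := _ + 1 in B1; set C2 := _ + 1 in B2.
  exists (C1 * C2 + 1); have nL := near_ldom Lp.
  apply: filterS3 B1 B2 nL => z b1 b2 Lz.
  have := jac_bound Mc Md (Diff_smooth (A z.1)) (@isoA z.1) i j Lz.
  set u := jac _ _ _ _ _ _ => uB.
  have u2 : u ^+ 2 <= C1 * C2.
    apply: le_trans uB _; apply: le_trans (ler_norm _) _.
    by rewrite normrM ler_pM.
  rewrite -real_normK ?num_real// in u2.
  (* A bound on the square gives [|u| <= C1 * C2 + 1] without a root: either [|u| <= 1], or
     [|u| <= u^2]. *)
  have [u1|u1] := leP `|u| 1.
    by apply: le_trans u1 _; rewrite lerDr; apply: le_trans u2; exact: sqr_ge0.
  apply: le_trans (_ : `|u| ^+ 2 <= _); first by rewrite expr2 ler_peMr// ltW.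
  by apply: le_trans u2 _; rewrite lerDl.
- exists (C1 + C2); apply: filterS2 H1 H2 => z h1 h2.
  by apply: le_trans (ler_normD _ _) _; exact: lerD.
- exists (C1 * C2); apply: filterS2 H1 H2 => z h1 h2.
  by rewrite normrM ler_pM.
Qed.

Lemma near_ball_prod (p : 'rV[R]_n) (P : T * 'rV[R]_n -> Prop) :
  (\forall z \near filter_prod F (nbhs p), P z) ->
  exists2 A0, F A0 & exists2 r : R, 0 < r &
    forall t v, A0 t -> `|v| < r -> P (t, v + p).
Proof.
move=> [[A0 B0] [/= FA /nbhs_ballP[r /= r0 rB]] AB]; exists A0 => //; exists r => //.
move=> t v At vr; apply: AB; split => //=; apply: rB.
by rewrite -ball_normE/= opprD addrCA subrr addr0 normrN.
Qed.

(* Bounded derivatives make the first derivatives equicontinuous, so that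
   their pointwise limits along an ultrafilter are continuous limits. *)
Lemma jet_cconv E p : jet_expr E -> ldom f c d p -> exists l, cconv E p l.
Proof.
move=> HE Lp; elim: HE => [a sa|b sb|i j|E1 E2 _ [l1 H1] _ [l2 H2]|E1 E2 _ [l1 H1] _ [l2 H2]].
- by exists (a p); exact: cconv_source.
- by exists (b (local f c d p)); exact: cconv_target.
- clear E; pose E t q := jac c d (A t) q i j.
  have [C HC] := jet_bounded (jet_jac i j) Lp.
  (* At [p] itself a limit exists because the values lie in a compact segment and [F] is an
     ultrafilter. *)
  have [l El] : exists l : R, (fun t => E t p) @ F --> l.
    have FC : F [set t | `|E t p| <= C].
      have [[A0 B0] [/= FA Bp] AB] := HC; apply: filterS FA => t At.
      exact: (AB (t, p) (conj At (nbhs_singleton Bp))).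
    have K := @segment_compact R (- C) C; rewrite compact_ultra in K.
    have UE : UltraFilter ((fun t => E t p) @ F) by exact: fmap_ultra.
    have FC' : ((fun t => E t p) @ F) [set` `[- C, C]].
      by apply: (@filterS _ F _ _ _ _ FC) => t /=; rewrite in_itv/= ler_norml.
    have [l [_ El]] := K _ UE FC'.
    by exists l.
  exists l.
  have [E' sE' DE] : exists2 E', (forall k, jet_expr (E' k)) &
      forall k t q, ldom (A t) c d q -> 'D_(ebase k) (E t) q = E' k t q.
    have H k := cid2 (jet_derive (ebase k) (jet_jac i j)).
    exists (fun k => s2val (H k)); first by move=> k; exact: s2valP (H k).
    by move=> k t q Lq; have [] := s2valP' (H k) t q Lq.
  have [D HD] : exists D, \forall z \near filter_prod F (nbhs p),
      forall k, `|E' k z.1 z.2| <= D.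
    have H k := cid (jet_bounded (sE' k) Lp).
    exists (\sum_k `|sval (H k)|).
    apply: (@filter_forall _ _ (fun k z => `|E' k z.1 z.2| <= \sum_k `|sval (H k)|)) => k.
    apply: filterS (svalP (H k)) => z /le_trans; apply.
    by apply: le_trans (ler_norm _) _; rewrite (bigD1 k)//= lerDl sumr_ge0.
  have [A0 FA0 [r r0 rP]] := near_ball_prod (filterI (near_ldom Lp) HD).
  have D0 : 0 <= n%:R * `|D| :> R by rewrite mulr_ge0.
  (* The mean value theorem on the segment from [p] to [v + p], with the partial derivatives of
     [E t] bounded by [D] uniformly in [t]. *)
  have lip t v : A0 t -> `|v| < r -> `|E t (v + p) - E t p| <= n%:R * `|D| * `|v|.
    move=> At vr; have oL := open_ldom c d (smooth_map_cont (Diff_smooth (A t))).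
    have sj := usm_D (ebase i) (local_usm j (Diff_smooth (A t)) Mc Md).
    have Ls (s : R) : `|s| <= 1 -> ldom (A t) c d (s *: v + p).
      move=> s1; apply: (rP t (s *: v) At _).1; rewrite normrZ.
      by apply: le_lt_trans vr; rewrite ler_piMl.
    have [|s s1] := @mvt_line R _ (E t) p v 1.
      by move=> s; rewrite normr1 => /Ls Lsp; have [] := usm_der v sj Lsp.
    rewrite normr1 in s1; rewrite scale1r mul1r => ->.
    rewrite (differentiable_D _ (usm_differentiable oL sj (Ls s s1))).
    apply: le_trans (ler_norm_sum _ _ _) _.
    rewrite -mulrA mulr_natl -[X in _ *+ X](card_ord n) -sumr_const; apply: ler_sum => k _.
    rewrite normrM mulrC ler_pM// ?coord_le_norm//.
    rewrite (DE k t _ (Ls s s1)) (le_trans _ (ler_norm D))//.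
    apply: (rP t (s *: v) At _).2; rewrite normrZ.
    by apply: le_lt_trans vr; rewrite ler_piMl.
  apply/cvgrPdist_le => e e0; have e20 : 0 < e / 2 by rewrite divr_gt0.
  move/cvgrPdist_le : El => /(_ _ e20) El.
  (* On the ball of radius [r'] the Lipschitz bound contributes at most [e / 2]; the added 1 keeps
     the denominator positive. *)
  pose r' := Num.min r (e / 2 / (n%:R * `|D| + 1)).
  have r'0 : 0 < r' by rewrite lt_min r0/= divr_gt0// ltr_wpDl.
  exists ([set t | A0 t /\ `|l - E t p| <= e / 2], [set q | `|q - p| < r']) => /=.
    split; first exact: filterI.
    apply/nbhs_ballP; exists r' => // q; rewrite -ball_normE/= distrC.
    by [].
  move=> [t q] [/= [At Etl] qr]; rewrite (splitr e) -(subrKA (E t p)).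
  apply: le_trans (ler_normD _ _) _; apply: lerD => //.
  have qr' : `|q - p| < r by apply: lt_le_trans qr _; rewrite ge_min lexx.
  have H := lip t (q - p) At qr'; rewrite subrK in H.
  rewrite distrC; apply: le_trans H _.
  apply: (@le_trans _ _ ((n%:R * `|D| + 1) * `|q - p|)); first by rewrite ler_wpM2r// lerDl.
  rewrite mulrC -ler_pdivlMr ?ltr_wpDl//; apply: ltW; apply: lt_le_trans qr _.
  by rewrite ge_min lexx orbT.
- by exists (l1 + l2); exact: cvgD.
- by exists (l1 * l2); exact: cvgM.
Qed.

Lemma jet_limit_cont E (Eh : 'rV[R]_n -> R) p : jet_expr E ->
  (forall p, ldom f c d p -> cconv E p (Eh p)) -> ldom f c d p ->
  {for p, continuous Eh}.
Proof.
move=> HE HEh Lp; have oL := open_ldom c d cf.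
apply: continuous_near_le => e e0.
have := HEh p Lp; rewrite /cconv => /cvgrPdist_le /(_ _ e0) [[A0 B0] [/= FA Bp] AB].
apply: filterS (nearI Bp (open_near oL Lp)) => q [Bq Lq].
apply: (cvg_dist_le _ (cconv_point (HEh q Lq))).
by apply: filterS FA => t At; exact: (AB (t, q) (conj At Bq)).
Qed.

(** For fixed [h] the mean value theorem writes each difference quotient as a value of [E' t] near
    [p], hence close to [Eh' p]; letting the index run along [F] transfers the estimate to the
    quotient of [Eh]. *)
Lemma jet_limit_derive E (Eh : 'rV[R]_n -> R) v : jet_expr E ->
  (forall p, ldom f c d p -> cconv E p (Eh p)) ->
  exists E' Eh', [/\ jet_expr E', forall p, ldom f c d p -> cconv E' p (Eh' p),
    forall t p, ldom (A t) c d p -> is_derive p v (E t) (E' t p) &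
    forall p, ldom f c d p -> is_derive p v Eh (Eh' p)].
Proof.
move=> HE HEh; have oL := open_ldom c d cf.
have [E' HE' DE] := jet_derive v HE.
have ex p : exists l, ldom f c d p -> cconv E' p l.
  have [Lp|nL] := pselect (ldom f c d p); last by exists 0.
  by have [l El] := jet_cconv HE' Lp; exists l.
pose Eh' p := sval (cid (ex p)).
have HEh' p : ldom f c d p -> cconv E' p (Eh' p) := svalP (cid (ex p)).
exists E', Eh'; split => // p Lp; apply/dderivP; rewrite /dderiv.
apply/cvgrPdist_le => e e0; have := HEh' p Lp.
rewrite /cconv => /cvgrPdist_le /(_ _ e0) N.
have [[A0 B0] [/= FA Bp] AB] := filterI (near_ldom Lp) N.
have NS := near_segment v (nearI Bp (open_near oL Lp)).
have N2 : \forall h \near (0 : R)^', h != 0 /\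
    forall s : R, `|s| <= `|h| -> B0 (s *: v + p) /\ ldom f c d (s *: v + p).
  exact: (filterI (nbhs_dnbhs_neq (0 : R)) (nbhs_dnbhs NS)).
apply: filterS N2 => h [h0 hP]; have [Bh Lh] := hP h (lexx _).
have cE : (fun t => h^-1 * (E t (h *: v + p) - E t p)) @ F -->
    h^-1 * (Eh (h *: v + p) - Eh p).
  apply: cvgM; first exact: cvg_cst.
  by apply: cvgB; [exact: cconv_point (HEh _ Lh)|exact: cconv_point (HEh _ Lp)].
apply: (cvg_dist_le _ cE).
apply: filterS FA => t At.
have At' s : `|s| <= `|h| -> ldom (A t) c d (s *: v + p) /\
    `|Eh' p - E' t (s *: v + p)| <= e.
  by move=> /hP[Bs _]; exact: (AB (t, s *: v + p) (conj At Bs)).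
have [|s sh ->] := @mvt_line R _ (E t) p v h.
  by move=> s sh; have [] := DE t _ (At' s sh).1.
rewrite mulKf// (@derive_val _ _ _ _ _ _ _ (DE t _ (At' s sh).1)).
exact: (At' s sh).2.
Qed.

Lemma jet_limit_usm E (Eh : 'rV[R]_n -> R) : jet_expr E ->
  (forall p, ldom f c d p -> cconv E p (Eh p)) -> usm (ldom f c d) Eh.
Proof.
move=> HE HEh k; elim: k E Eh HE HEh => [|k IH] E Eh HE HEh.
  by split=> //; apply: pcont_snd => p; exact: jet_limit_cont HE HEh.
have oL := open_ldom c d cf.
apply: (pCkS_intro (open_snd oL)).
  by apply: pcont_snd => p; exact: jet_limit_cont HE HEh.
move=> v; have [E' [Eh' [HE' HEh' _ D]]] := jet_limit_derive v HE HEh.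
exists (fun _ => Eh'); last exact: IH HE' HEh'.
by move=> [b q] /= Lq; exact: D.
Qed.

Lemma jet_limit_iterD E (Eh : 'rV[R]_n -> R) vs : jet_expr E ->
  (forall p, ldom f c d p -> cconv E p (Eh p)) ->
  forall p, ldom f c d p ->
  cconv (fun t => Defs.iterD vs (E t : _ -> R^o)) p (Defs.iterD vs (Eh : _ -> R^o) p).
Proof.
move=> HE HEh; have oL := open_ldom c d cf.
suff [E' [Eh' [HE' HEh' EE EEh]]] : exists E' Eh', [/\ jet_expr E',
    forall p, ldom f c d p -> cconv E' p (Eh' p),
    forall t p, ldom (A t) c d p -> Defs.iterD vs (E t : _ -> R^o) p = E' t p &
    forall p, ldom f c d p -> Defs.iterD vs (Eh : _ -> R^o) p = Eh' p].
  move=> p Lp; rewrite EEh//; apply: cvg_near_eq (HEh' p Lp).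
  by apply: filterS (near_ldom Lp) => z /EE.
elim: vs => [|v vs [E1 [Eh1 [HE1 HEh1 EE1 EEh1]]]]; first by exists E, Eh.
have [E' [Eh' [HE' HEh' D1 D2]]] := jet_limit_derive v HE1 HEh1.
exists E', Eh'; split => //= [t p Lp|p Lp].
  rewrite -(@derive_val _ _ _ _ _ _ _ (D1 t p Lp)); apply: near_eq_derive.
  apply: filterS (open_near (open_ldom c d (smooth_map_cont (Diff_smooth (A t)))) Lp) => q.
  exact: EE1.
rewrite -(@derive_val _ _ _ _ _ _ _ (D2 p Lp)); apply: near_eq_derive.
by apply: filterS (open_near oL Lp) => q; exact: EEh1.
Qed.

Lemma cconv_coord j p : ldom f c d p ->
  cconv (fun t q => local (A t) c d q ord0 j) p (local f c d p ord0 j).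
Proof.
by move=> Lp; apply: (cconv_target (b := fun y => y ord0 j)) => //; apply: usm_coord; exact: crange_open'.
Qed.

Lemma jet_coord j : jet_expr (fun t q => local (A t) c d q ord0 j).
Proof.
by apply: (jet_target (b := fun y => y ord0 j)); apply: usm_coord; exact: crange_open'.
Qed.

End limits.

Section limit_isometry.
Context {T : Type} (A : T -> Diff M) (isoA : forall t, isom (A t)).
Context (F : set_system T) {UF : UltraFilter F}.
Context (f : M -> M) (cf : continuous f).
Hypothesis Af : forall x,
  (fun z : T * M => A z.1 z.2) @ filter_prod F (nbhs x) --> f x.

Lemma limit_smooth : smooth_map f.
Proof.
move=> c Mc; split.
  move=> p cp; apply: continuous_comp; first exact: cinv_cts.
  exact: cf.
move=> d Md; have oL := open_ldom c d cf.
apply: (iffRL (smooth_on_mxP (d \o (f \o cinv c)) oL)) => i j; rewrite ord1.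
apply: (jet_limit_usm isoA cf Af Mc Md (jet_coord A c d j)) => p.
exact: cconv_coord.
Qed.

Lemma limit_Diff (f' : Diff M) : f' = f :> (M -> M) -> A @ F --> f'.
Proof.
move=> f'E; apply: cvg_Diff => c d p Mc Md; rewrite f'E => Lp; split.
  exact: near_ldom Lp.
move=> vs j.
apply: (@jet_limit_iterD _ A isoA F UF f cf Af c d Mc Md _
  (fun q => local f c d q ord0 j) vs (jet_coord A c d j)) => // q Lq.
exact: cconv_coord.
Qed.

End limit_isometry.
End isometries.

(** * Properness of isometric actions *)

Lemma norm_le_sqr {R : realType} (a r : R) : 0 <= r -> a ^+ 2 <= r ^+ 2 -> `|a| <= r.
Proof.
by move=> r0 ar; rewrite -[leLHS]sqrtr_sqr -(ger0_norm r0) -[leRHS]sqrtr_sqr ler_wsqrtr.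
Qed.

Section pointwise_continuity.
Context {R : realType} {S : topologicalType}.
Implicit Types (f g : S -> R) (x : S).

Lemma continuous_sumR (I : Type) (r : seq I) (f : I -> S -> R) x :
  (forall i, {for x, continuous (f i)}) ->
  {for x, continuous (fun y => \sum_(i <- r) f i y)}.
Proof. by move=> cf; apply: cvg_sumR. Qed.

Lemma continuous_mulR f g x : {for x, continuous f} -> {for x, continuous g} ->
  {for x, continuous (fun y => f y * g y)}.
Proof. by move=> cf cg; apply: cvgM. Qed.

Lemma continuous_normR f x : {for x, continuous f} ->
  {for x, continuous (fun y => `|f y|)}.
Proof. by move=> cf; apply: cvg_norm. Qed.

End pointwise_continuity.

Section maps.
Context {R : realType}.

Lemma smooth_map2_cont m1 m2 n (M1 : manifoldType R m1) (M2 : manifoldType R m2)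
    (N : manifoldType R n) (f : M1 -> M2 -> N) : smooth_map2 f ->
  continuous (fun z : M1 * M2 => f z.1 z.2).
Proof.
move=> sf [x y]; have [c1 Mc1 cx] := chart_at x; have [c2 Mc2 cy] := chart_at y.
have [cf _] := sf c1 c2 Mc1 Mc2.
have H : {for (x, y), continuous
    ((fun p => f (cinv c1 p.1) (cinv c2 p.2)) \o (fun z : M1 * M2 => (c1 z.1, c2 z.2)))}.
  apply: continuous_comp.
    apply: (@pair_continuous _ _ _ (fun z : M1 * M2 => c1 z.1) (fun z : M1 * M2 => c2 z.2)).
      apply: (@continuous_comp _ _ _ fst c1); first exact: cvg_fst.
      exact: cmap_continuous.
    apply: (@continuous_comp _ _ _ snd c2); first exact: cvg_snd.
    exact: cmap_continuous.
  by apply: cf; split => /=; exact: crange_cmap.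
apply: continuous_near_eq H.
apply: (near_pair (z := (x, y)) (near_cdom cx) (near_cdom cy)) => u v cu cv /=.
by rewrite !cmapK.
Qed.

Context {n : nat} {M : manifoldType R n}.

Lemma smooth_map_id : smooth_map (@idfun M).
Proof.
move=> c Mc; split; first by move=> p cp; exact: cinv_cts.
move=> d Md.
have oL := open_ldom c d (fun x => @cvg_id _ (nbhs x) : {for x, continuous (@idfun M)}).
apply: (iffRL (smooth_on_mxP (d \o (idfun \o cinv c)) oL)) => i j; rewrite ord1.
exact: transition_usm.
Qed.

Lemma smooth_fun_comp (h : M -> R) (f : M -> M) : smooth_fun h -> smooth_map f ->
  smooth_fun (h \o f).
Proof.
move=> sh sf c Mc; apply/smooth_on_RP; first exact: crange_open'.
apply: usm_local => p cp; have [d Md dp] := chart_at (f (cinv c p)).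
exists (ldom f c d); first by split.
have oL := open_ldom c d (smooth_map_cont sf).
apply: (@usm_ext _ _ _ ((h \o cinv d) \o local f c d)) => //.
  by move=> q [cq dq]; rewrite /= /local/= cmapK.
apply: (usm_comp (crange_open' d) oL (smooth_fun_usm sh Md)).
  by move=> j; exact: local_usm.
by move=> q [_ dq]; exact: crange_cmap.
Qed.

Lemma near_sep (x y : M) : (forall U, nbhs x U -> U y) -> x = y.
Proof.
move=> H; apply: manifold_hausdorff => A B Ax By; exists y; split; first exact: H.
exact: nbhs_singleton.
Qed.

End maps.

Section distance.
Context {R : realType} {n : nat} {M : manifoldType R n}.
Variable g : chart R n M -> 'rV[R]_n -> 'M[R]_n.
Hypothesis rg : riemannian g.
Implicit Types (c d : chart R n M) (x y z : M) (r : R).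

Definition lip1 (f : M -> R) := smooth_fun f /\ forall c p v, atlas M c -> crange c p ->
  ('D_v (f \o cinv c : _ -> R^o) p) ^+ 2 <= bform (g c p) v v.

(* [dle x y r] says that the Riemannian distance of x and y is at most r; the
   distance is defined by duality with the functions of gradient at most 1. *)
Definition dle x y r := forall f, lip1 f -> `|f x - f y| <= r.

Lemma bform_pull (b : 'M[R]_n) (K : 'M[R]_n) (v : 'rV[R]_n) :
  bform b (v *m K) (v *m K) = bform (K *m b *m K^T) v v.
Proof. by rewrite /bform trmx_mul !mulmxA. Qed.

Lemma lip1_isom f (A : M -> M) : smooth_map A -> isom g A -> lip1 f -> lip1 (f \o A).
Proof.
move=> sA iA [sf lf]; split; first exact: smooth_fun_comp.
move=> c p v Mc cp; have [d Md dp] := chart_at (A (cinv c p)).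
have Lp : ldom A c d p by split.
have D := D_comp_local sA Mc Md v sf Lp.
rewrite (@derive_val _ _ _ _ _ _ _ D).
have := lf d (local A c d p) (v *m jacobian (local A c d) p) Md (crange_cmap dp).
move/le_trans; apply; rewrite bform_pull.
by have := iA c d p; rewrite /pull_bilin => ->//; exact/meets_ldom.
Qed.

Lemma isom_id : isom g idfun.
Proof. by move=> c d p mp; have [_ /(_ c d p mp) ->] := rg. Qed.

Lemma dle_sym x y r : dle x y r -> dle y x r.
Proof. by move=> H f lf; rewrite distrC; exact: H. Qed.

Lemma dle_trans y x z r s : dle x y r -> dle y z s -> dle x z (r + s).
Proof.
move=> H1 H2 f lf; rewrite -(subrKA (f y)); apply: le_trans (ler_normD _ _) _.
by apply: lerD; [exact: H1|exact: H2].
Qed.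

Lemma dle_isom (A : M -> M) x y r : smooth_map A -> isom g A -> dle x y r ->
  dle (A x) (A y) r.
Proof. by move=> sA iA H f lf; exact: (H _ (lip1_isom sA iA lf)). Qed.

Lemma near_bform_le c p : atlas M c -> crange c p -> exists2 C : R, 0 <= C &
  \forall q \near p, forall v, bform (g c q) v v <= C * `|v| ^+ 2.
Proof.
move=> Mc cp; pose C := \sum_k \sum_l (`|g c p k l| + 1).
exists C; first by apply: sumr_ge0 => k _; apply: sumr_ge0 => l _; rewrite addr_ge0.
have N : \forall q \near p, forall k l, `|g c q k l| <= `|g c p k l| + 1.
  apply: near_forall => k; apply: near_forall => l.
  have cg : {for p, continuous (fun q => g c q k l)} := usm_cont (metric_usm rg k l Mc) cp.
  have lt1 : `|g c p k l| < `|g c p k l| + 1 by rewrite ltrDl.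
  by apply: filterS (cvgr_lt _ (cvg_norm cg) _ lt1) => q /ltW.
apply: filterS N => q qP v; rewrite bformE /C mulr_suml; apply: ler_sum => k _.
rewrite mulr_suml; apply: ler_sum => l _; apply: le_trans (ler_norm _) _.
rewrite mulrAC !normrM mulrC expr2; apply: ler_pM; rewrite ?mulr_ge0//.
by apply: ler_pM; rewrite ?coord_le_norm.
Qed.

(** Near [x] the metric is at most [C |v|^2] in a chart, so a function of gradient at most 1 varies
    by at most [(C + 1) |c y - c x|]; [C + 1] replaces the square root of [C]. *)
Lemma dle_near x r : 0 < r -> \forall y \near x, dle x y r.
Proof.
move=> r0; have [c Mc cx] := chart_at x.
have [C C0 NC] := near_bform_le Mc (crange_cmap cx).
have := nearI NC (near_crange (crange_cmap cx)).
move=> /nbhs_ballP[s /= s0 sP].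
pose t := Num.min s (r / (C + 1)).
have t0 : 0 < t by rewrite lt_min s0/= divr_gt0// ltr_wpDl.
have nt : \forall q \near c x, `|q - c x| < t.
  by apply/nbhs_ballP; exists t => // q; rewrite -ball_normE/= distrC.
have := nearI (near_cdom cx) (near_cinv cx nt); apply: filterS => y [cy yt] f [sf lf].
pose v := c y - c x.
have vs : `|v| < s by apply: lt_le_trans yt _; rewrite ge_min lexx.
have bs (u : R) : `|u| <= 1 -> (forall w, bform (g c (u *: v + c x)) w w <= C * `|w| ^+ 2)
    /\ crange c (u *: v + c x).
  move=> u1; apply: sP; rewrite -ball_normE/= opprD addrCA subrr addr0 normrN normrZ.
  by apply: le_lt_trans vs; rewrite ler_piMl.
have suf := smooth_fun_usm sf Mc.
have [|u u1] := @mvt_line R _ (f \o cinv c) (c x) v 1.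
  by move=> u; rewrite normr1 => /bs[_ cu]; have [] := usm_der v suf cu.
rewrite normr1 in u1; rewrite scale1r mul1r /v subrK /= !cmapK// => E.
rewrite distrC E; have [bu cu] := bs u u1.
apply: norm_le_sqr; first exact: ltW.
apply: le_trans (lf c _ v Mc cu) _; apply: le_trans (bu v) _.
have Cv : (C + 1) * `|v| <= r.
  rewrite mulrC -ler_pdivlMr ?ltr_wpDl//; apply: ltW; apply: lt_le_trans yt _.
  by rewrite ge_min lexx orbT.
apply: (@le_trans _ _ (((C + 1) * `|v|) ^+ 2)); last first.
  by rewrite ler_sqr ?nnegrE ?mulr_ge0 ?addr_ge0// ltW.
rewrite exprMn ler_wpM2r ?exprn_ge0//; nra.
Qed.

Lemma D_le_bform c p (f : 'rV[R]_n -> R) v : atlas M c -> crange c p ->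
  differentiable f p ->
  ('D_v f p) ^+ 2 <= bform (g c p) v v *
    (\sum_j `|'D_(ebase j) f p| * Num.sqrt (invmx (g c p) j j)) ^+ 2.
Proof.
move=> Mc cp df; have pg := metric_posdef rg Mc cp; have b0 := posdef_ge0 v pg.
have S0 : 0 <= \sum_j `|'D_(ebase j) f p| * Num.sqrt (invmx (g c p) j j).
  by apply: sumr_ge0 => j _; rewrite mulr_ge0 ?sqrtr_ge0.
rewrite -(sqr_sqrtr b0) -exprMn -real_normK ?num_real//.
rewrite ler_sqr ?nnegrE ?mulr_ge0 ?sqrtr_ge0//.
rewrite (differentiable_D _ df); apply: le_trans (ler_norm_sum _ _ _) _.
rewrite mulr_sumr; apply: ler_sum => j _; rewrite normrM [leRHS]mulrCA [leLHS]mulrC.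
apply: ler_pM => //; rewrite -sqrtrM// -sqrtr_sqr ler_wsqrtr// mulrC.
exact: posdef_coord.
Qed.

(** A bump function at [x] that vanishes off [U], divided by a bound for its gradient, is a
    competitor in [dle] that separates [x] from the complement of [U]. With [dle_near], the distance
    induces the topology of [M]. *)
Lemma dle_nbhs x (U : set M) : (\forall y \near x, U y) ->
  exists2 r, 0 < r & forall y, dle x y r -> U y.
Proof.
move=> Ux; have [c Mc cx] := chart_at x.
have [f [sf f0 fx [K [cK KU fK]]]] := bump (nearI Ux (near_cdom cx)).
have suf := smooth_fun_usm sf Mc; have Kx : K x.
  by apply: contrapT => /fK fx0; move: fx; rewrite fx0 ltxx.
(* By [D_le_bform], [h] dominates the length of the gradient of [f]; its maximum on the compact set
   [K] gives the normalising constant [C]. *)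
pose h q := \sum_j `|'D_(ebase j) (f \o cinv c) q| * Num.sqrt (invmx (g c q) j j).
have ch q : crange c q -> {for q, continuous h}.
  move=> cq; apply: continuous_sumR => j; apply: continuous_mulR.
    by apply: continuous_normR; exact: (usm_cont (usm_D (ebase j) suf) cq).
  apply: (@continuous_comp _ _ _ (fun q => invmx (g c q) j j) Num.sqrt).
    exact: (usm_cont (metric_inv_usm rg j j Mc) cq).
  exact: sqrt_continuous.
have [x1 _ hx1] : exists2 x1, x1 \in K & forall y, y \in K -> h (c y) <= h (c x1).
  apply: (compact_EVT_max (f := h \o c)) => //; first by exists x.
  apply: continuous_in_subspaceT => y; rewrite inE => /KU[_ cy].
  by apply: continuous_comp; [exact: cmap_continuous|exact/ch/crange_cmap].
pose C := `|h (c x1)| + 1; have C0 : 0 < C by rewrite ltr_wpDl.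
have lf : lip1 (fun y => C^-1 * f y).
  split.
    move=> c' Mc'; apply/smooth_on_RP; first exact: crange_open'.
    by apply: usmZ; [exact: crange_open'|exact: smooth_fun_usm].
  move=> c' p v Mc' cp.
  have sfc' := smooth_fun_usm sf Mc'.
  have D := is_deriveZ C^-1 (usm_der v sfc' cp).
  have -> : 'D_v ((fun y => C^-1 * f y) \o cinv c' : _ -> R^o) p =
      C^-1 * 'D_v (f \o cinv c') p := @derive_val _ _ _ _ _ _ _ D.
  rewrite exprMn exprVn ler_pdivrMl ?exprn_gt0//.
  have pg := metric_posdef rg Mc' cp.
  have [Kp|nKp] := pselect (K (cinv c' p)); last first.
    have N : \forall q \near p, 0 = (f \o cinv c') q.
      have oK := open_chart_set1 c' (closed_openC (compact_closedM cK)).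
      by apply: filterS (open_near oK (conj cp nKp)) => q [_ /fK] /= ->.
    rewrite -(near_eq_derive v N) derive_cst expr0n/=.
    by rewrite mulr_ge0 ?posdef_ge0 ?exprn_ge0// ltW.
  have [_ cp2] := KU _ Kp; have Lp : ldom idfun c' c p by split.
  have D2 := D_comp_local smooth_map_id Mc' Mc v sf Lp.
  have -> : 'D_v (f \o cinv c') p = 'D_(v *m jacobian (local idfun c' c) p)
      (f \o cinv c) (local idfun c' c p) := @derive_val _ _ _ _ _ _ _ D2.
  have cq : crange c (local idfun c' c p) := crange_cmap cp2.
  have df := usm_differentiable (crange_open' c) suf cq.
  apply: le_trans (D_le_bform _ Mc cq df) _.
  rewrite bform_pull; have := isom_id (c := c') (d := c) (p := p).
  rewrite /pull_bilin => ->; last exact/meets_ldom.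
  rewrite mulrC ler_wpM2r ?posdef_ge0//.
  rewrite ler_sqr ?nnegrE ?(ltW C0)//; last first.
    by apply: sumr_ge0 => j _; rewrite mulr_ge0 ?sqrtr_ge0.
  have := hx1 (cinv c' p) (mem_set Kp) => /le_trans; apply.
  by apply: le_trans (ler_norm _) _; rewrite lerDl.
exists (C^-1 * f x / 2); first by rewrite divr_gt0// mulr_gt0// invr_gt0.
move=> y /(_ _ lf) H; apply: contrapT => nU.
have fy : f y = 0 by apply: fK => /KU[].
move: H; rewrite fy mulr0 subr0 ger0_norm ?mulr_ge0 ?invr_ge0 ?(ltW C0)//.
have pos : 0 < C^-1 * f x by rewrite mulr_gt0// invr_gt0.
by rewrite leNgt ltr_pdivrMr// ltr_pMr// ltr1n.
Qed.

Lemma dle_sep x y : (forall r, 0 < r -> dle x y r) -> x = y.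
Proof. by move=> H; apply: near_sep => U /dle_nbhs[r r0 rU]; exact/rU/H. Qed.

Lemma cvg_dle {T : Type} (F : set_system T) (u : T -> M) x : Filter F ->
  u @ F --> x <-> forall r, 0 < r -> \forall t \near F, dle x (u t) r.
Proof.
move=> FF; split=> [ux r r0|H U /dle_nbhs[r r0 rU]]; first exact: ux (dle_near x r0).
by apply: filterS (H r r0) => t; exact: rU.
Qed.

Lemma compact_ball x : exists2 r, 0 < r &
  exists2 K : set M, compact K & forall y, dle x y r -> K y.
Proof.
have [K [cK Kx _]] := locally_compactM (@filterT _ (nbhs x) _ : \forall y \near x, setT y).
by have [r r0 rK] := dle_nbhs Kx; exists r => //; exists K.
Qed.

End distance.

Section group_action.
Context {R : realType} {n m : nat} {M : manifoldType R n} {G : lieGroupType R m}.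
Variable rho : G -> Diff M.
Hypothesis G_closed : closed_lie_subgroup rho.

Lemma rho_mul a b x : rho (a * b)%g x = rho a (rho b x).
Proof. exact: rhoM G_closed a b x. Qed.

Lemma rho_one x : rho 1%g x = x.
Proof.
have [h [_ hK _]] := Diff_inv (rho 1%g).
by rewrite -[LHS]hK -rho_mul monoid.mulg1 hK.
Qed.

Lemma rhoK a : cancel (rho a) (rho a^-1%g).
Proof. by move=> x; rewrite -rho_mul monoid.mulVg rho_one. Qed.

Lemma rhoVK a : cancel (rho a^-1%g) (rho a).
Proof. by move=> x; rewrite -rho_mul monoid.mulgV rho_one. Qed.

Lemma rho_continuous : continuous rho.
Proof.
move=> a U; rewrite nbhsE => -[B [oB Ba] BU].
apply: (@filterS _ (nbhs a) _ (rho @^-1` B)); first by move=> b /BU.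
apply: open_near => //; apply: (iffRL (rho_embedding G_closed _)).
by exists B.
Qed.

Lemma cvg_rho {T : Type} (F : set_system T) (u : T -> G) a : Filter F ->
  (fun t => rho (u t)) @ F --> rho a -> u @ F --> a.
Proof.
move=> FF H U; rewrite nbhsE => -[V [oV Va] VU].
have [B oB VE] := iffLR (rho_embedding G_closed V) oV.
apply: (@filterS _ F _ (u @^-1` V)); first by move=> t /VU.
have Ba : B (rho a) by move: Va; rewrite VE.
by rewrite VE; exact: (H B (@open_near _ B _ oB Ba)).
Qed.

Lemma action_continuous : continuous (fun z : G * M => rho z.1 z.2).
Proof. exact: smooth_map2_cont (rho_smooth G_closed). Qed.

Section isometric.
Variable g : chart R n M -> 'rV[R]_n -> 'M[R]_n.
Hypothesis rg : riemannian g.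
Hypothesis iso_rho : forall a, isom g (rho a).
Hypothesis M_connected : connected [set: M].

Local Notation dle := (dle g).

Lemma dle_rho a x y r : dle x y r -> dle (rho a x) (rho a y) r.
Proof. exact: dle_isom (Diff_smooth (rho a)) (iso_rho (a:=a)). Qed.

Lemma dle_rhoV a x y r : dle (rho a x) y r -> dle x (rho a^-1%g y) r.
Proof. by move/(dle_rho a^-1%g); rewrite rhoK. Qed.

Section ultrafilter.
Context (F : set_system G) {UF : UltraFilter F}.

(** Fix [a1] with [rho a1 e] close to the limit. Four steps of length [r] lead from [x] to the point
    that [rho a1] maps to [rho a x], so [rho a x] stays in the compact image of [K] under [rho a1],
    where the ultrafilter converges. *)
Lemma cvg_step (e y' x : M) (r : R) (K : set M) : 0 < r -> compact K ->
  (forall z, dle x z (r + r + r + r) -> K z) -> dle x e r ->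
  (fun a => rho a e) @ F --> y' -> exists y : M, (fun a => rho a x) @ F --> y.
Proof.
move=> r0 cK xK xe ey.
have S : \forall a \near F, dle y' (rho a e) r.
  exact: (iffLR (cvg_dle rg _ _ _) ey r r0).
have [a1 Sa1] := filter_ex S.
have cK1 : compact (rho a1 @` K).
  apply: continuous_compact => //; apply: continuous_subspaceT.
  exact: smooth_map_cont (Diff_smooth (rho a1)).
rewrite compact_ultra in cK1.
have UE : UltraFilter ((fun a => rho a x) @ F) by exact: fmap_ultra.
have FK : ((fun a => rho a x) @ F) (rho a1 @` K).
  apply: (@filterS _ F _ _ _ _ S) => a Sa /=.
  exists (rho a1^-1%g (rho a x)); last by rewrite rhoVK.
  apply: xK.
  have H1 : dle e (rho a1^-1%g y') r by apply: dle_rhoV; exact: dle_sym.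
  have H2 : dle (rho a1^-1%g y') (rho a1^-1%g (rho a e)) r by exact: dle_rho.
  have H3 : dle (rho a1^-1%g (rho a e)) (rho a1^-1%g (rho a x)) r.
    by do 2 apply: dle_rho; exact: dle_sym.
  exact: dle_trans (dle_trans (dle_trans xe H1) H2) H3.
by have [y [_ yE]] := cK1 _ UE FK; exists y.
Qed.

(** The points whose images converge form an open and closed set, because [cvg_step] applies from
    [x] to [e] and from [e] to [x] with a radius that depends only on [x]. *)
Lemma cvg_everywhere (x0 y0 : M) : (fun a => rho a x0) @ F --> y0 ->
  forall x, exists y : M, (fun a => rho a x) @ F --> y.
Proof.
move=> H0; pose E := [set x : M | exists y : M, (fun a => rho a x) @ F --> y].
have nE x : exists2 r, 0 < r & forall e, dle x e r -> (E x <-> E e).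
  have [s s0 [K cK sK]] := compact_ball rg x.
  (* Four steps come from [cvg_step], and a fifth when the ball has to be taken around [e] instead
     of [x]. *)
  pose r := s / 5; have r0 : 0 < r by rewrite divr_gt0.
  have le5 z t : t <= s -> dle x z t -> K z.
    by move=> ts xz; apply: sK => f lf; exact: le_trans (xz f lf) ts.
  exists r => // e xe; split=> -[y Hy].
    apply: (@cvg_step x y e r K) => //; last exact: dle_sym.
    move=> z ez; apply: (le5 z (r + (r + r + r + r))); last exact: dle_trans xe ez.
    by rewrite /r; lra.
  apply: (@cvg_step e y x r K) => // z xz; apply: (le5 z (r + r + r + r)) => //.
  by rewrite /r; lra.
have ET : E = [set: M].
  apply: M_connected; first by exists x0, y0.
  - exists E; last by rewrite setTI.
    apply: near_open => x Ex; have [r r0 rE] := nE x.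
    by apply: filterS (dle_near rg x r0) => e xe; apply/(rE e xe).
  - exists E; last by rewrite setTI.
    rewrite -(setCK E); apply: open_closedC; apply: near_open => x nEx.
    have [r r0 rE] := nE x.
    by apply: filterS (dle_near rg x r0) => e xe /(rE e xe).
by move=> x; have : [set: M] x by []; rewrite -ET.
Qed.

(** Isometries are equicontinuous, which upgrades pointwise convergence to continuous
    convergence. *)
Lemma limit_map (x0 y0 : M) : (fun a => rho a x0) @ F --> y0 ->
  exists f : M -> M, [/\ forall x, (fun a => rho a x) @ F --> f x,
    continuous f & forall x,
    (fun z : G * M => rho z.1 z.2) @ filter_prod F (nbhs x) --> f x].
Proof.
move=> /cvg_everywhere H; pose f x := sval (cid (H x)).
have fE x : (fun a => rho a x) @ F --> f x := svalP (cid (H x)).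
have fd x r : 0 < r -> \forall a \near F, dle (f x) (rho a x) r.
  by move=> r0; exact: (iffLR (cvg_dle rg _ _ _) (fE x) r r0).
exists f; split => // [x|x].
  apply: (iffRL (cvg_dle rg _ _ _)) => r r0.
  have r3 : 0 < r / 3 by rewrite divr_gt0.
  apply: filterS (dle_near rg x r3) => x' xx'.
  have [a [ax ax']] := filter_ex (filterI (fd x _ r3) (fd x' _ r3)).
  have := dle_trans (dle_trans ax (dle_rho a xx')) (dle_sym ax').
  by have -> : r / 3 + r / 3 + r / 3 = r by lra.
move=> U /(dle_nbhs rg)[r r0 rU]; have r2 : 0 < r / 2 by rewrite divr_gt0.
exists ([set a | dle (f x) (rho a x) (r / 2)], [set x' | dle x x' (r / 2)]) => /=.
  by split; [exact: fd|exact: dle_near].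
move=> [a x'] [/= ax xx']; apply: rU; rewrite (splitr r).
exact: dle_trans ax (dle_rho a xx').
Qed.

End ultrafilter.

(** An ultrafilter on the preimage of [K] has a convergent image. Replacing the moving point by its
    limit [x0] makes [limit_map] applicable to the group elements and, from [y0], to their inverses;
    the two limits are mutually inverse smooth maps, and closedness puts the limit in the group. *)
Lemma isometric_acts_properly : acts_properly rho.
Proof.
split.
  move=> z; apply: (@pair_continuous _ _ _ (fun p : G * M => rho p.1 p.2) snd).
    exact: action_continuous.
  exact: cvg_snd.
move=> K cK; rewrite compact_ultra => Phi UPhi PhiK.
have cK' := cK; rewrite compact_ultra in cK'.
have U1 : UltraFilter ((fun p : G * M => (rho p.1 p.2, p.2)) @ Phi) by exact: fmap_ultra.
have [[y0 x0] [K00 cv]] := cK' _ U1 PhiK.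
have cy : (fun p : G * M => rho p.1 p.2) @ Phi --> y0.
  move=> U Uy; apply: (cv [set z | U z.1]); exists (U, setT); last by case=> u v [].
  by split=> //; exact: filterT.
have cx : snd @ Phi --> x0.
  move=> U Ux; apply: (cv [set z | U z.2]); exists (setT, U); last by case=> u v [].
  by split=> //; exact: filterT.
pose F := (fst : G * M -> G) @ Phi.
have UF : UltraFilter F by exact: fmap_ultra.
have d0 r : 0 < r -> \forall a \near F, dle y0 (rho a x0) r.
  move=> r0; have r2 : 0 < r / 2 by rewrite divr_gt0.
  have N1 : \forall p \near Phi, dle y0 (rho p.1 p.2) (r / 2).
    exact: (iffLR (cvg_dle rg _ _ _) cy _ r2).
  have N2 : \forall p \near Phi, dle x0 p.2 (r / 2).
    exact: (iffLR (cvg_dle rg _ _ _) cx _ r2).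
  suff : Phi [set p | dle y0 (rho p.1 x0) r] by [].
  apply: (filterS _ (filterI N1 N2)) => -[a x] /= [h1 h2].
  by rewrite (splitr r); exact: dle_trans h1 (dle_rho a (dle_sym h2)).
have c0 : (fun a => rho a x0) @ F --> y0 by apply/(cvg_dle rg).
(* The image of [F] under inversion supplies the inverse of the limit map. *)
pose F' := (fun a : G => a^-1%g) @ F; have UF' : UltraFilter F' by exact: fmap_ultra.
have c0' : (fun a => rho a y0) @ F' --> x0.
  apply/(cvg_dle rg) => r r0; suff : F [set a | dle x0 (rho a^-1%g y0) r] by [].
  apply: (@filterS _ F _ _ _ _ (d0 r r0)) => a /= ax.
  by have := dle_rho a^-1%g (dle_sym ax); rewrite rhoK.
have [f [fE cf fcc]] := limit_map c0.
have [h [hE ch hcc]] := limit_map c0'.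
have fd x r : 0 < r -> \forall a \near F, dle (f x) (rho a x) r.
  by move=> r0; exact: (iffLR (cvg_dle rg _ _ _) (fE x) r r0).
have hd x r : 0 < r -> \forall a \near F, dle (h x) (rho a^-1%g x) r.
  by move=> r0; exact: (iffLR (cvg_dle rg _ _ _) (hE x) r r0).
have fhK : cancel h f.
  move=> y; apply/esym/(dle_sep rg) => r r0; have r2 : 0 < r / 2 by rewrite divr_gt0.
  have [a [fa ha]] := filter_ex (filterI (fd (h y) _ r2) (hd y _ r2)).
  have := dle_rho a ha; rewrite rhoVK => hy; rewrite (splitr r).
  exact: dle_trans (dle_sym hy) (dle_sym fa).
have hfK : cancel f h.
  move=> x; apply/esym/(dle_sep rg) => r r0; have r2 : 0 < r / 2 by rewrite divr_gt0.
  have [a [fa ha]] := filter_ex (filterI (fd x _ r2) (hd (f x) _ r2)).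
  have := dle_rho a^-1%g fa; rewrite rhoK => fx; rewrite (splitr r).
  exact: dle_trans (dle_sym fx) (dle_sym ha).
have sf : smooth_map f by exact: (limit_smooth rg iso_rho cf fcc).
have sh : smooth_map h by exact: (limit_smooth rg iso_rho ch hcc).
pose f' := MkDiff sf (ex_intro _ h (And3 sh hfK fhK)).
have cf' : rho @ F --> f' by apply: (limit_Diff rg iso_rho cf fcc).
have [a0 _ a0E] : range rho f'.
  apply: (@closed_cvg _ _ F _ rho (range rho) (rho_closed G_closed) _ f' cf').
  by apply: filterE => a; exists a.
have ca : (fst : G * M -> G) @ Phi --> a0.
  by apply: (cvg_rho (F := F) (u := id)); rewrite a0E.
exists (a0, x0); split; last first.
  move=> W [[P Q] [/= Pa Qx] PQ].
  have N1 : Phi [set p | P p.1] := ca _ Pa.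
  have N2 : Phi [set p | Q p.2] := cx _ Qx.
  apply: (@filterS _ Phi _ _ _ _ (filterI N1 N2)) => -[a x] [/= Pa' Qx'].
  exact: (PQ (a, x) (conj Pa' Qx')).
have fx0 : f x0 = y0.
  apply: (dle_sep rg) => r r0; have r2 : 0 < r / 2 by rewrite divr_gt0.
  have [a [fa ya]] := filter_ex (filterI (fd x0 _ r2) (d0 _ r2)).
  by rewrite (splitr r); exact: dle_trans fa (dle_sym ya).
by rewrite /= a0E /= fx0.
Qed.

End isometric.
End group_action.

(** * The metric of a pseudo-Hermitian structure *)

Lemma usm_mulmx {R : realType} {V : normedModType R} (U : set V) (a b c : nat)
    (X : V -> 'M[R]_(a, b)) (Y : V -> 'M[R]_(b, c)) : open U ->
  (forall i j, usm U (fun x => X x i j)) -> (forall i j, usm U (fun x => Y x i j)) ->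
  forall i j, usm U (fun x => (X x *m Y x) i j).
Proof.
move=> oU sX sY i j; apply: (@usm_ext _ _ _ (fun x => \sum_k X x i k * Y x k j)) => //.
  by move=> x _; rewrite mxE.
by apply: usm_sum => // k _; exact: usmM.
Qed.

Section contact_algebra.
Context {R : realType} {n : nat}.

(* Pointwise data of a pseudo-Hermitian structure: the contact form, the matrix
   of its exterior derivative and the endomorphism of its kernel. *)
Record contact_data (w : 'cV[R]_n) (B J : 'M[R]_n) : Prop := ContactData {
  cd_neq0 : w != 0 ;
  cd_alt : B^T = - B ;
  cd_ker : forall v : 'rV[R]_n, v *m w = 0 :> 'M[R]_1 -> v *m J *m w = 0 ;
  cd_sym : forall u v : 'rV[R]_n, u *m w = 0 :> 'M[R]_1 -> v *m w = 0 :> 'M[R]_1 ->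
    bform (J *m B) u v = bform (J *m B) v u ;
  cd_pos : forall u : 'rV[R]_n, u *m w = 0 :> 'M[R]_1 -> u != 0 ->
    0 < bform (J *m B) u u }.

Section one_point.
Variables (w : 'cV[R]_n) (B J : 'M[R]_n).

(** For contact data [B] is degenerate along the Reeb direction only, and adding [w w^T] makes it
    invertible. The Reeb vector, obtained by solving with this matrix, is then a smooth and natural
    function of [w] and [B]. *)
Definition contact_bilin := B + w *m w^T.
Definition reeb : 'rV[R]_n := w^T *m invmx contact_bilin.
(** Acting on row vectors, the projection onto the kernel of [w] along the Reeb vector. *)
Definition ker_proj : 'M[R]_n := 1%:M - w *m reeb.
Definition contact_metric : 'M[R]_n :=
  w *m w^T + ker_proj *m (J *m B) *m ker_proj^T.

Hypothesis cd : contact_data w B J.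
Let w_neq0 := cd_neq0 cd.
Let B_alt := cd_alt cd.
Let J_ker := cd_ker cd.
Let lev_sym := cd_sym cd.
Let lev_pos := cd_pos cd.

Local Notation inker v := (v *m w = 0 :> 'M[R]_1).
Local Notation lev u v := (bform (J *m B) u v).
Local Notation A := contact_bilin.
Local Notation xi := reeb.
Local Notation P := ker_proj.

Lemma alt_form (x : 'rV[R]_n) : x *m B *m x^T = 0.
Proof.
have E : (x *m B *m x^T)^T = - (x *m B *m x^T).
  by rewrite !trmx_mul trmxK B_alt mulNmx mulmxN mulmxA.
apply/matrixP => i j; rewrite !ord1 [RHS]mxE.
have := congr1 (fun X : 'M[R]_1 => X ord0 ord0) E; rewrite [LHS]mxE [RHS]mxE.
by move: ((x *m B *m x^T) ord0 ord0) => z; lra.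
Qed.

(** Testing with [v = x J] gives, up to sign, the Levi form of [x] with itself, which is positive
    unless [x = 0]. *)
Lemma ker_nondegenerate (x : 'rV[R]_n) : inker x ->
  (forall v : 'rV[R]_n, inker v -> x *m B *m v^T = 0) -> x = 0.
Proof.
move=> kx H; apply/eqP; apply: contraT => x0; have := lev_pos kx x0.
have := congr1 trmx (H _ (J_ker kx)).
rewrite !trmx_mul !trmxK B_alt trmx0 mulNmx mulmxN !mulmxA => /eqP.
by rewrite oppr_eq0 => /eqP E; rewrite /bform !mulmxA E mxE ltxx.
Qed.

Lemma trmx11 (z : 'M[R]_1) : z^T = z.
Proof. by apply/matrixP => i j; rewrite !ord1 mxE. Qed.

Lemma scalar_square_eq0 (z : 'M[R]_1) : z *m z = 0 -> z = 0.
Proof.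
move=> /matrixP /(_ ord0 ord0); rewrite !mxE big_ord1 => /eqP.
by rewrite mulf_eq0 orbb => /eqP z0; apply/matrixP => i j; rewrite !ord1 z0 mxE.
Qed.

(** If [x A = 0], pairing with [x] kills the alternating term and leaves [(x w)^2 = 0]; then [x]
    lies in the kernel of [w], [x B] vanishes there, and [ker_nondegenerate] applies. *)
Lemma contact_unit : A \in unitmx.
Proof.
rewrite -row_free_unit -kermx_eq0; apply/eqP/row_matrixP => i; rewrite row0.
set x := row i _; have xA : x *m A = 0 by rewrite /x -row_mul mulmx_ker row0.
have kx : inker x.
  apply: scalar_square_eq0; have := congr1 (fun y => y *m x^T) xA.
  rewrite mulmxDr mulmxDl alt_form add0r mul0mx !mulmxA => E.
  by rewrite -mulmxA -{2}(trmx11 (x *m w)) trmx_mul mulmxA.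
apply: (ker_nondegenerate kx) => v _.
have := congr1 (fun y => y *m v^T) xA.
by rewrite mulmxDr mulmxDl (mulmxA x w) kx !mul0mx addr0.
Qed.

Lemma reebA : xi *m A = w^T.
Proof. by rewrite /reeb mulmxKV// contact_unit. Qed.

(** Pairing [xi A = w^T] with [xi] shows that [z = xi w] satisfies [z^2 = z]; and [z = 0] would put
    [xi] in the kernel, hence [xi = 0] and [w = 0]. *)
Lemma reeb_w : xi *m w = 1%:M.
Proof.
have E : xi *m w *m (xi *m w) = xi *m w.
  have := congr1 (fun y => y *m xi^T) reebA.
  rewrite mulmxDr mulmxDl alt_form add0r (mulmxA xi w) -mulmxA.
  by rewrite -trmx_mul trmx11.
have [k0|k0] := eqVneq (xi *m w) 0.
  have x0 : xi = 0.
    apply: (ker_nondegenerate k0) => v kv.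
    have := congr1 (fun y => y *m v^T) reebA.
    rewrite mulmxDr mulmxDl (mulmxA xi w) k0 !mul0mx addr0 => ->.
    by rewrite -trmx_mul kv trmx0.
  move: w_neq0; rewrite -(trmxK w) -reebA x0 mul0mx trmx0 eqxx; by [].
have [z zE] : exists z, xi *m w = z%:M.
  exists ((xi *m w) ord0 ord0); apply/matrixP => i j.
  by rewrite !ord1 [RHS]mxE eqxx mulr1n.
rewrite zE in E k0 *; rewrite -scalar_mxM in E.
have z0 : z != 0 by apply: contraNneq k0 => ->; apply/eqP/matrixP => i j; rewrite !mxE mul0rn.
have := congr1 (fun X : 'M[R]_1 => X ord0 ord0) E; rewrite /= !mxE eqxx !mulr1n.
by move/(canRL (mulfK z0)); rewrite mulfV// => ->.
Qed.

Lemma proj_ker (v : 'rV[R]_n) : inker (v *m P).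
Proof.
rewrite -mulmxA mulmxBl mul1mx -mulmxA reeb_w mulmx1 subrr mulmx0.
by [].
Qed.

Lemma proj_id (v : 'rV[R]_n) : inker v -> v *m P = v.
Proof. by move=> kv; rewrite mulmxBr mulmx1 mulmxA kv mul0mx subr0. Qed.

Lemma reebB : xi *m B = 0.
Proof.
have := reebA; rewrite mulmxDr mulmxA reeb_w mul1mx.
by move=> /(canRL (addrK _)) ->; rewrite subrr.
Qed.

Lemma lev_proj u v : bform (P *m (J *m B) *m P^T) u v = lev (u *m P) (v *m P).
Proof. by rewrite /bform trmx_mul !mulmxA. Qed.

Lemma lev_ge0 (u : 'rV[R]_n) : inker u -> 0 <= lev u u.
Proof.
move=> ku; have [->|/(lev_pos ku)/ltW//] := eqVneq u 0.
by rewrite /bform !mul0mx mxE.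
Qed.

Lemma contact_metricE u v : bform contact_metric u v =
  (u *m w) ord0 ord0 * (v *m w) ord0 ord0 + lev (u *m P) (v *m P).
Proof.
rewrite -lev_proj /bform mulmxDr mulmxDl mxE; congr (_ + _).
by rewrite mulmxA -mulmxA -trmx_mul mxE big_ord1 [_^T _ _]mxE.
Qed.

Lemma bform_eq (X Y : 'M[R]_n) : (forall u v, bform X u v = bform Y u v) -> X = Y.
Proof.
move=> H; apply/matrixP => i j; have := H (delta_mx ord0 i) (delta_mx ord0 j).
by rewrite /bform -!rowE trmx_delta -!colE !mxE.
Qed.

Lemma bform_trmx (X : 'M[R]_n) u v : bform X^T u v = bform X v u.
Proof.
by rewrite /bform -[in LHS](trmx11 (u *m X^T *m v^T)) !trmx_mul !trmxK mulmxA.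
Qed.

Lemma contact_posdef : posdef contact_metric.
Proof.
split.
  apply: bform_eq => u v; rewrite bform_trmx !contact_metricE mulrC.
  by rewrite lev_sym//; exact: proj_ker.
move=> v v0; rewrite contact_metricE -expr2.
have [kv|kv] := eqVneq (v *m w) 0.
  by rewrite kv mxE expr0n add0r proj_id// lev_pos.
apply: ltr_pwDl; last by apply: lev_ge0; exact: proj_ker.
rewrite lt_def sqr_ge0 andbT sqrf_eq0; apply: contra kv => /eqP E.
by apply/eqP/matrixP => i j; rewrite !ord1 E mxE.
Qed.

End one_point.

(** The factor [s] is a sign. It drops out of [w w^T], and out of the projection because the form
    and the Reeb vector both change by [s]; only the Levi term could keep it. *)
Lemma contact_metric_pull (w w2 : 'cV[R]_n) (B B2 J J2 D : 'M[R]_n) (s : R) :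
  contact_data w B J -> contact_data w2 B2 J2 -> s ^+ 2 = 1 ->
  D *m w2 = s *: w -> D *m B2 *m D^T = s *: B ->
  (forall v : 'rV[R]_n, v *m w = 0 :> 'M[R]_1 -> v *m J *m D = v *m D *m J2) ->
  D *m contact_metric w2 B2 J2 *m D^T = contact_metric w B J.
Proof.
move=> cd cd2 s1 Dw DB DJ.
have ss : s * s = 1 by rewrite -expr2.
have wD : w2^T *m D^T = s *: w^T by rewrite -trmx_mul Dw linearZ.
have Aunit := contact_unit cd.
have DA : D *m contact_bilin w2 B2 *m D^T = s *: B + w *m w^T.
  rewrite mulmxDr mulmxDl DB !mulmxA Dw -mulmxA wD -scalemxAl -scalemxAr scalerA.
  by rewrite ss scale1r.
have Dunit : D \in unitmx.
  have : D *m (contact_bilin w2 B2 *m D^T) \in unitmx.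
    rewrite mulmxA DA.
    have [->|->] : s = 1 \/ s = -1.
    - move/eqP: s1; rewrite -subr_eq0 -[X in _ - X](expr1n _ 2) subr_sqr mulf_eq0.
      by rewrite subr_eq0 addr_eq0 => /orP[]/eqP; [left|right].
    - by rewrite scale1r.
    rewrite scaleN1r -(cd_alt cd) -[w *m w^T]trmxK trmx_mul trmxK -linearD/=.
    by rewrite unitmx_tr.
  by rewrite unitmx_mul => /andP[].
have xiD : s *: (reeb w B *m D) = reeb w2 B2.
  have E : s *: (reeb w B *m D) *m contact_bilin w2 B2 = w2^T.
    apply: (can_inj (mulmxK (_ : D^T \in unitmx))); first by rewrite unitmx_tr.
    have X : reeb w B *m (s *: B + w *m w^T) = w^T.
      rewrite mulmxDr -scalemxAr (reebB cd) scaler0 add0r mulmxA (reeb_w cd).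
      by rewrite mul1mx.
    move: (reeb w B) (contact_bilin w2 B2) DA X => r A2 DA X.
    by rewrite -!scalemxAl -!mulmxA [D *m (_ *m _)]mulmxA DA X wD.
  by rewrite [RHS]/reeb -E mulmxK// (contact_unit cd2).
have PD : ker_proj w B *m D = D *m ker_proj w2 B2.
  have -> : D *m ker_proj w2 B2 = D - D *m w2 *m reeb w2 B2.
    by rewrite mulmxBr mulmx1 (mulmxA D).
  have -> : ker_proj w B *m D = D - w *m (reeb w B *m D).
    by rewrite mulmxBl mul1mx -(mulmxA w).
  rewrite Dw -xiD; move: (reeb w B *m D) => r.
  by rewrite -scalemxAl -scalemxAr scalerA ss scale1r.
have PJD : ker_proj w B *m J *m D = ker_proj w B *m D *m J2.
  apply/row_matrixP => i; rewrite !row_mul.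
  by apply: DJ; rewrite rowE; exact: proj_ker cd _.
have E3 : D *m (ker_proj w2 B2 *m (J2 *m B2) *m (ker_proj w2 B2)^T) *m D^T =
    s *: (ker_proj w B *m (J *m B) *m (ker_proj w B)^T).
  move: (ker_proj w B) (ker_proj w2 B2) PD PJD => P P2 PD PJD.
  have -> : D *m (P2 *m (J2 *m B2) *m P2^T) *m D^T = (D *m P2) *m J2 *m B2 *m (D *m P2)^T.
    by rewrite trmx_mul !mulmxA.
  rewrite -PD -PJD (trmx_mul P D).
  have -> : P *m J *m D *m B2 *m (D^T *m P^T) = P *m J *m (D *m B2 *m D^T) *m P^T.
    by rewrite !mulmxA.
  by rewrite DB -scalemxAr -scalemxAl !mulmxA.
have E : D *m contact_metric w2 B2 J2 *m D^T = w *m w^T +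
    s *: (ker_proj w B *m (J *m B) *m (ker_proj w B)^T).
  rewrite mulmxDr mulmxDl E3 (mulmxA D w2) Dw -[_ *m w2^T *m D^T]mulmxA wD.
  by rewrite -scalemxAl -scalemxAr scalerA ss scale1r.
rewrite E /contact_metric; congr (_ + _).
set Q := _ *m _ *m _^T.
have [s_1|s_N1] : s = 1 \/ s = -1.
- move/eqP: s1; rewrite -subr_eq0 -[X in _ - X](expr1n _ 2) subr_sqr mulf_eq0.
  by rewrite subr_eq0 addr_eq0 => /orP[]/eqP; [left|right].
- by rewrite s_1 scale1r.
(* a negative factor is excluded by the positivity of both Levi forms, unless
   the kernel vanishes *)
have P0 : ker_proj w B = 0.
  apply/row_matrixP => i; rewrite row0; apply/eqP; apply: contraT => Pi0.
  pose x : 'rV[R]_n := row i 1%:M; have xP : x *m ker_proj w B = row i (ker_proj w B).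
    by rewrite /x -row_mul mul1mx.
  have L1 : 0 < bform Q x x.
    rewrite /Q (lev_proj _ _ _ x x) xP; apply: (cd_pos cd _ Pi0).
    by rewrite -xP; exact: proj_ker cd _.
  have L2 : 0 <= bform (D *m (ker_proj w2 B2 *m (J2 *m B2) *m (ker_proj w2 B2)^T) *m D^T) x x.
    rewrite -bform_pull lev_proj; apply: (lev_ge0 cd2); exact: proj_ker cd2 _.
  move: L2; rewrite E3 s_N1 scaleN1r /bform mulmxN mulNmx mxE oppr_ge0.
  by rewrite leNgt; move: L1; rewrite /bform => ->.
by rewrite /Q P0 !mul0mx scaler0.
Qed.

End contact_algebra.

(** * Multiplicative cocycles *)

Section linear_substitution.
Context {R : realType} {V V' : normedModType R} (L : V -> V') (cL : continuous L)
  (linL : forall (h : R) u v, L (h *: u + v) = h *: L u + L v).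

Lemma usm_linear (U : set V') (f : V' -> R) : open U -> usm U f ->
  usm [set x | U (L x)] (f \o L).
Proof.
move=> oU sf.
have oU' : open [set z : bool * V | U (L z.2)].
  apply: open_snd (_ : open [set x | U (L x)]); apply: open_comp => // x _; exact: cL.
move=> k; elim: k f sf => [|k IH] f sf.
  split=> // -[t x] Ux; have cf := usm_cont sf Ux.
  apply: (@cvg_prod_snd _ _ _ _ (f \o L)); apply: continuous_comp; [exact: cL|exact: cf].
apply: pCkS_intro => //.
  move=> -[t x] Ux; have cf := usm_cont sf Ux.
  apply: (@cvg_prod_snd _ _ _ _ (f \o L)); apply: continuous_comp; [exact: cL|exact: cf].
move=> v; exists (fun _ => 'D_(L v) f \o L); last by apply: IH; exact: usm_D.
move=> [t x] /= Ux; apply/dderivP; rewrite /dderiv.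
have /dderivP := usm_der (L v) sf Ux; rewrite /dderiv.
by under eq_fun do rewrite -linL.
Qed.

End linear_substitution.

(** [usm_comp] composes with functions of one row vector; the pair is encoded as a row vector of
    length [m + n] and decoded by the linear map [L]. *)
Lemma usm_comp2 {R : realType} {V : normedModType R} m n
    (W : set ('rV[R]_m * 'rV[R]_n)) (U : set V) (g : 'rV[R]_m * 'rV[R]_n -> R)
    (f1 : V -> 'rV[R]_m) (f2 : V -> 'rV[R]_n) : open W -> open U -> usm W g ->
  (forall j, usm U (fun x => f1 x ord0 j)) -> (forall j, usm U (fun x => f2 x ord0 j)) ->
  (forall x, U x -> W (f1 x, f2 x)) -> usm U (fun x => g (f1 x, f2 x)).
Proof.
move=> oW oU sg s1 s2 UW.
pose L (r : 'rV[R]_(m + n)) : 'rV[R]_m * 'rV[R]_n := (lsubmx r, rsubmx r).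
have cL : continuous L.
  move=> r; apply: pair_continuous.
    apply: (@cvg_row _ _ _ (nbhs r) _ (lsubmx r) (nbhs_filter r)) => j.
    rewrite (_ : (fun x : 'rV[R]_(m + n) => _) = fun x => x ord0 (lshift n j)).
      by rewrite mxE; exact: coord_continuous.
    by apply/funext => x; rewrite mxE.
  apply: (@cvg_row _ _ _ (nbhs r) _ (rsubmx r) (nbhs_filter r)) => j.
  rewrite (_ : (fun x : 'rV[R]_(m + n) => _) = fun x => x ord0 (rshift m j)).
    by rewrite mxE; exact: coord_continuous.
  by apply/funext => x; rewrite mxE.
have lL (h : R) u v : L (h *: u + v) = h *: L u + L v.
  by rewrite /L !linearD !linearZ.
have LK x : L (row_mx (f1 x) (f2 x)) = (f1 x, f2 x) by rewrite /L row_mxKl row_mxKr.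
have sgL := usm_linear cL lL oW sg.
apply: (@usm_ext _ _ _ ((g \o L) \o fun x => row_mx (f1 x) (f2 x))) => //.
  by move=> x _; rewrite /= LK.
apply: (@usm_comp _ _ _ _ _ _ (fun x => row_mx (f1 x) (f2 x)) _ oU sgL).
- by apply: open_comp => // r _; exact: cL.
- move=> j; case: (split_ordP j) => k ->.
    apply: (usm_ext oU _ (s1 k)) => x _; by rewrite row_mxEl.
  apply: (usm_ext oU _ (s2 k)) => x _; by rewrite row_mxEr.
- by move=> x Ux /=; rewrite LK; exact: UW.
Qed.

Lemma usm_fst {R : realType} {V1 V2 : normedModType R} (U : set V1) (f : V1 -> R) :
  open U -> usm U f -> usm [set z : V1 * V2 | U z.1] (fun z => f z.1).
Proof.
move=> oU; apply: (@usm_linear _ _ _ (@fst V1 V2)) => // z; exact: cvg_fst.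
Qed.

Lemma usm_snd {R : realType} {V1 V2 : normedModType R} (U : set V2) (f : V2 -> R) :
  open U -> usm U f -> usm [set z : V1 * V2 | U z.2] (fun z => f z.2).
Proof.
move=> oU; apply: (@usm_linear _ _ _ (@snd V1 V2)) => // z; exact: cvg_snd.
Qed.

Lemma near_and {T : topologicalType} (x : T) (P Q S : set T) :
  (\forall y \near x, P y) -> (\forall y \near x, Q y) ->
  (forall y, P y -> Q y -> S y) -> \forall y \near x, S y.
Proof. by move=> nP nQ H; apply: filterS (nearI nP nQ) => y [? ?]; exact: H. Qed.

Section smooth_action.
Context {R : realType} {n m : nat} {M : manifoldType R n} {G : lieGroupType R m}.
Context {rho : G -> Diff M} (G_closed : closed_lie_subgroup rho).

Lemma invg_continuous : continuous (fun a : G => a^-1%g).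
Proof. exact: smooth_map_cont (@smooth_invg R m G). Qed.

Lemma open_preimage {S T : topologicalType} (f : S -> T) (A : set T) :
  continuous f -> open A -> open [set x | A (f x)].
Proof. by move=> cf oA; apply: open_comp => // x _; exact: cf. Qed.

Variables (c1 : chart R m G) (c d : chart R n M).
Hypotheses (Gc1 : atlas G c1) (Mc : atlas M c) (Md : atlas M d).

(** The inverse is built in because the coefficient module uses [f (a^-1 x)], and the cocycles below
    are formed accordingly. *)
Definition act_dom : set ('rV[R]_m * 'rV[R]_n) :=
  [set z | crange c1 z.1 /\ ldom (rho (cinv c1 z.1)^-1%g) c d z.2].

Lemma open_act_dom : open act_dom.
Proof.
apply: near_open => -[q p] [/= c1q [cp dp]].
have := open_near (cdom_open d) dp.
have ca : {for (q, p), continuous (fun z : 'rV[R]_m * 'rV[R]_n =>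
    rho (cinv c1 z.1)^-1%g (cinv c z.2))}.
  have cc : {for (q, p), continuous (fun z : 'rV[R]_m * 'rV[R]_n =>
      ((cinv c1 z.1)^-1%g, cinv c z.2))}.
    apply: pair_continuous.
      apply: (@continuous_comp _ _ _ (@fst 'rV[R]_m 'rV[R]_n) (fun q => (cinv c1 q)^-1%g)).
        exact: cvg_fst.
      apply: (@continuous_comp _ _ _ (cinv c1)); first exact: cinv_cts.
      exact: invg_continuous.
    apply: (@continuous_comp _ _ _ (@snd 'rV[R]_m 'rV[R]_n) (cinv c)); first exact: cvg_snd.
    exact: cinv_cts.
  apply: (@continuous_comp _ _ _ (fun z : 'rV[R]_m * 'rV[R]_n =>
      ((cinv c1 z.1)^-1%g, cinv c z.2)) (fun z : G * M => rho z.1 z.2)) => //.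
  exact: action_continuous G_closed _.
move=> /ca nd.
have n1 : \forall z \near (q, p), crange c1 z.1 /\ crange c z.2.
  apply: (@near_pair _ _ (q, p) (crange c1) (crange c)); [exact: near_crange|exact: near_crange|by []].
by apply: near_and nd n1 _ => -[q' p'] /= ? [? ?].
Qed.

(** Inversion and the action are smooth separately, each in charts; an auxiliary chart [e] of [G]
    around the inverse factors the map as their composite. *)
Lemma act_local_usm j :
  usm act_dom (fun z => local (rho (cinv c1 z.1)^-1%g) c d z.2 ord0 j).
Proof.
apply: usm_local => -[q0 p0] [/= c1q [cp dp]].
have [e Ge eq0] := chart_at (cinv c1 q0)^-1%g.
pose I1 : set 'rV[R]_m := [set q | crange c1 q /\ cdom e (cinv c1 q)^-1%g].
have oI1 : open I1.
  exact: (open_chart_set1 c1 (open_preimage invg_continuous (cdom_open e))).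
have sI j' : usm I1 (fun q => e (cinv c1 q)^-1%g ord0 j').
  have [_ H] := @smooth_invg R m G c1 Gc1.
  have oI : open (crange c1 `&` (fun q => (cinv c1 q)^-1%g) @^-1` cdom e) by exact: oI1.
  by have /(smooth_on_mxP _ oI) := H e Ge; apply.
pose W : set ('rV[R]_m * 'rV[R]_n) := (crange e `*` crange c) `&`
  [set z | cdom d (rho (cinv e z.1) (cinv c z.2))].
have oW : open W.
  apply: near_open => -[q p] [[/= eq cp'] dp'].
  have ca : {for (q, p), continuous (fun z : 'rV[R]_m * 'rV[R]_n =>
      rho (cinv e z.1) (cinv c z.2))}.
    have [H _] := rho_smooth G_closed Ge Mc; exact: H.
  have nd := ca _ (open_near (cdom_open d) dp').
  have n1 : \forall z \near (q, p), crange e z.1 /\ crange c z.2.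
    apply: (@near_pair _ _ (q, p) (crange e) (crange c)); [exact: near_crange|exact: near_crange|by []].
  by apply: near_and nd n1 _ => -[q' p'] /= ? [? ?].
have sW : usm W (fun z => d (rho (cinv e z.1) (cinv c z.2)) ord0 j).
  have [_ H] := rho_smooth G_closed Ge Mc.
  by have /(smooth_on_mxP _ oW) := H d Md; apply.
pose U := act_dom `&` [set z | I1 z.1].
have oU1 : open [set z : 'rV[R]_m * 'rV[R]_n | I1 z.1].
  by apply: open_preimage oI1 => z; exact: cvg_fst.
have oU : open U by apply: openI oU1; exact: open_act_dom.
exists U; first by [].
apply: (@usm_ext _ _ _ (fun z => d (rho (cinv e (e (cinv c1 z.1)^-1%g)) (cinv c z.2)) ord0 j)) => //.
  by move=> z [_ [_ ez]]; rewrite cmapK.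
have f1 j' : usm U (fun z => e (cinv c1 z.1)^-1%g ord0 j').
  by apply: usm_sub (usm_fst oI1 (sI j')); move=> z [].
have f2 j' : usm U (fun z => z.2 ord0 j').
  apply: usm_sub (usm_snd (crange_open' c) (usm_coord j' (crange_open' c))).
  by move=> z [[_ []]].
refine (@usm_comp2 R _ m n W U (fun z => d (rho (cinv e z.1) (cinv c z.2)) ord0 j)
  (fun z => e (cinv c1 z.1)^-1%g) snd oW oU sW f1 f2 _).
move=> z [[/= ? [? dz]] [? ez]]; split; first by split=> //; exact: crange_cmap.
by rewrite /= cmapK.
Qed.

Lemma act_jacobian_usm i j :
  usm act_dom (fun z => jacobian (local (rho (cinv c1 z.1)^-1%g) c d) z.2 i j).
Proof.
apply: (usm_ext open_act_dom _ (usm_D (0, ebase i) (act_local_usm j))) => -[q p] Hz.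
rewrite (jacobian_entry (Diff_smooth _) Mc Md) /=; last by case: Hz.
have D := is_derive_pair2 (usm_der (0, ebase i) (act_local_usm j) Hz).
by rewrite -(@derive_val _ _ _ _ _ _ _ D).
Qed.

End smooth_action.

Section jacobian_composition.
Context {R : realType} {n : nat} {M : manifoldType R n}.

Lemma jacobian_comp (f1 f2 f : M -> M) (c d e : chart R n M) p :
  smooth_map f1 -> smooth_map f2 -> smooth_map f -> (forall x, f x = f2 (f1 x)) ->
  atlas M c -> atlas M d -> atlas M e -> ldom f1 c d p -> cdom e (f (cinv c p)) ->
  ldom f2 d e (local f1 c d p) /\
  jacobian (local f c e) p =
    jacobian (local f1 c d) p *m jacobian (local f2 d e) (local f1 c d p).
Proof.
move=> s1 s2 s3 fE Mc Md Me L1 ep; have [cp dp] := L1.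
have L2 : ldom f2 d e (local f1 c d p).
  by split; [exact: crange_cmap|rewrite /local /= cmapK// -fE].
split; first exact: L2.
have L3 : ldom f c e p by split.
apply/matrixP => i j; rewrite (jacobian_entry s3 Mc Me i j L3) [RHS]mxE.
have dh := local_coord_differentiable s2 Md Me j L2.
have D := @chain_rule R n _ (fun q => local f2 d e q ord0 j) (local f1 c d) p (ebase i) dh
  (fun j => @diff_derivable _ _ _ _ _ _ (local_coord_differentiable s1 Mc Md j L1)).
have E : \forall q \near p, ((fun q => local f2 d e q ord0 j) \o local f1 c d) q
    = local f c e q ord0 j.
  have oL := open_ldom c d (smooth_map_cont s1).
  apply: filterS (open_near oL L1) => q [cq dq]; by rewrite /= /local/= cmapK// fE.
have D2 := near_eq_is_derive E D.
refine (etrans (@derive_val _ _ _ _ _ _ _ D2) _).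
refine (eq_bigr _ (fun k _ => _)).
exact: (congr2 *%R (esym (jacobian_entry s1 Mc Md i k L1))
  (esym (jacobian_entry s2 Md Me k j L2))).
Qed.

End jacobian_composition.

Section cocycles.
Context {R : realType} {n m : nat} {M : manifoldType R n} {G : lieGroupType R m}.
Context {rho : G -> Diff M} (G_closed : closed_lie_subgroup rho).

Lemma act_comp_usm c1 c d (F : 'rV[R]_n -> R) : atlas G c1 -> atlas M c -> atlas M d ->
  usm (crange d) F ->
  usm (act_dom (rho:=rho) c1 c d) (fun z => F (local (rho (cinv c1 z.1)^-1%g) c d z.2)).
Proof.
move=> Gc1 Mc Md sF.
refine (@usm_comp R _ n (crange d) (act_dom (rho:=rho) c1 c d) F
  (fun z => local (rho (cinv c1 z.1)^-1%g) c d z.2) (crange_open' d) _ sF _ _).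
- exact: open_act_dom.
- by move=> j; exact: act_local_usm.
- by move=> z [_ [_ dz]]; exact: crange_cmap.
Qed.

Lemma act_dom_cover c1 c (F : 'rV[R]_m * 'rV[R]_n -> R) :
  (forall d, atlas M d -> usm (act_dom (rho:=rho) c1 c d) F) ->
  usm (crange c1 `*` crange c) F.
Proof.
move=> H; apply: usm_local => -[q p] [/= c1q cp].
have [d Md dp] := chart_at (rho (cinv c1 q)^-1%g (cinv c p)).
by exists (act_dom (rho:=rho) c1 c d); [|exact: H].
Qed.

(** The logarithm of [h] at [a^-1] is an additive 1-cocycle for the action by [f (a^-1 x)]:
    inversion reverses products and turns the multiplicative law into the vanishing of
    [coboundary]. *)
Lemma cocycle_trivial (h : G -> M -> R) :
  (forall a x, 0 < h a x) ->
  (forall a b x, h (a * b)%g x = h a (rho b x) * h b x) ->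
  (forall c1 c, atlas G c1 -> atlas M c -> usm (crange c1 `*` crange c)
     (fun z => h (cinv c1 z.1)^-1%g (cinv c z.2))) ->
  Hd_vanishes rho 1 ->
  exists2 k : M -> R, smooth_fun k & forall a x, ln (h a x) = k (rho a x) - k x.
Proof.
move=> h0 hM sh H1.
have slnh c1 c : atlas G c1 -> atlas M c -> usm (crange c1 `*` crange c)
    (fun z => ln (h (cinv c1 z.1)^-1%g (cinv c z.2))).
  by move=> Gc1 Mc; apply: usm_ln; [apply: openX; exact: crange_open'| |exact: sh].
have sm (a : 'I_1 -> G) : (fun x => ln (h (a ord0)^-1%g x)) \in @smooth_pred R n M.
  apply/asboolP; have [c1 Gc1 c1a] := chart_at (a ord0).
  have J : jointly_smooth (crange c1) (fun q x => ln (h (cinv c1 q)^-1%g x)).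
    by move=> c Mc; exact: slnh.
  by have := jointly_smooth_slice (crange_open' c1) J (crange_cmap c1a); rewrite cmapK.
pose l : cochain (G:=G) (M:=M) 1 := fun a => MkCinf (sm a).
have sl : smooth_cochain l.
  move=> c Gc; have E : [set p : 'M[R]_(1, m) | forall i, crange (c i) (row i p)] =
      crange (c ord0).
    apply/seteqP; split=> p /=; first by move/(_ ord0); rewrite row_id.
    by move=> ? i; rewrite (ord1 i) row_id.
  rewrite E; apply: jointly_smooth_on; first exact: crange_open'.
  move=> d Md; apply: usm_ext (slnh _ _ (Gc ord0) Md).
    by apply: openX; exact: crange_open'.
  by move=> z _; rewrite /= row_id.
have [|k sk kE] := H1 l sl.
  move=> a x; rewrite /coboundary /Defs.act big_ord1 /= !expr1 sqrrN expr1n mul1r mulN1r.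
  rewrite /merge_at /= /widen_ord.
  rewrite (_ : lift ord0 ord0 = ord_max :> 'I_2); last exact: val_inj.
  rewrite (_ : Ordinal _ = ord0 :> 'I_2); last exact: val_inj.
  rewrite invMg hM lnM ?posrE//. lra.
(* A 0-cochain has a single value, since any two functions on the empty index set are equal. *)
exists (k (fun=> 1%g)); first exact: Cinf_smooth.
move=> a x; have := kE (fun=> a^-1%g) x; rewrite /coboundary /Defs.act big_ord0 /= expr1.
rewrite !invgK => ->; rewrite addr0 mulN1r.
by congr (k _ _ - k _ _); apply/funext => -[].
Qed.

End cocycles.

Lemma congr_scale {R : comPzRingType} {n : nat} (J1 J2 X Y Z : 'M[R]_n) (a b : R) :
  J2 *m X *m J2^T = a *: Y -> J1 *m Y *m J1^T = b *: Z ->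
  (J1 *m J2) *m X *m (J1 *m J2)^T = (a * b) *: Z.
Proof.
move=> H2 H1; rewrite trmx_mul !mulmxA -(mulmxA J1) -(mulmxA J1) H2.
by rewrite -scalemxAr -scalemxAl H1 scalerA.
Qed.

Section conformal.
Context {R : realType} {n m : nat} {M : manifoldType R n} {G : lieGroupType R m}.
Context {rho : G -> Diff M} (G_closed : closed_lie_subgroup rho).
Context (g : chart R n M -> 'rV[R]_n -> 'M[R]_n) (rg : riemannian g).

Lemma riemannian_scale (k : M -> R) : smooth_fun k ->
  riemannian (fun c p => expR (k (cinv c p)) *: g c p).
Proof.
move=> sk; have [_ tg pg] := rg; split.
- move=> c Mc; have oc := crange_open' c.
  apply: (iffRL (smooth_on_mxP _ oc)) => i j.
  apply: (usm_ext oc _ (usmM oc (usm_exp oc (smooth_fun_usm sk Mc)) (metric_usm rg i j Mc))).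
  by move=> p _; rewrite mxE.
- move=> c d p mp; rewrite (tg c d p mp) /pull_bilin.
  rewrite -scalemxAr -scalemxAl; have [Mc Md cp dp] := mp.
  by rewrite [cinv d _]cmapK.
- move=> c p Mc cp; have [gT gpos] := pg c p Mc cp; split; first by rewrite linearZ /= gT.
  move=> v /gpos v0; rewrite -scalemxAr -scalemxAl mxE mulr_gt0//; exact: expR_gt0.
Qed.

Lemma conformal_acts_properly : connected [set: M] ->
  (forall a, preserves_conformal g (rho a)) -> Hd_vanishes rho 1 -> acts_properly rho.
Proof.
(* In dimension 0 there is no matrix entry from which to read the conformal factor, but then every
   map is an isometry. *)
move=> cM pc H1; have [n0|n_gt0] := posnP n.
  apply: (isometric_acts_properly G_closed rg) cM => a c d p _.
  by apply/matrixP => i; have := ltn_ord i; rewrite [X in (_ < X)%N]n0.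
pose i0 := Ordinal n_gt0.
pose h a := projT1 (cid (pc a)).
have hP a : [/\ smooth_fun (h a), forall x, 0 < h a x &
    forall c d p, Defs.meets (rho a) c d p ->
      pull_bilin (rho a) g c d p = h a (cinv c p) *: g c p].
  by rewrite /h; case: cid.
have gpos c p : atlas M c -> crange c p -> g c p i0 i0 != 0.
  move=> Mc cp; have [_ /(_ (ebase i0))] := metric_posdef rg Mc cp.
  rewrite /bform trmx_delta -rowE -colE !mxE => H; apply/lt0r_neq0/H.
  by apply/eqP => /matrixP /(_ ord0 i0) /eqP; rewrite !mxE !eqxx oner_eq0.
have hM a b x : h (a * b)%g x = h a (rho b x) * h b x.
  have [c Mc cx] := chart_at x; have [d Md dx] := chart_at (rho b x).
  have [e Me ex] := chart_at (rho a (rho b x)).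
  have cp := crange_cmap cx; set p := c x in cp *.
  have px : cinv c p = x by exact: cmapK.
  have L1 : ldom (rho b) c d p by split; rewrite ?px.
  have L3 : ldom (rho (a * b)%g) c e p by split; rewrite ?px ?rho_mul.
  have [L2 JE] := jacobian_comp (Diff_smooth (rho b)) (Diff_smooth (rho a))
    (Diff_smooth (rho (a * b)%g)) (rho_mul G_closed a b) Mc Md Me L1 (proj2 L3).
  have [_ _ /(_ c e p) H3] := hP (a * b)%g.
  have [_ _ /(_ c d p) Hb] := hP b.
  have [_ _ /(_ d e (local (rho b) c d p)) Ha] := hP a.
  have {}H3 := H3 ltac:(split=> //; exact: L3.2).
  have {}Hb := Hb ltac:(split=> //; exact: L1.2).
  have {}Ha := Ha ltac:(split=> //; [exact: L2.1|exact: L2.2]).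
  have lE : local (rho a) d e (local (rho b) c d p) = local (rho (a * b)%g) c e p.
    by rewrite /local /= px cmapK// rho_mul.
  have dE : cinv d (local (rho b) c d p) = rho b x by rewrite /local /= px cmapK.
  rewrite dE in Ha; rewrite px in Hb H3.
  move: H3; rewrite /pull_bilin JE -lE (congr_scale Ha Hb).
  by move/matrixP/(_ i0 i0); rewrite mxE [RHS]mxE => /(mulIf (gpos _ _ Mc cp)).
(* The hypothesis gives smoothness of the factor in the point only. As a quotient of diagonal
   entries of the pulled back metric and of the metric, it is smooth in the group element as
   well. *)
have sh c1 c : atlas G c1 -> atlas M c -> usm (crange c1 `*` crange c)
     (fun z => h (cinv c1 z.1)^-1%g (cinv c z.2)).
  move=> Gc1 Mc; apply: (act_dom_cover (rho:=rho)) => d Md.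
  have oD : open (act_dom (rho:=rho) c1 c d) by exact: open_act_dom.
  pose J (z : 'rV[R]_m * 'rV[R]_n) := jacobian (local (rho (cinv c1 z.1)^-1%g) c d) z.2.
  have sJ i j : usm (act_dom (rho:=rho) c1 c d) (fun z => J z i j).
    exact: act_jacobian_usm.
  have sg i j : usm (act_dom (rho:=rho) c1 c d)
      (fun z => g d (local (rho (cinv c1 z.1)^-1%g) c d z.2) i j).
    apply: (act_comp_usm G_closed (F := fun q => g d q i j)) => //; exact: metric_usm.
  have sJT i j : usm (act_dom (rho:=rho) c1 c d) (fun z => (J z)^T i j).
    by apply: (usm_ext oD _ (sJ j i)) => z _; rewrite [RHS]mxE.
  have sp := usm_mulmx oD (usm_mulmx oD sJ sg) sJT.
  have sg0 : usm (act_dom (rho:=rho) c1 c d) (fun z => g c z.2 i0 i0).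
    apply: usm_sub (usm_snd (crange_open' c) (metric_usm rg i0 i0 Mc)).
    by move=> z [_ []].
  have sg0V := usm_inv oD _ sg0.
  apply: usm_ext (usmM oD (sp i0 i0) (sg0V _)) => //; last first.
    by move=> z [_ [cz _]]; exact: gpos.
  move=> z [c1z [cz dz]]; have [_ _ H] := hP (cinv c1 z.1)^-1%g.
  have := H c d z.2 ltac:(split=> //).
  rewrite /pull_bilin -/(J z) => /matrixP /(_ i0 i0) ->.
  by rewrite mxE mulfK//; exact: gpos.
have h0 a : forall x, 0 < h a x by have [] := hP a.
have [k sk kE] := cocycle_trivial h0 hM sh H1.
(* Since [h a] is the exponential of [k o a - k], the weight [exp (- k)] absorbs the factor. *)
have sk' : smooth_fun (fun x => - k x).
  by apply/smooth_funP/psmoothN; [exact: openT|apply/smooth_funP].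
apply: (isometric_acts_properly G_closed (riemannian_scale sk')) cM => a c d p mp.
have [Mc Md cp dp] := mp; have [_ _ /(_ c d p mp)] := hP a.
rewrite /pull_bilin -scalemxAr -scalemxAl => ->; rewrite scalerA; congr (_ *: _).
rewrite [cinv d _]cmapK// -[h a _](@lnK R) ?posrE// kE -expRD; congr expR.
by rewrite addrA addNr add0r.
Qed.

End conformal.

(** * Pseudo-Hermitian structures preserved up to scale *)

(** The algebra behind the naturality of the exterior derivative: the symmetric second derivatives
    [H] cancel, and the rest is alternating. *)
Lemma alternating_sum {R : comPzRingType} {n : nat} (H H' w A B : 'I_n -> R)
    (X : 'I_n -> 'I_n -> R) : (forall k, H k = H' k) ->
  \sum_k (H k * w k + B k * \sum_l A l * X l k)
    - \sum_k (H' k * w k + A k * \sum_l B l * X l k)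
  = \sum_k \sum_l A k * (X k l - X l k) * B l.
Proof.
move=> E; rewrite !big_split /= (eq_bigr _ (fun k _ => congr1 ( *%R^~ _) (E k))).
rewrite opprD addrACA subrr add0r.
under eq_bigr do rewrite mulr_sumr.
rewrite exchange_big /= -sumrB; apply: eq_bigr => k _; rewrite mulr_sumr -sumrB.
by apply: eq_bigr => l _; ring.
Qed.

(** * The exterior derivative in coordinates *)

Section exterior_derivative.
Context {R : realType} {n : nat}.
Implicit Types (w : 'rV[R]_n -> 'cV[R]_n) (p u v : 'rV[R]_n).

Definition dmat w p : 'M[R]_n := \matrix_(i, j)
  ('D_(ebase i) (fun q => w q j ord0 : R^o) p - 'D_(ebase j) (fun q => w q i ord0 : R^o) p).

Lemma dmat_alt w p : (dmat w p)^T = - dmat w p.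
Proof. by apply/matrixP => i j; rewrite !mxE opprB. Qed.

Lemma dmat_usm (U : set 'rV[R]_n) w i j : open U ->
  (forall j, usm U (fun q => w q j ord0)) -> usm U (fun p => dmat w p i j).
Proof.
move=> oU sw; apply: (usm_ext oU _ (usmB oU (usm_D _ (sw j)) (usm_D _ (sw i)))) => p _.
by rewrite mxE.
Qed.

Lemma D_pairing (U : set 'rV[R]_n) w p u v : open U ->
  (forall j, usm U (fun q => w q j ord0)) -> U p ->
  'D_u (fun q => (v *m w q) ord0 ord0 : R^o) p =
  \sum_i \sum_j u ord0 i * 'D_(ebase i) (fun q => w q j ord0 : R^o) p * v ord0 j.
Proof.
move=> oU sw Up.
have -> : (fun q => (v *m w q) ord0 ord0 : R^o) = fun q => \sum_j v ord0 j * w q j ord0.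
  by apply/funext => q; rewrite mxE.
have sv : usm U (fun q => \sum_j v ord0 j * w q j ord0).
  by apply: usm_sum => // j _; exact: usmZ.
rewrite (differentiable_D _ (usm_differentiable oU sv Up)); apply: eq_bigr => i _.
have D := is_derive_sumf (index_enum 'I_n) (fun j =>
  is_derive_mulf (is_derive_cst (v ord0 j) p (ebase i)) (usm_der (ebase i) (sw j) Up)).
refine (etrans (congr1 ( *%R _) (@derive_val _ _ _ _ _ _ _ D)) _).
rewrite mulr_sumr; apply: eq_bigr => j _; rewrite mul0r add0r.
by rewrite mulrCA mulrC.
Qed.

Lemma dform_dmat (M : manifoldType R n) (w : chart R n M -> 'rV[R]_n -> 'cV[R]_n) c p u v :
  (forall j, usm (crange c) (fun q => w c q j ord0)) -> crange c p ->
  dform w c p u v = bform (dmat (w c) p) u v.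
Proof.
move=> sw cp; have oc := crange_open' c.
rewrite /dform /pairing (D_pairing u v oc sw cp) (D_pairing v u oc sw cp) bformE.
rewrite [X in _ - X]exchange_big /= -sumrB; apply: eq_bigr => i _.
rewrite -sumrB; apply: eq_bigr => j _; rewrite mxE.
move: ('D_(ebase i) _ p) ('D_(ebase j) _ p) => x y; ring.
Qed.

(** The Leibniz rule for d(f w); [df] enters only through a term that vanishes on pairs of vectors
    in the kernel of [w]. *)
Lemma dmat_scale (U : set 'rV[R]_n) (f : 'rV[R]_n -> R) w p : open U ->
  usm U f -> (forall j, usm U (fun q => w q j ord0)) -> U p ->
  exists df : 'cV[R]_n, dmat (fun q => f q *: w q) p =
    f p *: dmat w p + (df *m (w p)^T - w p *m df^T).
Proof.
move=> oU sf sw Up; exists (\col_i 'D_(ebase i) f p); apply/matrixP => i j.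
have D i' j' := is_derive_mulf (usm_der (ebase i') sf Up) (usm_der (ebase i') (sw j') Up).
have E j' : (fun q => (f q *: w q) j' ord0 : R^o) = fun q => f q * w q j' ord0.
  by apply/funext => q; rewrite mxE.
have {D}D i' j' : 'D_(ebase i') (fun q => (f q *: w q) j' ord0 : R^o) p =
    'D_(ebase i') f p * w p j' ord0 + f p * 'D_(ebase i') (fun q => w q j' ord0 : R^o) p.
  by rewrite E; exact: (@derive_val _ _ _ _ _ _ _ (D i' j')).
have L : dmat (fun q => f q *: w q) p i j =
    'D_(ebase i) (fun q => (f q *: w q) j ord0 : R^o) p -
    'D_(ebase j) (fun q => (f q *: w q) i ord0 : R^o) p by rewrite mxE.
rewrite L !D !mxE !big_ord1 !mxE.
move: ('D_(ebase i) (fun q => w q j ord0 : R^o) p) ('D_(ebase j) (fun q => w q i ord0 : R^o) p) => x y.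
move: ('D_(ebase i) f p) ('D_(ebase j) f p) => a b; ring.
Qed.

(** Pullback commutes with the exterior derivative. The factor [s] is a constant, so no derivative
    of it appears; hence the prior normalisation of the form up to a locally constant sign. *)
Lemma dmat_pull (U W : set 'rV[R]_n) (phi : 'rV[R]_n -> 'rV[R]_n) w1 w2 (s : R) p :
  open U -> open W -> (forall j, usm U (fun q => phi q ord0 j)) ->
  (forall j, usm U (fun q => w1 q j ord0)) -> (forall j, usm W (fun q => w2 q j ord0)) ->
  (forall q, U q -> W (phi q)) -> U p ->
  (forall q j, U q -> \sum_k 'D_(ebase j) (fun q => phi q ord0 k : R^o) q * w2 (phi q) k ord0
     = s * w1 q j ord0) ->
  forall i j, \sum_k \sum_l 'D_(ebase i) (fun q => phi q ord0 k : R^o) p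
      * dmat w2 (phi p) k l * 'D_(ebase j) (fun q => phi q ord0 l : R^o) p
    = s * dmat w1 p i j.
Proof.
move=> oU oW sphi s1 s2 UW Up E i j.
have H i' j' : s * 'D_(ebase i') (fun q => w1 q j' ord0 : R^o) p =
    \sum_k ('D_(ebase i') ('D_(ebase j') (fun q => phi q ord0 k : R^o)) p * w2 (phi p) k ord0
     + 'D_(ebase j') (fun q => phi q ord0 k : R^o) p *
       \sum_l 'D_(ebase i') (fun q => phi q ord0 l : R^o) p *
         'D_(ebase l) (fun q => w2 q k ord0 : R^o) (phi p)).
  have D1 := is_derive_mulf (is_derive_cst s p (ebase i')) (usm_der (ebase i') (s1 j') Up).
  have D2 := is_derive_sumf (index_enum 'I_n) (fun k => is_derive_mulf
    (usm_der (ebase i') (usm_D (ebase j') (sphi k)) Up)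
    (chain_rule (usm_differentiable oW (s2 k) (UW _ Up))
      (fun l => @ex_derive _ _ _ _ _ _ _ (usm_der (ebase i') (sphi l) Up)))).
  have N : \forall q \near p, \sum_k 'D_(ebase j') (fun q => phi q ord0 k : R^o) q
      * w2 (phi q) k ord0 = s * w1 q j' ord0.
    by apply: filterS (open_near oU Up) => q Uq; exact: E.
  have D3 := near_eq_is_derive N D2.
  rewrite -[RHS](@derive_val _ _ _ _ _ _ _ D3) (@derive_val _ _ _ _ _ _ _ D1).
  by rewrite mul0r add0r.
have L : dmat w1 p i j = 'D_(ebase i) (fun q => w1 q j ord0 : R^o) p
    - 'D_(ebase j) (fun q => w1 q i ord0 : R^o) p by rewrite mxE.
rewrite L mulrBr (H i j) (H j i).
have S k : 'D_(ebase i) ('D_(ebase j) (fun q => phi q ord0 k : R^o)) p =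
    'D_(ebase j) ('D_(ebase i) (fun q => phi q ord0 k : R^o)) p.
  exact: (usm_schwarz (ebase j) (ebase i) oU (sphi k) Up).
refine (etrans _ (esym (alternating_sum _ _ _ _ S))).
by apply: eq_bigr => k _; apply: eq_bigr => l _; rewrite mxE.
Qed.

End exterior_derivative.

Lemma near_open_nbhs {T : topologicalType} (x : T) (P : set T) :
  (\forall y \near x, P y) -> exists N : set T, [/\ open N, N x & N `<=` P].
Proof. by rewrite /prop_near1 nbhsE => -[N [oN Nx] NP]; exists N. Qed.

Lemma mx11_eq0 {R : nzRingType} (z : 'M[R]_1) : z ord0 ord0 = 0 <-> z = 0.
Proof.
split=> [z0|->]; last by rewrite mxE.
by apply/matrixP => i j; rewrite !ord1 z0 mxE.
Qed.

Lemma proportional_of_ker {R : fieldType} {n : nat} (w y : 'cV[R]_n) : w != 0 ->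
  (forall v : 'rV[R]_n, v *m w = 0 :> 'M[R]_1 -> v *m y = 0 :> 'M[R]_1) -> exists r, y = r *: w.
Proof.
move=> w0 H; have [i wi] : exists i, w i ord0 != 0.
  apply/existsP; apply: contraT; rewrite negb_exists => /forallP wz.
  case/negP: w0; apply/eqP/matrixP => i j; rewrite ord1 mxE.
  by have := wz i; rewrite negbK => /eqP.
exists (y i ord0 / w i ord0); apply/matrixP => j k; rewrite ord1 !mxE.
have := H (w i ord0 *: delta_mx ord0 j - w j ord0 *: delta_mx ord0 i).
rewrite !mulmxBl -!scalemxAl -!rowE => /(_ _) /mx11_eq0; rewrite !mxE => E.
have {}E := E ltac:(by apply/mx11_eq0; rewrite !mxE mulrC subrr).
by apply: (mulfI wi); rewrite (subr0_eq E) mulrA [w i ord0 * _]mulrC divfK// mulrC.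
Qed.

Section contact_data_lemmas.
Context {R : realType} {n : nat}.

(** [J] preserves the kernel of [w], where the extra term vanishes, so the Levi form on the kernel
    is merely multiplied by [f > 0]. *)
Lemma contact_data_scale (w df : 'cV[R]_n) (B J : 'M[R]_n) (f : R) : 0 < f ->
  contact_data w B J -> (f *: B + (df *m w^T - w *m df^T))^T
    = - (f *: B + (df *m w^T - w *m df^T)) ->
  contact_data (f *: w) (f *: B + (df *m w^T - w *m df^T)) J.
Proof.
move=> f0 cd alt; have fn : f != 0 by rewrite gt_eqF.
have K (v : 'rV[R]_n) : v *m (f *: w) = 0 :> 'M[R]_1 -> v *m w = 0 :> 'M[R]_1.
  by rewrite -scalemxAr => /eqP; rewrite scaler_eq0 (negPf fn) => /eqP.
have T (v : 'rV[R]_n) : v *m w = 0 :> 'M[R]_1 -> w^T *m v^T = 0 :> 'M[R]_1.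
  by move=> vw; rewrite -trmx_mul vw trmx0.
have L (u v : 'rV[R]_n) : u *m w = 0 :> 'M[R]_1 -> v *m w = 0 :> 'M[R]_1 ->
    bform (J *m (f *: B + (df *m w^T - w *m df^T))) u v = f * bform (J *m B) u v.
  move=> uw vw; have uJ := cd_ker cd uw.
  rewrite /bform !mulmxDr !mulmxDl !mulmxN !mulNmx !mulmxA uJ !mul0mx subr0.
  by rewrite -!mulmxA T// !mulmx0 addr0 -!scalemxAl -!scalemxAr mxE.
split=> //.
- by rewrite scaler_eq0 negb_or fn; exact: cd_neq0 cd.
- by move=> v /K /(cd_ker cd); rewrite -scalemxAr => ->; rewrite scaler0.
- by move=> u v /K ku /K kv; rewrite !L// (cd_sym cd).
- by move=> u /K ku u0; rewrite L// mulr_gt0// (cd_pos cd).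
Qed.

End contact_data_lemmas.

Section contact_metrics.
Context {R : realType} {n : nat} {M : manifoldType R n}.
Variables (w : chart R n M -> 'rV[R]_n -> 'cV[R]_n) (J : chart R n M -> 'rV[R]_n -> 'M[R]_n).
Hypothesis w_usm : forall c j, atlas M c -> usm (crange c) (fun q => w c q j ord0).
Hypothesis J_usm : forall c i j, atlas M c -> usm (crange c) (fun q => J c q i j).
Hypothesis w_data : forall c p, atlas M c -> crange c p ->
  contact_data (w c p) (dmat (w c) p) (J c p).

Definition contact_g c p := contact_metric (w c p) (dmat (w c) p) (J c p).

(** The relation between the forms is assumed near [p] and not only at [p], because the metric
    involves the exterior derivative of the form. *)
Lemma contact_pull f c d p (s : R) : smooth_map f -> atlas M c -> atlas M d ->
  ldom f c d p -> s ^+ 2 = 1 ->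
  (\forall q \near p, pull_form f w c d q = s *: w c q) ->
  (forall v : 'rV[R]_n, v *m w c p = 0 :> 'M[R]_1 ->
     v *m J c p *m jacobian (local f c d) p
     = v *m jacobian (local f c d) p *m J d (local f c d p)) ->
  pull_bilin f contact_g c d p = contact_g c p.
Proof.
move=> sf Mc Md Lp s1 nE HJ; have [cp dp] := Lp.
have oL : open (ldom f c d) by exact: open_ldom (smooth_map_cont sf).
have dq : crange d (local f c d p) by exact: crange_cmap.
have [N [oN Np NE]] := near_open_nbhs nE.
pose U := ldom f c d `&` N; have oU : open U by exact: openI.
have UL q : U q -> ldom f c d q by case.
have sphi j : usm U (fun q => local f c d q ord0 j).
  by apply: usm_sub (local_usm j sf Mc Md) => q [].
have sw1 j : usm U (fun q => w c q j ord0).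
  by apply: usm_sub (w_usm j Mc) => q [[]].
have E q j : U q -> \sum_k 'D_(ebase j) (fun q => local f c d q ord0 k : R^o) q
    * w d (local f c d q) k ord0 = s * w c q j ord0.
  move=> [Lq /NE /matrixP /(_ j ord0)]; rewrite /pull_form mxE [RHS]mxE => <-.
  by apply: eq_bigr => k _; congr (_ * _); exact: (esym (jacobian_entry sf Mc Md j k Lq)).
have Up : U p by split.
have P := dmat_pull oU (crange_open' d) sphi sw1 (fun j => w_usm j Md)
  (fun q Uq => crange_cmap (UL q Uq).2) Up E.
rewrite /pull_bilin /contact_g; apply: (contact_metric_pull (s := s)) => //.
- exact: w_data.
- exact: w_data.
- exact: NE _ Np.
- apply/matrixP => i j; rewrite [RHS]mxE -P mxE.
  rewrite exchange_big /=; apply: eq_bigr => l _; rewrite [in LHS]mxE mulr_suml.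
  apply: eq_bigr => k _; rewrite [in X in _ * X]mxE.
  congr (_ * _ * _); exact: jacobian_entry.
Qed.

Lemma contact_riemannian :
  (forall c d p, Defs.meets idfun c d p -> w c p = pull_form idfun w c d p) ->
  (forall c d p (v : 'rV[R]_n), Defs.meets idfun c d p -> v *m w c p = 0 :> 'M[R]_1 ->
     v *m J c p *m jacobian (local idfun c d) p
     = v *m jacobian (local idfun c d) p *m J d (local idfun c d p)) ->
  riemannian contact_g.
Proof.
move=> wT JT; split.
- move=> c Mc; have oc := crange_open' c; apply: (iffRL (smooth_on_mxP _ oc)).
  have sw i j : usm (crange c) (fun p => w c p i j).
    by rewrite (ord1 j); exact: w_usm.
  have st a b (X : 'rV[R]_n -> 'M[R]_(a, b)) : (forall i j, usm (crange c) (fun p => X p i j)) ->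
      forall i j, usm (crange c) (fun p => (X p)^T i j).
    by move=> sX i j; apply: (usm_ext oc _ (sX j i)) => p _; rewrite [RHS]mxE.
  have sD a b (X Y : 'rV[R]_n -> 'M[R]_(a, b)) : (forall i j, usm (crange c) (fun p => X p i j)) ->
      (forall i j, usm (crange c) (fun p => Y p i j)) ->
      forall i j, usm (crange c) (fun p => (X p + Y p) i j).
    by move=> sX sY i j; apply: (usm_ext oc _ (usmD oc (sX i j) (sY i j))) => p _; rewrite [RHS]mxE.
  have sB i j : usm (crange c) (fun p => dmat (w c) p i j).
    by apply: dmat_usm => // k; exact: w_usm.
  have sww := usm_mulmx oc sw (st _ _ _ sw).
  have sA := sD _ _ _ _ sB sww.
  have sAV : forall i j, usm (crange c) (fun p => invmx (contact_bilin (w c p) (dmat (w c) p)) i j).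
    by move=> i j; apply: usm_invmx => // p cp; exact: contact_unit (w_data Mc cp).
  have sxi := usm_mulmx oc (st _ _ _ sw) sAV.
  have swxi := usm_mulmx oc sw sxi.
  have sP : forall i j, usm (crange c) (fun p => ker_proj (w c p) (dmat (w c) p) i j).
    move=> i j; apply: (usm_ext oc _ (usmB oc (usm_cst (1%:M i j) oc) (swxi i j))) => p _.
    by rewrite [RHS]mxE; congr (_ + _); rewrite [RHS]mxE.
  have sJB := usm_mulmx oc (fun i j => J_usm i j Mc) sB.
  exact: sD _ _ _ _ sww (usm_mulmx oc (usm_mulmx oc sP sJB) (st _ _ _ sP)).
- move=> c d p mp; have [Mc Md cp dp] := mp.
  apply/esym/(contact_pull (s := 1)) => //.
  + exact: smooth_map_id.
  + by rewrite expr1n.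
  + have oL : open (ldom idfun c d) by exact: (open_ldom (f := @idfun M) c d (smooth_map_cont smooth_map_id)).
    have Lp : ldom idfun c d p by [].
    apply: filterS (open_near oL Lp) => q [cq dq].
    by rewrite scale1r; apply/esym/wT.
  + by move=> v; exact: JT.
- by move=> c p Mc cp; have := contact_posdef (w_data Mc cp).
Qed.

End contact_metrics.

(** Lets the proportionality factor of two covectors be read off smoothly as a quotient by [w^T w],
    with no choice of a nonvanishing coordinate. *)
Lemma col_sqr_neq0 {R : realDomainType} {n : nat} (w : 'cV[R]_n) : w != 0 ->
  (w^T *m w) ord0 ord0 != 0.
Proof.
move=> w0; rewrite mxE psumr_eq0; last by move=> i _; rewrite mxE -expr2 sqr_ge0.
apply: contra w0 => /allP H; apply/eqP/matrixP => i j; rewrite ord1 [RHS]mxE.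
by have /eqP := H i (mem_index_enum i); rewrite mxE => /eqP; rewrite mulf_eq0 orbb => /eqP.
Qed.

Lemma col_neq0_ex {R : nzRingType} {n : nat} (w : 'cV[R]_n) : w != 0 ->
  exists v : 'rV[R]_n, v *m w != 0.
Proof.
move=> w0; apply: contrapT => /forallNP H; case/negP: w0; apply/eqP/row_matrixP => i.
by have /negP := H (delta_mx ord0 i); rewrite negbK -rowE row0 => /eqP.
Qed.

Lemma continuous_sign {R : realType} {S : topologicalType} (f : S -> R) x :
  {for x, continuous f} -> (forall y, f y ^+ 2 = 1) -> \forall y \near x, f y = f x.
Proof.
move=> cf f1; have fE y : f y = 1 \/ f y = -1.
  by have /eqP := f1 y; rewrite sqrf_eq1 => /orP[] /eqP; [left|right].
have N : \forall y \near x, ball (f x) 1 (f y) by exact: cf _ (nbhsx_ballx (f x) 1 ltr01).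
apply: filterS N => y; rewrite /ball /=.
by case: (fE x) (fE y) => -> [] ->// ; rewrite ?opprK ltr_norml; lra.
Qed.

Lemma meets_dom {R : realType} {n : nat} {M : manifoldType R n} (f : M -> M)
  (c d : chart R n M) p : Defs.meets f c d p -> ldom f c d p.
Proof. by case. Qed.

Lemma pull_chain {R : comPzRingType} {n : nat} (J1 J2 J3 : 'M[R]_n)
    (w0 w1 w2 w3 : 'cV[R]_n) r :
  w2 = J3 *m w3 -> J2 *m w2 = r *: w1 -> w0 = J1 *m w1 ->
  J1 *m (J2 *m J3) *m w3 = r *: w0.
Proof. by move=> E2 E1 ->; rewrite -!mulmxA -E2 E1 scalemxAr. Qed.

Lemma pull_comp {R : comPzRingType} {n : nat} (J1 J2 : 'M[R]_n)
    (w0 w1 w2 : 'cV[R]_n) r s :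
  J2 *m w2 = s *: w1 -> J1 *m w1 = r *: w0 -> J1 *m J2 *m w2 = (s * r) *: w0.
Proof. by move=> E2 E1; rewrite -mulmxA E2 -scalemxAr E1 scalerA. Qed.

Section pseudo_hermitian.
Context {R : realType} {n m : nat} {M : manifoldType R n} {G : lieGroupType R m}.
Context {rho : G -> Diff M} (G_closed : closed_lie_subgroup rho).
Context (w : chart R n M -> 'rV[R]_n -> 'cV[R]_n) (J : chart R n M -> 'rV[R]_n -> 'M[R]_n).
Hypothesis ph : pseudo_hermitian w J.

Lemma form_neq0 c p : atlas M c -> crange c p -> w c p != 0.
Proof.
move=> Mc cp; apply/eqP => w0; have [[_ [k _ H]] _ _] := ph.
have [u /eqP] := H c p Mc cp; apply; rewrite /contact_volume big1// => s _.
by rewrite /pairing w0 mulmx0 mxE mulr0 mul0r.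
Qed.

Lemma form_usm c j : atlas M c -> usm (crange c) (fun q => w c q j ord0).
Proof.
move=> Mc; have [[[H _] _] _ _] := ph.
exact: (iffLR (smooth_on_mxP (w c) (crange_open' c)) (H c Mc)).
Qed.

Lemma form_data c p : atlas M c -> crange c p ->
  contact_data (w c p) (dmat (w c) p) (J c p).
Proof.
move=> Mc cp; have [_ [_ _ HJ] HL] := ph.
have K (v : 'rV[R]_n) : v *m w c p = 0 :> 'M[R]_1 <-> pairing w c p v = 0.
  by apply: iff_sym; exact: mx11_eq0.
have L u v : levi w J c p u v = bform (J c p *m dmat (w c) p) u v.
  by rewrite /levi (dform_dmat _ _ (fun j => form_usm j Mc) cp) /bform !mulmxA.
have [H1 H2] := HL c p Mc cp.
split; [exact: form_neq0|exact: dmat_alt| | |].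
- by move=> v /K kv; apply/K; have [] := HJ c p v Mc cp kv.
- by move=> u v /K ku /K kv; have [] := H1 u v ku kv; rewrite !L.
- by move=> u /K ku u0; have := H2 u ku u0; rewrite L.
Qed.

Section scaled_form.
Variables (k : M -> R) (sk : smooth_fun k).

Definition scaled_form c p := expR (k (cinv c p)) *: w c p.

Lemma exp_usm c : atlas M c -> usm (crange c) (fun p => expR (k (cinv c p))).
Proof.
by move=> Mc; apply: usm_exp; [exact: crange_open'|exact: smooth_fun_usm sk Mc].
Qed.

Lemma scaled_usm c j : atlas M c -> usm (crange c) (fun q => scaled_form c q j ord0).
Proof.
move=> Mc; have oc := crange_open' c.
apply: (usm_ext oc _ (usmM oc (exp_usm Mc) (form_usm j Mc))) => p _.
by rewrite [RHS]mxE.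
Qed.

Lemma scaled_data c p : atlas M c -> crange c p ->
  contact_data (scaled_form c p) (dmat (scaled_form c) p) (J c p).
Proof.
move=> Mc cp.
have [df E] := dmat_scale (crange_open' c) (exp_usm Mc) (fun j => form_usm j Mc) cp.
rewrite /scaled_form in E *; rewrite E; apply: contact_data_scale.
- exact: expR_gt0.
- exact: form_data.
- by rewrite -E; exact: dmat_alt.
Qed.

Lemma scaled_ker c p (v : 'rV[R]_n) : v *m scaled_form c p = 0 :> 'M[R]_1 ->
  pairing w c p v = 0.
Proof.
rewrite -scalemxAr => /eqP; rewrite scaler_eq0 gt_eqF ?expR_gt0//= => /eqP H.
exact/mx11_eq0.
Qed.

Lemma scaled_riemannian : riemannian (contact_g scaled_form J).
Proof.
have [[[_ wT] _] [sJ JT _] _] := ph.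
apply: contact_riemannian.
- exact: scaled_usm.
- by move=> c i j Mc; exact: (iffLR (smooth_on_mxP (J c) (crange_open' c)) (sJ c Mc)).
- exact: scaled_data.
- move=> c d p mp; have [Mc Md cp dp] := mp.
  by rewrite /scaled_form (wT c d p mp) /pull_form -scalemxAr [cinv d _]cmapK.
- by move=> c d p v mp /scaled_ker kv; exact: JT.
Qed.

End scaled_form.

Hypothesis pCR : forall a, preserves_CR w J (rho a).

Lemma CR_factor a x : exists r : R, forall c d p, Defs.meets (rho a) c d p ->
  cinv c p = x -> pull_form (rho a) w c d p = r *: w c p.
Proof.
have [[[_ wT] _] _ _] := ph.
have [c0 Mc0 c0x] := chart_at x; have [d0 Md0 d0x] := chart_at (rho a x).
have cp0 := crange_cmap c0x; have px0 : cinv c0 (c0 x) = x by exact: cmapK.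
have m0 : Defs.meets (rho a) c0 d0 (c0 x) by split=> //; rewrite px0.
have [r Er] : exists r, pull_form (rho a) w c0 d0 (c0 x) = r *: w c0 (c0 x).
  apply: proportional_of_ker; first exact: form_neq0.
  move=> v /mx11_eq0 kv; apply/mx11_eq0; rewrite /pull_form mulmxA.
  by have [[H _] _] := pCR m0 v; exact: H.
exists r => c d p mp px; have [Mc Md cp dp] := mp.
have mi : Defs.meets idfun c c0 p by split=> //; rewrite /= px.
have Lp : local idfun c c0 p = c0 x by rewrite /local /= px.
have L0 : local (rho a) c0 d0 (c0 x) = d0 (rho a x) by rewrite /local /= px0.
have L1 : local (rho a) c d p = d (rho a x) by rewrite /local /= px.
have L2 : local (rho a) c0 d (c0 x) = d (rho a x) by rewrite /local /= px0.
have L3 : local idfun d0 d (d0 (rho a x)) = d (rho a x) by rewrite /local /= cmapK.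
have dx : cdom d (rho a x) by rewrite -px.
have mj : Defs.meets idfun d0 d (d0 (rho a x)).
  by split=> //; [exact: crange_cmap|rewrite /= cmapK].
have [_ J1] := jacobian_comp smooth_map_id (Diff_smooth (rho a)) (Diff_smooth (rho a))
  (fun=> erefl) Mc Mc0 Md (meets_dom mi) dp.
have dx' : cdom d (rho a (cinv c0 (c0 x))) by rewrite px0.
have [_ J2] := jacobian_comp (Diff_smooth (rho a)) smooth_map_id (Diff_smooth (rho a))
  (fun=> erefl) Mc0 Md0 Md (meets_dom m0) dx'.
have Ej := wT _ _ _ mj; have Ei := wT _ _ _ mi; move: Er Ei Ej.
rewrite /pull_form J1 Lp J2 L0 L1 L3 => Er Ei Ej.
exact: pull_chain Ej Er Ei.
Qed.

Definition CR_scale a x := projT1 (cid (CR_factor a x)).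

Lemma CR_scaleP a c d p : Defs.meets (rho a) c d p ->
  pull_form (rho a) w c d p = CR_scale a (cinv c p) *: w c p.
Proof. by rewrite /CR_scale; case: cid => r /= H mp; exact: H. Qed.

Lemma CR_scale_neq0 a x : CR_scale a x != 0.
Proof.
have [c Mc cx] := chart_at x; have [d Md dx] := chart_at (rho a x).
have px : cinv c (c x) = x by exact: cmapK.
have m0 : Defs.meets (rho a) c d (c x) by split=> //; [exact: crange_cmap|rewrite px].
apply/eqP => u0; have := CR_scaleP m0; rewrite px u0 scale0r => E.
have [v /eqP] := col_neq0_ex (form_neq0 Mc (crange_cmap cx)); apply.
apply/mx11_eq0; have [[_ H] _] := pCR m0 v; apply: H.
by rewrite /pairing -mulmxA -/(pull_form _ _ _ _ _) E mulmx0 mxE.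
Qed.

Lemma CR_scale_mul a b x : CR_scale (a * b)%g x = CR_scale a (rho b x) * CR_scale b x.
Proof.
have [c Mc cx] := chart_at x; have [d Md dx] := chart_at (rho b x).
have [e Me ex] := chart_at (rho a (rho b x)).
have cp := crange_cmap cx; have px : cinv c (c x) = x by exact: cmapK.
have m1 : Defs.meets (rho b) c d (c x) by split=> //; rewrite px.
have m3 : Defs.meets (rho (a * b)%g) c e (c x) by split=> //; rewrite px rho_mul.
have [_ _ _ e3] := m3.
have [L2 JE] := jacobian_comp (Diff_smooth (rho b)) (Diff_smooth (rho a))
  (Diff_smooth (rho (a * b)%g)) (rho_mul G_closed a b) Mc Md Me
  (meets_dom m1) e3.
have m2 : Defs.meets (rho a) d e (local (rho b) c d (c x)) by case: L2; split.
have H1 := CR_scaleP m1; have H2 := CR_scaleP m2; have H3 := CR_scaleP m3.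
have lE : local (rho a) d e (local (rho b) c d (c x)) = local (rho (a * b)%g) c e (c x).
  by rewrite /local /= px cmapK// rho_mul.
have dE : cinv d (local (rho b) c d (c x)) = rho b x by rewrite /local /= px cmapK.
rewrite px in H1 H3; rewrite dE in H2.
move: H1 H2 H3; rewrite /pull_form JE -lE => H1 H2; rewrite (pull_comp H2 H1) => /eqP.
rewrite -subr_eq0 -scalerBl scaler_eq0 (negPf (form_neq0 Mc cp)) orbF subr_eq0.
by move/eqP.
Qed.

Lemma CR_scale_usm c1 c : atlas G c1 -> atlas M c -> usm (crange c1 `*` crange c)
  (fun z => CR_scale (cinv c1 z.1)^-1%g (cinv c z.2)).
Proof.
move=> Gc1 Mc; apply: (act_dom_cover (rho:=rho)) => d Md.
have oD : open (act_dom (rho:=rho) c1 c d) by exact: open_act_dom.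
pose K (z : 'rV[R]_m * 'rV[R]_n) := jacobian (local (rho (cinv c1 z.1)^-1%g) c d) z.2.
have sK i j : usm (act_dom (rho:=rho) c1 c d) (fun z => K z i j).
  exact: act_jacobian_usm.
have sw2 i j : usm (act_dom (rho:=rho) c1 c d)
    (fun z => w d (local (rho (cinv c1 z.1)^-1%g) c d z.2) i j).
  rewrite (ord1 j).
  apply: (act_comp_usm G_closed (F := fun q => w d q i ord0)) => //; exact: form_usm.
have sw1 i j : usm (act_dom (rho:=rho) c1 c d) (fun z => w c z.2 i j).
  rewrite (ord1 j); apply: usm_sub (usm_snd (crange_open' c) (form_usm i Mc)).
  by move=> z [_ []].
have sw1T i j : usm (act_dom (rho:=rho) c1 c d) (fun z => (w c z.2)^T i j).
  by apply: (usm_ext oD _ (sw1 j i)) => z _; rewrite [RHS]mxE.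
have s1 := usm_mulmx oD sw1T (usm_mulmx oD sK sw2).
have s2 := usm_mulmx oD sw1T sw1.
have s0 (z : 'rV[R]_m * 'rV[R]_n) : act_dom (rho:=rho) c1 c d z ->
    ((w c z.2)^T *m w c z.2) ord0 ord0 != 0.
  by move=> [_ [cz _]]; apply: col_sqr_neq0; exact: form_neq0.
apply: (usm_ext oD _ (usmM oD (s1 ord0 ord0) (usm_inv oD s0 (s2 ord0 ord0)))) => z Hz.
have [c1z [cz dz]] := Hz.
have m0 : Defs.meets (rho (cinv c1 z.1)^-1%g) c d z.2 by split.
have := CR_scaleP m0; rewrite /pull_form -/(K z) => ->.
by rewrite -scalemxAr mxE mulfK// s0.
Qed.

Lemma CR_acts_properly : connected [set: M] -> Hd_vanishes rho 1 -> acts_properly rho.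
Proof.
(* The scale may be negative, and the logarithm requires a positive cocycle. *)
move=> cM H1; pose h a x := CR_scale a x ^+ 2.
have h0 a x : 0 < h a x by rewrite exprn_even_gt0//= CR_scale_neq0.
have hM a b x : h (a * b)%g x = h a (rho b x) * h b x by rewrite /h CR_scale_mul exprMn.
have sh c1 c : atlas G c1 -> atlas M c -> usm (crange c1 `*` crange c)
     (fun z => h (cinv c1 z.1)^-1%g (cinv c z.2)).
  move=> Gc1 Mc; have o : open (crange c1 `*` crange c) by apply: openX; exact: crange_open'.
  exact: usmM o (CR_scale_usm Gc1 Mc) (CR_scale_usm Gc1 Mc).
have [k sk kE] := cocycle_trivial h0 hM sh H1.
(* The cocycle is the square of the scale, hence the one half in the normalising exponent. *)
pose k2 x := - (1/2) * k x.
have sk2 : smooth_fun k2.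
  by apply/smooth_funP/psmoothM; [exact: openT|exact: psmooth_cst openT|apply/smooth_funP].
apply: (isometric_acts_properly G_closed (scaled_riemannian sk2)) cM => a c d p mp.
have [Mc Md cp dp] := mp.
(* The scale of [rho a] for the rescaled form. It is continuous with square 1, so it is constant
   near every point, as [contact_pull] requires. *)
pose s x := CR_scale a x * expR (k2 (rho a x) - k2 x).
have s1 x : s x ^+ 2 = 1.
  rewrite exprMn -/(h a x) -[h a x](@lnK R) ?posrE// kE expr2 -!expRD /k2.
  by rewrite -[RHS]expR0; congr expR; lra.
have cs : continuous s.
  have sa : smooth_fun (CR_scale a).
    have [c1 Gc1 c1a] := chart_at a^-1%g.
    have Js : jointly_smooth (crange c1) (fun q x => CR_scale (cinv c1 q)^-1%g x).
      by move=> c' Mc'; exact: CR_scale_usm.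
    have := jointly_smooth_slice (crange_open' c1) Js (crange_cmap c1a).
    by rewrite cmapK// invgK.
  move=> x; apply: continuous_mulR; first exact: smooth_fun_cont sa x.
  apply: (@continuous_comp _ _ _ _ expR); last exact: continuous_expR.
  apply: (@continuousB R R M (fun x => k2 (rho a x)) k2 x); last exact: smooth_fun_cont sk2 x.
  exact: smooth_fun_cont (smooth_fun_comp sk2 (Diff_smooth (rho a))) x.
have Lp : ldom (rho a) c d p by split.
have oL : open (ldom (rho a) c d) by exact: open_ldom (smooth_map_cont (Diff_smooth (rho a))).
have ns : \forall q \near p, s (cinv c q) = s (cinv c p).
  have := near_cmap (cdom_cinv cp) (continuous_sign (cs (cinv c p)) s1).
  by rewrite cinvK.
apply: (contact_pull (scaled_usm sk2) (scaled_data sk2) (Diff_smooth (rho a)) Mc Md Lp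
  (s1 (cinv c p))).
- apply: near_and (open_near oL Lp) ns _ => q [cq dq] sq.
  have mq : Defs.meets (rho a) c d q by split.
  have := CR_scaleP mq; rewrite -sq /pull_form /scaled_form -scalemxAr => ->.
  rewrite !scalerA; congr (_ *: _); rewrite [cinv d _]cmapK// /s -mulrA -expRD subrK.
  by rewrite mulrC.
- by move=> v /scaled_ker kv; have [_ H] := pCR mp v; exact: H.
Qed.

End pseudo_hermitian.

(** * The Haar integral *)

(** If [K] failed [P], the sets whose complement in [K] satisfies [P] would form a proper filter
    that contains [K]; at a cluster point in [K] the local hypothesis gives a contradiction. *)
Lemma compact_ind {T : topologicalType} (K : set T) (P : set T -> Prop) : compact K ->
  P set0 -> (forall A B, P A -> P B -> P (A `|` B)) ->
  (forall A B, A `<=` B -> P B -> P A) ->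
  (forall x, K x -> exists2 U, nbhs x U & P U) -> P K.
Proof.
move=> cK P0 PU PS Pl; apply: contrapT => nPK.
pose F := [set A | P (K `\` A)].
have FF : ProperFilter F.
  split; first by rewrite /F/= setD0.
  split; first by rewrite /F/= setDT.
    by move=> A B PA PB; rewrite /F/= setDIr; exact: PU.
  by move=> A B AB; apply: PS; apply: setDS.
have [|x [Kx clx]] := cK F FF; first by rewrite /F/= setDv.
have [U Ux PUx] := Pl x Kx.
have FU : F (~` U) by apply: PS PUx => y [_ /contrapT].
by have [y [nUy Uy]] := clx _ _ FU Ux.
Qed.

Section compact_support.
Context {R : realType} {m : nat} {G : lieGroupType R m}.
Implicit Types (f g h phi : G -> R) (a b x y : G).

Definition cc f := continuous f /\ exists2 K, compact K & forall x, ~ K x -> f x = 0.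
Definition ccp f := cc f /\ forall x, 0 <= f x.

Lemma mulg_continuous : continuous (fun z : G * G => (z.1 * z.2)%g).
Proof. exact: smooth_map2_cont (@smooth_mulg R m G). Qed.

Lemma mulgl_continuous a : continuous (fun x : G => (a * x)%g).
Proof.
move=> x; apply: (@continuous_comp _ _ _ (fun x : G => (a, x)) (fun z : G * G => (z.1 * z.2)%g)).
  by apply: pair_continuous; [exact: cvg_cst|exact: cvg_id].
exact: mulg_continuous.
Qed.

Lemma ccD f g : cc f -> cc g -> cc (fun x => f x + g x).
Proof.
move=> [cf [K cK Kf]] [cg [L cL Lg]]; split.
  by move=> x; apply: (@continuousD R R G f g x); [exact: cf|exact: cg].
exists (K `|` L); first exact: compactU.
by move=> x /not_orP[/Kf -> /Lg ->]; rewrite addr0.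
Qed.

Lemma ccM f g : continuous g -> cc f -> cc (fun x => g x * f x).
Proof.
move=> cg [cf [K cK Kf]]; split; last by exists K => // x /Kf ->; rewrite mulr0.
by move=> x; apply: continuous_mulR; [exact: cg|exact: cf].
Qed.

Lemma ccZ (c : R) f : cc f -> cc (fun x => c * f x).
Proof. by apply: ccM => x; exact: cvg_cst. Qed.

Lemma cc_norm f : cc f -> cc (fun x => `|f x|).
Proof.
move=> [cf [K cK Kf]]; split; last by exists K => // x /Kf ->; rewrite normr0.
by move=> x; apply: continuous_normR; exact: cf.
Qed.

Lemma cc_shift a f : cc f -> cc (fun x => f (a * x)%g).
Proof.
move=> [cf [K cK Kf]]; split.
  move=> x; apply: (@continuous_comp _ _ _ (fun x => (a * x)%g) f); last exact: cf.
  exact: mulgl_continuous.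
exists ((fun x => (a^-1 * x)%g) @` K).
  apply: continuous_compact cK; apply: continuous_subspaceT; exact: mulgl_continuous.
move=> x nx; apply: Kf => Kx; apply: nx; exists (a * x)%g => //.
by rewrite monoid.mulgA monoid.mulVg monoid.mul1g.
Qed.

Lemma ccp_shift a f : ccp f -> ccp (fun x => f (a * x)%g).
Proof. by move=> [/(cc_shift a) ? f0]; split. Qed.

Lemma ccpD f g : ccp f -> ccp g -> ccp (fun x => f x + g x).
Proof. by move=> [cf f0] [cg g0]; split; [exact: ccD|move=> x; rewrite addr_ge0]. Qed.

Lemma ccpZ (c : R) f : 0 <= c -> ccp f -> ccp (fun x => c * f x).
Proof. by move=> c0 [cf f0]; split; [exact: ccZ|move=> x; rewrite mulr_ge0]. Qed.

Lemma continuous_bounded_on f (K : set G) : continuous f -> compact K ->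
  exists2 B, 0 < B & forall x, K x -> f x <= B.
Proof.
move=> cf cK; apply: (@compact_ind _ K (fun A => exists2 B, 0 < B & forall x, A x -> f x <= B)) => //.
- by exists 1.
- move=> A A' [B B0 AB] [B' B'0 AB']; exists (B + B'); first exact: addr_gt0.
  move=> x [/AB|/AB'] H; apply: le_trans H _; first by rewrite lerDl ltW.
  by rewrite lerDr ltW.
- by move=> A A' AA' [B B0 AB]; exists B => // x /AA' /AB.
- move=> x _; have N : nbhs x [set y | ball (f x) 1 (f y)] by exact: cf _ (nbhsx_ballx (f x) 1 ltr01).
  exists [set y | ball (f x) 1 (f y)] => //.
  exists (`|f x| + 1); first by rewrite ltr_wpDl.
  move=> y; rewrite /ball /= => H; have := ler_norm (f x).
  move: H; rewrite ltr_norml => /andP[]; lra.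
Qed.

Lemma ccp_bounded f : ccp f -> exists2 B, 0 < B & forall x, f x <= B.
Proof.
move=> [[cf [K cK Kf]] f0]; have [B B0 fB] := continuous_bounded_on cf cK.
exists B => // x; have [/fB//|/Kf ->] := pselect (K x); exact: ltW.
Qed.

(* Nonnegative combinations of left translates of phi, the pair (c, a) standing
   for c times the translate by a. *)
Definition translates (s : seq (R * G)) phi x := \sum_(z <- s) z.1 * phi (z.2^-1 * x)%g.
Definition weight (s : seq (R * G)) := \sum_(z <- s) z.1.
Definition covers f phi s := all (fun z => 0 <= z.1) s /\ forall x, f x <= translates s phi x.
(** The covering number (f : phi) of Weil's construction of Haar measure; [phi] serves as a small
    measuring function. *)
Definition cov f phi := inf [set weight s | s in covers f phi].

Lemma weight_ge0 s : all (fun z => 0 <= z.1) s -> 0 <= weight s.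
Proof.
elim: s => [|z s IH] /=; first by rewrite /weight big_nil.
by move=> /andP[z0 /IH s0]; rewrite /weight big_cons addr_ge0.
Qed.

Lemma cov_le f phi s : covers f phi s -> cov f phi <= weight s.
Proof.
move=> H; apply: ge_inf; last by exists s.
by exists 0 => _ [t [t0 _] <-]; exact: weight_ge0.
Qed.

Lemma cov_glb f phi (r : R) : (exists s, covers f phi s) ->
  (forall s, covers f phi s -> r <= weight s) -> r <= cov f phi.
Proof.
move=> [s H] L; apply: lb_le_inf; first by exists (weight s), s.
by move=> _ [t Ht <-]; exact: L.
Qed.

Lemma translates_cat s t phi x :
  translates (s ++ t) phi x = translates s phi x + translates t phi x.
Proof. by rewrite /translates big_cat. Qed.

Lemma translates_ge0 s phi x : all (fun z => 0 <= z.1) s -> (forall x, 0 <= phi x) ->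
  0 <= translates s phi x.
Proof.
move=> + p0; elim: s => [|z s IH] /=; first by rewrite /translates big_nil.
by move=> /andP[z0 /IH s0]; rewrite /translates big_cons addr_ge0// mulr_ge0.
Qed.

Lemma cover_exists f phi : ccp f -> ccp phi -> (exists x, 0 < phi x) ->
  exists s, covers f phi s.
Proof.
move=> [[cf [K cK Kf]] f0] [[cp _] p0] [x0 px0].
have [B B0 fB] := ccp_bounded (conj (conj cf (ex_intro2 _ _ K cK Kf)) f0).
have [s [s0 Hs]] : exists s, all (fun z => 0 <= z.1) s /\
    forall x, K x -> B <= translates s phi x.
  apply: (@compact_ind _ K (fun A => exists s, all (fun z => 0 <= z.1) s /\
    forall x, A x -> B <= translates s phi x)) => //.
  - by exists [::].
  - move=> A A' [s [s0 As]] [t [t0 At]]; exists (s ++ t).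
    rewrite all_cat s0 t0; split=> // x [/As|/At] H; rewrite translates_cat.
      by apply: le_trans H _; rewrite lerDl translates_ge0.
    by apply: le_trans H _; rewrite lerDr translates_ge0.
  - by move=> A A' AA' [s [s0 As]]; exists s; split=> // x /AA' /As.
  move=> x _; pose a := (x * x0^-1)%g.
  have N : nbhs x [set y | ball (phi x0) (phi x0 / 2) (phi (a^-1 * y)%g)].
    have ca : {for x, continuous (fun y => phi (a^-1 * y)%g)}.
      apply: (@continuous_comp _ _ _ (fun x => (a^-1 * x)%g) phi); last exact: cp.
      exact: mulgl_continuous.
    apply: ca; rewrite /a invMg invgK -monoid.mulgA monoid.mulVg monoid.mulg1.
    by apply: nbhsx_ballx; rewrite divr_gt0.
  exists [set y | ball (phi x0) (phi x0 / 2) (phi (a^-1 * y)%g)] => //.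
  have c0 : 0 < B / (phi x0 / 2) by rewrite !divr_gt0.
  exists [:: (B / (phi x0 / 2), a)]; split; first by rewrite /= ltW.
  move=> y /= yb; rewrite /translates big_seq1 /=.
  have : phi x0 / 2 <= phi (a^-1 * y)%g.
    by move: yb; rewrite /ball /= ltr_norml => /andP[]; lra.
  rewrite mulrAC ler_pdivlMr ?divr_gt0// => H.
  by rewrite ler_pM2l.
exists s; split=> // x; have [/Hs|/Kf ->] := pselect (K x); last exact: translates_ge0.
exact: le_trans.
Qed.

Lemma cov_ge0 f phi : ccp f -> ccp phi -> (exists x, 0 < phi x) -> 0 <= cov f phi.
Proof.
move=> cf cp p0; apply: cov_glb; first exact: cover_exists.
by move=> s [s0 _]; exact: weight_ge0.
Qed.

Lemma covD f g phi : ccp f -> ccp g -> ccp phi -> (exists x, 0 < phi x) ->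
  cov (fun x => f x + g x) phi <= cov f phi + cov g phi.
Proof.
move=> cf cg cp p0; rewrite -lerBlDr; apply: cov_glb; first exact: cover_exists.
move=> s [s0 fs]; rewrite lerBlDl -lerBlDr; apply: cov_glb; first exact: cover_exists.
move=> t [t0 gt]; rewrite lerBlDl -/(weight _) [leRHS](_ : _ = weight (s ++ t)).
  apply: cov_le; split; first by rewrite all_cat s0.
  by move=> x; rewrite translates_cat lerD.
by rewrite /weight big_cat.
Qed.

Lemma cov_shift a f phi : ccp f -> ccp phi -> (exists x, 0 < phi x) ->
  cov (fun x => f (a * x)%g) phi <= cov f phi.
Proof.
move=> cf cp p0; apply: cov_glb; first exact: cover_exists.
move=> s [s0 fs]; pose t := [seq (z.1, (a^-1 * z.2)%g) | z <- s].
rewrite [leRHS](_ : _ = weight t); last by rewrite /weight big_map.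
apply: cov_le; split; first by rewrite all_map.
move=> x; apply: le_trans (fs _) _; rewrite /translates big_map.
by apply: ler_sum => z _ /=; rewrite invMg invgK monoid.mulgA.
Qed.

Lemma covZ (c : R) f phi : 0 < c -> ccp f -> ccp phi -> (exists x, 0 < phi x) ->
  c * cov f phi <= cov (fun x => c * f x) phi.
Proof.
move=> c0 cf cp p0; apply: cov_glb.
  by apply: cover_exists => //; exact: ccpZ (ltW c0) cf.
move=> s [s0 fs]; rewrite -ler_pdivlMl//; pose t := [seq (c^-1 * z.1, z.2) | z <- s].
rewrite [leRHS](_ : _ = weight t); last by rewrite /weight big_map mulr_sumr.
apply: cov_le; split.
  by rewrite all_map; apply: sub_all s0 => z z0 /=; rewrite mulr_ge0// invr_ge0 ltW.
move=> x; rewrite /translates big_map /=.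
under eq_bigr do rewrite -mulrA; rewrite -mulr_sumr ler_pdivlMl//; exact: fs.
Qed.

Lemma inf_mul_le (S : set R) (a c : R) : S !=set0 -> (forall d, S d -> a <= c * d) ->
  0 <= c -> a <= c * inf S.
Proof.
move=> [d0 Sd0] H; rewrite le_eqVlt => /orP[/eqP c0|c0].
  by have := H _ Sd0; rewrite -c0 !mul0r.
rewrite -ler_pdivrMl//; apply: lb_le_inf; first by exists d0.
by move=> d /H; rewrite ler_pdivrMl.
Qed.

(** Substituting a cover of [g] by [phi] into a cover of [f] by [g] multiplies the total weights. *)
Lemma cov_trans f g phi : ccp f -> ccp g -> ccp phi -> (exists x, 0 < g x) ->
  (exists x, 0 < phi x) -> cov f phi <= cov f g * cov g phi.
Proof.
move=> cf cg cp g0 p0; have [s Hs] := cover_exists cf cg g0.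
have [t Ht] := cover_exists cg cp p0.
rewrite mulrC; apply: inf_mul_le; first by exists (weight s), s.
  move=> _ [{Hs}s [s0 fs] <-]; rewrite mulrC.
  apply: inf_mul_le; [by exists (weight t), t| |exact: weight_ge0].
  move=> _ [{Ht}t [t0 gt] <-].
  pose u : seq (R * G) := allpairs (fun y z : R * G => (y.1 * z.1, (y.2 * z.2)%g)) s t.
  rewrite [leRHS](_ : _ = weight u); last first.
    rewrite /weight /u big_allpairs_dep /= mulr_suml.
    by apply: eq_bigr => y _; rewrite mulr_sumr.
  apply: cov_le; split.
    apply/allP => _ /allpairsP[[y z] /= [ys zt ->]].
    exact: mulr_ge0 (allP s0 _ ys) (allP t0 _ zt).
  move=> x; apply: le_trans (fs x) _; rewrite /translates /u big_allpairs_dep /=.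
  rewrite big_seq [leRHS]big_seq; apply: ler_sum => y ys.
  under [leRHS]eq_bigr do rewrite -mulrA; rewrite -mulr_sumr.
  apply: ler_wpM2l; first exact: (allP s0).
  apply: le_trans (gt _) _; apply: ler_sum => z _.
  by rewrite invMg monoid.mulgA.
exact: cov_ge0.
Qed.

(** Evaluation at a point [x] with [f x > 0] bounds every weight below by [f x / B], where [B]
    bounds [phi]. *)
Lemma cov_gt0 f phi : ccp f -> ccp phi -> (exists x, 0 < phi x) -> (exists x, 0 < f x) ->
  0 < cov f phi.
Proof.
move=> cf cp p0 [x fx]; have [B B0 pB] := ccp_bounded cp.
apply: (@lt_le_trans _ _ (f x / B)); first exact: divr_gt0.
apply: cov_glb; first exact: cover_exists.
move=> s [s0 fs]; rewrite ler_pdivrMr//; apply: le_trans (fs x) _.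
rewrite /weight mulr_suml /translates; elim: s s0 {fs} => [|z s IH] /=; first by rewrite !big_nil.
by move=> /andP[z0 /IH H]; rewrite !big_cons lerD// ler_wpM2l.
Qed.

End compact_support.

Lemma ler_cvg_filter {R : realType} {T : Type} (F : set_system T) (u v : T -> R) (l l' : R) :
  ProperFilter F -> u @ F --> l -> v @ F --> l' -> F [set t | u t <= v t] -> l <= l'.
Proof.
move=> PF /cvgrPdist_le ul /cvgrPdist_le vl uv; apply/ler_addgt0Pr => b b0.
have b2 : 0 < b / 2 by rewrite divr_gt0.
have [t [uvt [lt lt']]] := filter_ex (filterI uv (filterI (ul _ b2) (vl _ b2))).
by move: lt lt' uvt; rewrite !ler_norml => /andP[] ? ? /andP[] /=; lra.
Qed.

Section haar.
Context {R : realType} {m : nat} {G : lieGroupType R m}.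
Implicit Types (f g h phi chi : G -> R) (a b x y : G).

Lemma ccp_bump x (V : set G) : nbhs x V ->
  exists f, [/\ ccp f, 0 < f x & forall y, ~ V y -> f y = 0].
Proof.
move=> Vx; have [f [sf f0 fx [K [cK KV Kf]]]] := bump Vx.
exists f; split=> //; last by move=> y nV; apply: Kf => /KV.
by split=> //; split; [exact: smooth_fun_cont|exists K].
Qed.

Lemma ccp_cutoff (K : set G) : compact K ->
  exists chi, [/\ ccp chi, exists x, 0 < chi x & forall x, K x -> 1 <= chi x].
Proof.
move=> cK; have [f1 [c1 p1 _]] := @ccp_bump 1%g setT filterT.
have [chi [cc1 H]] : exists chi, ccp chi /\ forall x, K x -> 1 <= chi x.
  apply: (@compact_ind _ K (fun A => exists chi, ccp chi /\ forall x, A x -> 1 <= chi x)) => //.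
  - by exists f1.
  - move=> A B [f [cf fA]] [g [cg gB]]; exists (fun x => f x + g x); split; first exact: ccpD.
    move=> x [/fA|/gB] H; apply: le_trans H _; first by rewrite lerDl; exact: (proj2 cg).
    by rewrite lerDr; exact: (proj2 cf).
  - by move=> A B AB [f [cf fB]]; exists f; split=> // x /AB /fB.
  - move=> x _; have [f [cf fx _]] := @ccp_bump x setT filterT.
    have [[ctf _] _] := cf.
    exists [set y | ball (f x) (f x / 2) (f y)].
      by apply: ctf; apply: nbhsx_ballx; rewrite divr_gt0.
    exists (fun y => (f x / 2)^-1 * f y); split.
      by apply: ccpZ cf; rewrite invr_ge0 divr_ge0// ltW.
    move=> y /= yb; rewrite ler_pdivlMl ?divr_gt0// mulr1.
    by move: yb; rewrite /ball /= ltr_norml => /andP[]; lra.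
exists (fun x => chi x + f1 x); split; first exact: ccpD.
  by exists 1%g; rewrite ltr_wpDl//; exact: (proj2 cc1).
by move=> x /H hx; apply: le_trans hx _; rewrite lerDl; exact: (proj2 c1).
Qed.

(** Points of the compact set [K] are treated by compactness; intersecting [V] with its inverse
    covers the case where only [t] lies in [K]. *)
Lemma cc_uniform h (e : R) : cc h -> 0 < e ->
  exists2 V, nbhs (1%g : G) V & forall s t, V (s^-1 * t)%g -> `|h s - h t| <= e.
Proof.
move=> [ch [K cK Kh]] e0.
have [V V1 HV] : exists2 V, nbhs (1%g : G) V &
    forall s, K s -> forall v, V v -> `|h s - h (s * v)%g| <= e.
  apply: (@compact_ind _ K (fun A => exists2 V, nbhs (1%g : G) V &
    forall s, A s -> forall v, V v -> `|h s - h (s * v)%g| <= e)) => //.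
  - by exists setT => //; exact: filterT.
  - move=> A B [V V1 AV] [W W1 BW]; exists (V `&` W); first exact: filterI.
    by move=> s [/AV H|/BW H] v [? ?]; exact: H.
  - by move=> A B AB [V V1 BV]; exists V => // s /AB; exact: BV.
  - move=> x _; have ca : {for (x, 1%g : G), continuous (fun z : G * G => h (z.1 * z.2)%g)}.
      apply: (@continuous_comp _ _ _ (fun z : G * G => (z.1 * z.2)%g) h); last exact: ch.
      exact: mulg_continuous.
    have e2 : 0 < e / 2 by rewrite divr_gt0.
    have := ca _ (nbhsx_ballx _ (e / 2) e2) => -[[U V] [/= Ux V1] UV].
    exists U => //; exists V => // s Us v Vv.
    have H1 := UV (s, v) (conj Us Vv).
    have H2 := UV (s, 1%g) (conj Us (nbhs_singleton V1)).
    move: H1 H2; rewrite /ball /= !monoid.mulg1 => H1 H2.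
    rewrite (splitr e) (_ : h s - _ = (h x - h (s * v)%g) - (h x - h s)); last by ring.
    by apply: le_trans (ler_normB _ _) _; rewrite lerD// ltW.
exists (V `&` [set v | V v^-1%g]).
  apply: filterI => //; apply: invg_continuous; by rewrite monoid.invg1.
move=> s t [Vst]; rewrite /= invMg invgK => Vts.
have [Ks|nKs] := pselect (K s).
  have := HV s Ks _ Vst; by rewrite monoid.mulgA monoid.mulgV monoid.mul1g.
have [Kt|nKt] := pselect (K t).
  by have := HV t Kt _ Vts; rewrite monoid.mulgA monoid.mulgV monoid.mul1g distrC.
by rewrite !Kh// subrr normr0 ltW.
Qed.

(** Subadditivity holds for every [phi]; the reverse estimate needs a small support. A cover of [h]
    is split between [f1] and [f2] in the proportions [f1 / h] and [f2 / h] at the centre of each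
    translate, and these vary by at most [e / 2] where the translate is nonzero. *)
Lemma cov_add_approx f1 f2 : ccp f1 -> ccp f2 ->
  exists chi, [/\ ccp chi, exists x, 0 < chi x & forall e : R, 0 < e ->
    exists2 V, nbhs (1%g : G) V & forall phi, ccp phi -> (exists x, 0 < phi x) ->
      (forall x, ~ V x -> phi x = 0) ->
      cov f1 phi + cov f2 phi <=
        (1 + e) * (cov (fun x => f1 x + f2 x) phi + e * cov chi phi)].
Proof.
move=> cf1 cf2; have [[ct1 [K1 cK1 Kf1]] f10] := cf1; have [[ct2 [K2 cK2 Kf2]] f20] := cf2.
have [chi [cchi nchi Hchi]] := ccp_cutoff (compactU cK1 cK2).
have chi0 := proj2 cchi.
(* The term [e * chi], at least [e] on [K1] and [K2], keeps [h] positive there, so that the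
   quotients by [h] are continuous. *)
exists chi; split=> // e e0; pose h x := f1 x + f2 x + e * chi x.
have cech : ccp (fun x => e * chi x) by apply: ccpZ => //; exact: ltW.
have ch : ccp h by apply: ccpD => //; exact: ccpD.
have h0 := proj2 ch.
have hK x : (K1 `|` K2) x -> 0 < h x.
  move=> /Hchi x1; have := f10 x; have := f20 x.
  have : 0 < e * chi x by rewrite mulr_gt0// (lt_le_trans ltr01).
  rewrite /h; lra.
have hh0 f K : compact K -> K `<=` K1 `|` K2 -> ccp f -> (forall x, ~ K x -> f x = 0) ->
    cc (fun x => f x / h x).
  move=> cK KK [[ctf _] f0] Kf; split; last by exists K => // x /Kf ->; rewrite mul0r.
  move=> x; have [Kx|nKx] := pselect (K x).
    apply: (@continuous_mulR R G f (fun x => (h x)^-1) x); first exact: ctf.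
    apply: (@continuous_comp _ _ _ h (fun r => r^-1)); first by have [[cth _] _] := ch; exact: cth.
    by apply: inv_continuous; rewrite gt_eqF// hK//; exact: KK.
  have oK : open (~` K) by apply: closed_openC; exact: compact_closedM.
  apply: (@continuous_near_eq _ _ (fun=> 0)); last exact: cvg_cst.
  by apply: filterS (open_near oK nKx) => y /Kf ->; rewrite mul0r.
have e2 : 0 < e / 2 by rewrite divr_gt0.
have [V1 V11 H1] := cc_uniform (hh0 f1 K1 cK1 (@subsetUl _ _ _) cf1 Kf1) e2.
have [V2 V21 H2] := cc_uniform (hh0 f2 K2 cK2 (@subsetUr _ _ _) cf2 Kf2) e2.
exists (V1 `&` V2); first exact: filterI.
move=> phi cp p0 pV; have phi0 := proj2 cp.
suff H : cov f1 phi + cov f2 phi <= (1 + e) * cov h phi.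
  apply: le_trans H _; apply: ler_wpM2l; first by rewrite addr_ge0// ltW.
  apply: le_trans (covD (ccpD cf1 cf2) cech cp p0) _; rewrite lerD2l.
  have ei : 0 < e^-1 by rewrite invr_gt0.
  have := covZ ei cech cp p0; rewrite ler_pdivrMl//; congr (_ <= _ * cov _ _).
  by apply/funext => x; rewrite mulKf// gt_eqF.
apply: inf_mul_le.
- by have [s Hs] := cover_exists ch cp p0; exists (weight s), s.
- move=> _ [s [s0 hs] <-].
  have T (f : G -> R) K : (forall x, 0 <= f x) -> (forall x, f x <= h x) ->
     (forall x, ~ K x -> f x = 0) -> K `<=` K1 `|` K2 ->
     (forall s t, (V1 `&` V2) (s^-1 * t)%g -> `|f s / h s - f t / h t| <= e / 2) ->
     cov f phi <= \sum_(z <- s) z.1 * (f z.2 / h z.2 + e / 2).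
    move=> f0 fh Kf KK Hu; pose t := [seq (z.1 * (f z.2 / h z.2 + e / 2), z.2) | z <- s].
    rewrite [leRHS](_ : _ = weight t); last by rewrite /weight big_map.
    apply: cov_le; split.
      rewrite all_map; apply: sub_all s0 => z z0 /=.
      by rewrite mulr_ge0// addr_ge0 ?divr_ge0// ltW.
    move=> x; have q0 : 0 <= f x / h x by rewrite divr_ge0.
    have -> : f x = f x / h x * h x.
      have [Kx|/Kf ->] := pselect (K x); last by rewrite !mul0r.
      by rewrite divfK// gt_eqF// hK//; exact: KK.
    apply: le_trans (ler_wpM2l q0 (hs x)) _; rewrite /translates big_map mulr_sumr /=.
    elim: s s0 {hs t} => [|z s IH] /=; first by rewrite !big_nil.
    move=> /andP[z0 /IH H]; rewrite !big_cons; apply: lerD => //.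
    rewrite mulrCA -mulrA ler_wpM2l//.
    have [Vz|nVz] := pselect ((V1 `&` V2) (z.2^-1 * x)%g); last by rewrite pV// !mulr0.
    apply: ler_wpM2r => //; have := Hu _ _ Vz; rewrite ler_norml => /andP[]; lra.
  have L1 : cov f1 phi <= \sum_(z <- s) z.1 * (f1 z.2 / h z.2 + e / 2).
    apply: (T f1 K1 f10 _ Kf1 (@subsetUl _ _ _)); last by move=> ? ? [? _]; exact: H1.
    by move=> x; rewrite /h -addrA lerDl addr_ge0// mulr_ge0// ltW.
  have L2 : cov f2 phi <= \sum_(z <- s) z.1 * (f2 z.2 / h z.2 + e / 2).
    apply: (T f2 K2 f20 _ Kf2 (@subsetUr _ _ _)); last by move=> ? ? [_ ?]; exact: H2.
    by move=> x; rewrite /h addrAC lerDr addr_ge0// mulr_ge0// ltW.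
  apply: le_trans (lerD L1 L2) _; rewrite /weight -big_split mulr_sumr /=.
  elim: s s0 {hs T L1 L2} => [|z s IH] /=; first by rewrite !big_nil.
  move=> /andP[z0 /IH H]; rewrite !big_cons; apply: lerD => //.
  rewrite -mulrDr mulrC ler_wpM2r//.
  suff : f1 z.2 / h z.2 + f2 z.2 / h z.2 <= 1 by lra.
  rewrite -mulrDl; have := h0 z.2; rewrite le_eqVlt => /orP[/eqP <-|hz].
    by rewrite invr0 mulr0.
  by rewrite ler_pdivrMr// mul1r /h lerDl mulr_ge0// ltW.
- by rewrite addr_ge0// ltW.
Qed.

Lemma le_of_factor (a b c : R) : 0 <= c ->
  (forall e : R, 0 < e -> a <= (1 + e) * (b + e * c)) -> a <= b.
Proof.
move=> c0 H; apply/ler_addgt0Pr => d d0.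
pose D := `|b| + 2 * c + 1; have D0 : 0 < D by rewrite /D; have := normr_ge0 b; lra.
pose e := Num.min 1 (d / D); have e0 : 0 < e by rewrite lt_min ltr01 divr_gt0.
have e1 : e <= 1 by rewrite ge_min lexx.
have eD : e * D <= d by rewrite -ler_pdivlMr// ge_min lexx orbT.
apply: le_trans (H e e0) _; have bn := ler_norm b.
have h1 : e * b <= e * `|b| by rewrite ler_pM2l.
have h2 : e * (e * c) <= e * c by apply: ler_piMl => //; rewrite mulr_ge0// ltW.
have h3 : e * D = e * `|b| + 2 * (e * c) + e by rewrite /D; ring.
have -> : (1 + e) * (b + e * c) = b + e * c + e * b + e * (e * c) by ring.
rewrite h3 in eD; move: eD e0 h1 h2 c0; clearbody e; clear; lra.
Qed.

(** Normalised by a fixed [f0], the covering numbers lie between 0 and [cov f f0] by [cov_trans]. An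
    ultrafilter of functions [phi] with supports shrinking to the identity gives limits, and
    [cov_add_approx] makes the limit additive. *)
Lemma haar_exists : exists I : (G -> R) -> R,
  [/\ forall f, ccp f -> 0 <= I f,
      forall f, ccp f -> (exists x, 0 < f x) -> 0 < I f,
      forall f g, ccp f -> ccp g -> I (fun x => f x + g x) = I f + I g,
      forall (c : R) f, 0 <= c -> ccp f -> I (fun x => c * f x) = c * I f &
      forall a f, ccp f -> I (fun x => f (a * x)%g) = I f].
Proof.
have [f0 [cf0 f01 _]] := @ccp_bump 1%g setT filterT.
have nf0 : exists x, 0 < f0 x by exists 1%g.
pose good (V : set G) phi := [/\ ccp phi, exists x, 0 < phi x & forall x, ~ V x -> phi x = 0].
pose F : set_system (G -> R) := [set A | exists2 V, nbhs (1%g : G) V & good V `<=` A].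
have FF : ProperFilter F.
  split.
    by move=> [V V1 VA]; have [f [cf fx Vf]] := ccp_bump V1; apply: (VA f); split=> //; exists 1%g.
  split; first by exists setT => //; exact: filterT.
    move=> A B [V V1 VA] [W W1 WB]; exists (V `&` W); first exact: filterI.
    move=> f [cf nf Vf]; split; [apply: VA|apply: WB]; split=> // x nx; apply: Vf; by case.
  by move=> A B AB [V V1 VA]; exists V => // f /VA /AB.
have [U [UU FU]] := ultraFilterLemma FF.
have Ugood : U (good setT) by apply: FU; exists setT => //; exact: filterT.
pose q f phi := cov f phi / cov f0 phi.
have qcvg f : exists l : R, ccp f -> q f @ U --> l.
  have [cf|ncf] := pselect (ccp f); last by exists 0.
  have := @segment_compact R 0 (cov f f0); rewrite compact_ultra => cS.
  have UE : UltraFilter (q f @ U) by exact: fmap_ultra.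
  have [|l [_ ql]] := cS _ UE; last by exists l.
  apply: (@filterS _ U _ _ _ _ Ugood) => phi [cp np _] /=.
  have p0 := cov_gt0 cf0 cp np nf0.
  rewrite in_itv /= divr_ge0 ?(ltW p0)//=; last exact: cov_ge0.
  by rewrite ler_pdivrMr//; exact: cov_trans.
have [I HI] := choice qcvg; exists I.
have UF : ProperFilter U by exact: ultra_proper.
have lim_le (u v : (G -> R) -> R) (l l' : R) : u @ U --> l -> v @ U --> l' ->
    U [set phi | u phi <= v phi] -> l <= l'.
  move=> ul vl uv; exact: (@ler_cvg_filter _ _ U u v l l' UF ul vl uv).
have qZ (r : R) (u : (G -> R) -> R) (l : R) : u @ U --> l -> (fun phi => r * u phi) @ U --> r * l.
  by move=> H; apply: cvgMl_tmp.
have qD (u v : (G -> R) -> R) (l l' : R) : u @ U --> l -> v @ U --> l' ->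
    (fun phi => u phi + v phi) @ U --> l + l'.
  by move=> H H'; exact: cvgD.
have le_lim f g (r : R) : ccp f -> ccp g -> (forall phi, ccp phi -> (exists x, 0 < phi x) ->
    cov f phi <= r * cov g phi) -> I f <= r * I g.
  move=> cf cg H; apply: (lim_le _ _ _ _ (HI f cf) (qZ r _ _ (HI g cg))).
  apply: (@filterS _ U _ _ _ _ Ugood) => phi [cp np _].
  have p0 := cov_gt0 cf0 cp np nf0.
  by rewrite /= /q mulrA ler_pM2r ?invr_gt0//; exact: H.
have I0 f : ccp f -> 0 <= I f.
  move=> cf; apply: (lim_le _ _ _ _ (cvg_cst 0) (HI f cf)).
  apply: (@filterS _ U _ _ _ _ Ugood) => phi [cp np _].
  by rewrite /= /q divr_ge0// cov_ge0.
have ID f g : ccp f -> ccp g -> I (fun x => f x + g x) = I f + I g.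
  move=> cf cg; have cfg := ccpD cf cg; apply/eqP; rewrite eq_le; apply/andP; split.
    apply: (lim_le _ _ _ _ (HI _ cfg) (qD _ _ _ _ (HI f cf) (HI g cg))).
    apply: (@filterS _ U _ _ _ _ Ugood) => phi [cp np _].
    have p0 := cov_gt0 cf0 cp np nf0.
    by rewrite /= /q -mulrDl ler_pM2r ?invr_gt0//; exact: covD.
  have [chi [cchi nchi H]] := cov_add_approx cf cg.
  apply: (@le_of_factor _ _ (I chi)); first exact: I0.
  move=> e e0; have [V V1 HV] := H e e0.
  apply: (lim_le _ _ _ _ (qD _ _ _ _ (HI f cf) (HI g cg))
    (qZ (1 + e) _ _ (qD _ _ _ _ (HI _ cfg) (qZ e _ _ (HI chi cchi))))).
  have UV : U (good V) by apply: FU; exists V.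
  apply: (@filterS _ U _ _ _ _ UV) => phi [cp np Vp].
  have p0 := cov_gt0 cf0 cp np nf0.
  rewrite /= /q -mulrDl mulrA -mulrDl mulrA ler_pM2r ?invr_gt0//; exact: HV.
have IZ (c : R) f : 0 < c -> ccp f -> I (fun x => c * f x) = c * I f.
  move=> c0 cf; have ccf := ccpZ (ltW c0) cf; apply/eqP; rewrite eq_le; apply/andP; split.
    apply: le_lim => // phi cp np; have ci : 0 < c^-1 by rewrite invr_gt0.
    have := covZ ci ccf cp np; rewrite ler_pdivrMl//; congr (_ <= _ * cov _ _).
    by apply/funext => x; rewrite mulKf// gt_eqF.
  rewrite -ler_pdivlMl//; apply: le_lim => // phi cp np.
  by rewrite ler_pdivlMl//; exact: covZ.
split=> //.
- move=> f cf nf; have c0 := cov_gt0 cf0 cf nf nf0.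
  (* [cov_trans] with the roles of [f] and [f0] exchanged bounds the normalised numbers away from
     0. *)
  apply: (@lt_le_trans _ _ (cov f0 f)^-1); first by rewrite invr_gt0.
  apply: (lim_le _ _ _ _ (cvg_cst _) (HI f cf)).
  apply: (@filterS _ U _ _ _ _ Ugood) => phi [cp np _].
  have p0 := cov_gt0 cf0 cp np nf0.
  rewrite /= /q ler_pdivlMr// ler_pdivrMl//; exact: cov_trans.
- move=> c f; rewrite le_eqVlt => /orP[/eqP <- cf|]; last exact: IZ.
  have c0 : ccp (fun x => 0 * f x) by exact: ccpZ.
  have := ID _ _ c0 c0; rewrite (_ : (fun x => _ + _) = fun x => 0 * f x).
    by move/eqP; rewrite -subr_eq subrr mul0r => /eqP.
  by apply/funext => x; rewrite mul0r addr0.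
- have sh a f : ccp f -> I (fun x => f (a * x)%g) <= I f.
    move=> cf; rewrite -[I f]mul1r; apply: le_lim => //; first exact: ccp_shift.
    by move=> phi cp np; rewrite mul1r; exact: cov_shift.
  move=> a f cf; apply/eqP; rewrite eq_le sh//=.
  have := sh a^-1%g _ (ccp_shift a cf); congr (I _ <= _).
  by apply/funext => x; rewrite monoid.mulgA monoid.mulgV monoid.mul1g.
Qed.

(* The value on f is independent of the decomposition into a difference of
   nonnegative functions. *)
Lemma haar_functional : exists I : (G -> R) -> R,
  [/\ forall f g, cc f -> cc g -> I (fun x => f x + g x) = I f + I g,
      forall (c : R) f, cc f -> I (fun x => c * f x) = c * I f,
      forall f, ccp f -> 0 <= I f,
      forall f, ccp f -> (exists x, 0 < f x) -> 0 < I f &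
      forall a f, cc f -> I (fun x => f (a * x)%g) = I f].
Proof.
have [I [I0 Ip ID IZ IS]] := haar_exists.
pose pos f x := 2^-1 * (`|f x| + f x); pose neg f x := 2^-1 * (`|f x| + - f x).
have cpos f : cc f -> ccp (pos f).
  move=> cf; split; first by apply: ccZ; apply: ccD => //; exact: cc_norm.
  by move=> x; rewrite /pos; have := lerNnormlW (lexx `|f x|); lra.
have cneg f : cc f -> ccp (neg f).
  move=> cf; split.
    apply: ccZ; apply: ccD; first exact: cc_norm.
    by have := ccZ (-1) cf; under eq_fun do rewrite mulN1r.
  by move=> x; rewrite /neg; have := ler_norm (f x); lra.
pose J f := I (pos f) - I (neg f).
have JE f g h : cc f -> ccp g -> ccp h -> (forall x, f x = g x - h x) -> J f = I g - I h.
  move=> cf cg ch E; apply/eqP; rewrite subr_eq addrAC eq_sym subr_eq; apply/eqP.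
  rewrite -(ID _ _ cg (cneg f cf)) -(ID _ _ (cpos f cf) ch); congr I; apply/funext => x.
  by rewrite /pos /neg E; lra.
have fE f x : f x = pos f x - neg f x by rewrite /pos /neg; lra.
have Jp f : ccp f -> J f = I f.
  move=> cf; have c0 : ccp (fun x => 0 * f x) by exact: ccpZ.
  by rewrite (JE f f _ (proj1 cf) cf c0) ?IZ// ?mul0r ?subr0// => x; rewrite mul0r subr0.
have JD f g : cc f -> cc g -> J (fun x => f x + g x) = J f + J g.
  move=> cf cg; rewrite (JE _ _ _ (ccD cf cg) (ccpD (cpos f cf) (cpos g cg))
    (ccpD (cneg f cf) (cneg g cg))).
    have cp := cpos f cf; have cn := cneg f cf; have cp' := cpos g cg; have cn' := cneg g cg.
    by rewrite (ID (pos f) (pos g))// (ID (neg f) (neg g))// /J; lra.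
  by move=> x; rewrite [in LHS]fE [in X in _ + X]fE; lra.
exists J; split=> //.
- move=> c f cf; have cp := cpos f cf; have cn := cneg f cf.
  have [c0|/ltW c0] := leP 0 c.
    rewrite (JE _ _ _ (ccZ c cf) (ccpZ c0 (cpos f cf)) (ccpZ c0 (cneg f cf))).
      by rewrite (IZ c (pos f))// (IZ c (neg f))// /J mulrBr.
    by move=> x; rewrite [in LHS]fE mulrBr.
  have c0' : 0 <= - c by rewrite oppr_ge0.
  rewrite (JE _ _ _ (ccZ c cf) (ccpZ c0' (cneg f cf)) (ccpZ c0' (cpos f cf))).
    by rewrite (IZ (- c) (pos f))// (IZ (- c) (neg f))// /J; ring.
  by move=> x; rewrite [in LHS]fE; ring.
- by move=> f cf; rewrite Jp//; exact: I0.
- by move=> f cf nf; rewrite Jp//; exact: Ip.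
- by move=> a f cf; rewrite /J -(IS a _ (cpos f cf)) -(IS a _ (cneg f cf)).
Qed.

End haar.

(** * Averaging over a proper action *)

Section integration.
Context {R : realType} {m : nat} {G : lieGroupType R m} (I : (G -> R) -> R).
Hypothesis ID : forall f g, cc f -> cc g -> I (fun x => f x + g x) = I f + I g.
Hypothesis IZ : forall (c : R) f, cc f -> I (fun x => c * f x) = c * I f.
Hypothesis I0 : forall f, ccp f -> 0 <= I f.

Lemma haarB f g : cc f -> cc g -> I (fun x => f x - g x) = I f - I g.
Proof.
move=> cf cg; rewrite -[- I g]mulN1r -IZ// -ID//; last exact: ccZ.
by congr I; apply/funext => x; rewrite mulN1r.
Qed.

Lemma haar_bound f chi (e : R) : cc f -> cc chi -> (forall x, `|f x| <= e * chi x) ->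
  `|I f| <= e * I chi.
Proof.
move=> cf cchi H; have ce := ccZ e cchi; rewrite ler_norml; apply/andP; split.
  have c1 := ccD ce cf.
  have : 0 <= I (fun x => e * chi x + f x).
    apply: I0; split=> // x; have := H x; rewrite ler_norml => /andP[]; lra.
  by rewrite ID// IZ//; lra.
have cN := ccZ (-1) cf; have c1 := ccD ce cN.
have : 0 <= I (fun x => e * chi x + -1 * f x).
  apply: I0; split=> // x; have := H x; rewrite ler_norml => /andP[]; lra.
by rewrite ID// !IZ//; lra.
Qed.

Section parameter.
Context {V : normedModType R} (U : set V) (oU : open U) (K : set G) (cK : compact K).
Let W := [set z : G * V | U z.2].
Let oW : open W. Proof. exact: open_snd. Qed.
Let supported (F : G -> V -> R) := forall t p, U p -> ~ K t -> F t p = 0.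

Lemma param_cc F p : pcont W F -> supported F -> U p -> cc (F ^~ p).
Proof.
move=> cF sF Up; split; last by exists K => // t; exact: sF.
move=> t; apply: (@continuous_comp _ _ _ (fun t => (t, p) : G * V) (fun z => F z.1 z.2)).
  by apply: pair_continuous; [exact: cvg_id|exact: cvg_cst].
exact: (cF (t, p)).
Qed.

Lemma param_uniform F p (e : R) : pcont W F -> U p -> 0 < e ->
  \forall q \near p, forall t, K t -> `|F t q - F t p| <= e.
Proof.
move=> cF Up e0; apply: (@compact_ind _ K (fun A => \forall q \near p, forall t, A t ->
    `|F t q - F t p| <= e)) => //.
- by apply: filterE => q t [].
- move=> A B nA nB; apply: filterS (nearI nA nB) => q [qA qB] t [/qA|/qB] //.
- by move=> A B AB; apply: filterS => q qB t /AB; exact: qB.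
move=> t _; have e2 : 0 < e / 2 by rewrite divr_gt0.
have [[A B] [/= At Bp] AB] := cF (t, p) Up _ (nbhsx_ballx _ (e / 2) e2).
have Bp' := nbhs_singleton Bp.
exists A => //; apply: filterS Bp => q Bq s As.
have H1 := AB (s, q) (conj As Bq).
have H2 := AB (s, p) (conj As Bp'); move: H1 H2; rewrite /ball /= => H1 H2.
rewrite (splitr e) (_ : F s q - _ = (F t p - F s p) - (F t p - F s q)); last by ring.
by apply: le_trans (ler_normB _ _) _; rewrite lerD// ltW.
Qed.

Lemma supported_D F v : supported F -> supported (fun t => 'D_v (F t)).
Proof.
move=> sF t p Up nK; have N : \forall q \near p, (cst 0 : V -> R) q = F t q.
  by apply: filterS (open_near oU Up) => q Uq; rewrite sF.
have D := near_eq_is_derive N (is_derive_cst (0 : R) p v).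
exact: (@derive_val _ _ _ _ _ _ _ D).
Qed.

(** By the mean value theorem the error of the difference quotient is at most [d] uniformly on the
    compact set [K]; the cutoff [chi], at least 1 on [K], does the work of the measure of [K]. *)
Lemma param_is_derive F p v : psm W F -> supported F -> U p ->
  is_derive p v (fun q => I (F ^~ q)) (I (fun t => 'D_v (F t) p)).
Proof.
move=> pF sF Up; have [chi [cchi _ Hchi]] := ccp_cutoff cK; have [cc_chi chi0] := cchi.
have pF' := psm_D v pF; have sF' := supported_D v sF.
apply/dderivP; apply/cvgrPdist_le => e e0; rewrite /prop_near1 /=.
(* Chosen so that [d * I chi <= e]; the added 1 makes the denominator positive. *)
pose d := e / (I chi + 1); have Ic := I0 cchi.
have Ic1 : 0 < I chi + 1 by lra.
have d0 : 0 < d by rewrite divr_gt0.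
have N := nearI (param_uniform (psm_cont pF') Up d0) (open_near oU Up).
have N2 := @nbhs_dnbhs _ (0 : R) _ (near_segment v N).
have N3 : \forall h \near (0 : R)^', h != 0 by exact: nbhs_dnbhs_neq.
apply: filterS (filterI N2 N3) => h [Hh h0].
have Uh s : `|s| <= `|h| -> U (s *: v + p) by move=> /Hh [].
have Uhv := Uh h (lexx _).
have c1 := param_cc (psm_cont pF) sF Uhv; have c0 := param_cc (psm_cont pF) sF Up.
have c' := param_cc (psm_cont pF') sF' Up.
have cB : cc (fun t => F t (h *: v + p) - F t p).
  by have := ccD c1 (ccZ (-1) c0); under eq_fun do rewrite mulN1r.
rewrite -haarB// -[h^-1 *: _]/(h^-1 * _) -IZ// -haarB//; last exact: ccZ.
apply: (@le_trans _ _ (d * I chi)); last first.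
  by rewrite /d mulrAC ler_pdivrMr// ler_pM2l//; lra.
apply: haar_bound => //.
  by have := ccD c' (ccZ (-1) (ccZ h^-1 cB)); under eq_fun do rewrite mulN1r.
move=> t; have [Kt|nKt] := pselect (K t); last first.
  by rewrite !sF// sF'// subrr mulr0 subrr normr0 mulr_ge0// ltW.
have dF s : `|s| <= `|h| -> derivable (F t) (s *: v + p) v.
  by move=> /Uh Us; have [] := psm_der (z:=(t, s *: v + p)) v pF Us.
have [s sh E] := mvt_line dF; rewrite E.
rewrite mulKf// distrC; have [/(_ t Kt) H _] := Hh s sh; apply: le_trans H _.
by rewrite -[leLHS]mulr1 ler_pM2l//; exact: Hchi.
Qed.

Lemma haar_usm F : psm W F -> supported F -> usm U (fun p => I (F ^~ p)).
Proof.
have oU' : open [set z : bool * V | U z.2] by exact: open_snd.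
have C F' p : psm W F' -> supported F' -> U p -> {for p, continuous (fun p => I (F' ^~ p))}.
  move=> pF sF Up; apply: continuous_near_le => e e0.
  have [chi [cchi _ Hchi]] := ccp_cutoff cK; have [cc_chi chi0] := cchi.
  have Ic := I0 cchi; have Ic1 : 0 < I chi + 1 by lra.
  pose d := e / (I chi + 1); have d0 : 0 < d by rewrite divr_gt0.
  apply: filterS (nearI (param_uniform (psm_cont pF) Up d0) (open_near oU Up)) => q [Hq Uq].
  rewrite distrC; have c1 := param_cc (psm_cont pF) sF Uq; have c0 := param_cc (psm_cont pF) sF Up.
  rewrite -haarB//; apply: (@le_trans _ _ (d * I chi)); last first.
    by rewrite /d mulrAC ler_pdivrMr// ler_pM2l//; lra.
  apply: haar_bound => //.
    by have := ccD c1 (ccZ (-1) c0); under eq_fun do rewrite mulN1r.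
  move=> t; have [Kt|nKt] := pselect (K t); last first.
    by rewrite !sF// subrr normr0 mulr_ge0// ltW.
  by apply: le_trans (Hq t Kt) _; rewrite -[leLHS]mulr1 ler_pM2l//; exact: Hchi.
move=> + + k; elim: k F => [|k IH] F pF sF.
  by split=> // -[b p] Up; apply: (@cvg_prod_snd _ _ _ _ (fun p => I (F ^~ p))); exact: C.
apply: pCkS_intro => //.
  by move=> -[b p] Up; apply: (@cvg_prod_snd _ _ _ _ (fun p => I (F ^~ p))); exact: C.
move=> v; exists (fun _ p => I (fun t => 'D_v (F t) p)).
  by move=> [b p] Up; exact: param_is_derive.
by apply: IH; [exact: psm_D|exact: supported_D].
Qed.

End parameter.
End integration.

Section local_sums.
Context {R : realType} {n : nat} {M : manifoldType R n}.
Variable w : nat -> M -> R.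
Hypothesis w_fin : forall x : M, exists N : nat, \forall y \near x, forall i, (N <= i)%N -> w i y = 0.

Lemma truncation_eq (u : nat -> R) (N N' : nat) x :
  (forall i, (N <= i)%N -> w i x = 0) -> (forall i, (N' <= i)%N -> w i x = 0) ->
  \sum_(i < N) w i x * u i = \sum_(i < N') w i x * u i.
Proof.
have L : forall N d : nat, (forall i, (N <= i)%N -> w i x = 0) ->
    \sum_(i < N + d) w i x * u i = \sum_(i < N) w i x * u i.
  move=> {}N d H; rewrite big_split_ord /= [X in _ + X]big1 ?addr0// => i _.
  by rewrite H ?mul0r// leq_addr.
move=> H H'; have [le|/ltnW le] := leqP N N'.
  by rewrite -(subnKC le) L.
by rewrite -(subnKC le) L.
Qed.

(** The cutoff is an arbitrary choice for each [x]; by [local_sumE] any bound beyond which the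
    weights vanish gives the same value, so one finite sum serves near a given point. *)
Definition local_sum (u : nat -> M -> R) x :=
  \sum_(i < projT1 (cid (w_fin x))) w i x * u i x.

Lemma local_sumE (u : nat -> M -> R) x (N : nat) :
  (forall i, (N <= i)%N -> w i x = 0) -> local_sum u x = \sum_(i < N) w i x * u i x.
Proof.
move=> H; rewrite /local_sum; case: cid => N' /= HN'.
exact: (truncation_eq (u ^~ x) (nbhs_singleton HN') H).
Qed.

Lemma local_sum_smooth (u : nat -> M -> R) : (forall i, smooth_fun (w i)) ->
  (forall i, smooth_fun (u i)) -> smooth_fun (local_sum u).
Proof.
move=> sw su; apply/smooth_funP/psmooth_local => -[b x] _.
have [N HN] := w_fin x; have [Z [oO Zx HZ]] := near_open_nbhs HN.
have oO' : open [set z : bool * M | Z z.2] by exact: open_snd.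
exists [set z | Z z.2] => //.
apply: (@psmooth_ext _ _ _ _ _ (fun _ x => \sum_(i < N) w i x * u i x)) => //.
  by move=> [b' y] Zy; apply/esym/local_sumE; exact: HZ.
apply: psmooth_sum => // i _; apply: psmoothM => //.
  by apply: psmooth_sub (iffLR (smooth_funP _) (sw i)).
by apply: psmooth_sub (iffLR (smooth_funP _) (su i)).
Qed.

End local_sums.

Section proper_action.
Context {R : realType} {n m : nat} {M : manifoldType R n} {G : lieGroupType R m}.
Context {rho : G -> Diff M} (G_closed : closed_lie_subgroup rho).

(** A countable basis is indexed by natural numbers through an injection. Each basic set on which
    some bump function is positive is assigned one, and every point lies in such a set. *)
Lemma countable_bumps : exists phi : nat -> M -> R,
  [/\ forall i, smooth_fun (phi i), forall i x, 0 <= phi i x,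
      forall i, exists2 K, compact K & forall x, ~ K x -> phi i x = 0 &
      forall x, exists i, 0 < phi i x].
Proof.
have [B cB [oB Bx]] := @manifold_second_countable R n M.
have /countable_injP [f finj] := cB.
pose good (phi : M -> R) := [/\ smooth_fun phi, forall x, 0 <= phi x &
  exists2 K, compact K & forall x, ~ K x -> phi x = 0].
have H i : exists phi, good phi /\ forall b, B b -> f b = i ->
    (exists2 psi, good psi & forall x, b x -> 0 < psi x) -> forall x, b x -> 0 < phi x.
  have [[b [Bb fb [psi gpsi bpsi]]]|nex] := pselect (exists b, [/\ B b, f b = i &
      exists2 psi, good psi & forall x, b x -> 0 < psi x]).
    exists psi; split=> // b' Bb' fb' _; rewrite (_ : b' = b)//.
    by apply: finj; rewrite ?inE// fb fb'.
  (* Indices that name no suitable basic set get the zero function. *)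
  exists (fun=> 0); split; last by move=> b Bb fb e; exfalso; apply: nex; exists b.
  split=> //; first by apply/smooth_funP; exact: psmooth_cst openT.
  by exists set0 => //; exact: compact0.
have [phi Hphi] := choice H; exists phi; split.
- by move=> i; have [[]] := Hphi i.
- by move=> i; have [[]] := Hphi i.
- by move=> i; have [[]] := Hphi i.
move=> x; have [psi [spsi psi0 px [K [cK _ Ksupp]]]] := @bump R n M x setT filterT.
have gpsi : good psi by split=> //; exists K.
have N : nbhs x [set y | 0 < psi y].
  apply: (@smooth_fun_cont _ _ _ psi spsi x [set r | 0 < r]); exact: lt_nbhsr px.
have [b [Bb bx] bN] := Bx x _ N.
exists (f b); have [_ Hb] := Hphi (f b); apply: (Hb b) => //.
by exists psi.
Qed.

Hypothesis G_proper : acts_properly rho.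

(** The elements that carry some point of [N] into [C] are the projection of a compact preimage, and
    inversion then accounts for [a^-1]. Integrands over [G] thereby have compact support, locally
    uniformly in the point. *)
Lemma proper_support (N C : set M) : compact N -> compact C ->
  exists2 K, compact K & forall a x, N x -> C (rho a^-1%g x) -> K a.
Proof.
move=> cN cC; have [_ /(_ _ (compact_setX cC cN)) cP] := G_proper.
set P := _ @^-1` _ in cP.
exists ((fun z : G * M => z.1^-1%g) @` P).
  apply: continuous_compact cP; apply: continuous_subspaceT => z.
  apply: (@continuous_comp _ _ _ (@fst G M) (fun a => a^-1%g)); first exact: cvg_fst.
  exact: invg_continuous.
by move=> a x Nx Cx; exists (a^-1%g, x); rewrite ?invgK.
Qed.

Lemma rhoV_continuous : continuous (fun a => rho a^-1%g).
Proof.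
move=> a; apply: (@continuous_comp _ _ _ (fun a => a^-1%g) rho).
  exact: invg_continuous.
exact: rho_continuous G_closed _.
Qed.

Lemma psmooth_translate (phi : M -> R) : smooth_fun phi ->
  psmooth [set: G * M] (fun a x => phi (rho a^-1%g x)).
Proof.
move=> sphi c Mc; apply: psm_local => -[a p] [/= cp _].
have [d Md dx] := chart_at (rho a^-1%g (cinv c p)).
have oD := open_pdom rhoV_continuous Mc Md.
exists (pdom (fun a => rho a^-1%g) c d); first by split.
apply: (@psm_ext _ _ _ _ (fun t p => (phi \o cinv d) (local (rho t^-1%g) c d p))) => //.
  by move=> [b q] [/= cq dq]; rewrite /local /= cmapK.
apply: (@psm_comp _ _ _ _ [set z | crange d z.2] _ (fun _ => phi \o cinv d)
  (fun t p => local (rho t^-1%g) c d p)) => //.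
- by apply: open_snd; exact: crange_open'.
- apply: usm_psm; exact: smooth_fun_usm.
- by move=> j; exact: (local_psm rhoV_continuous).
- by move=> [b q] [/= cq dq]; exact: crange_cmap.
Qed.

Section integrals.
Context (I : (G -> R) -> R).
Hypothesis ID : forall f g, cc f -> cc g -> I (fun x => f x + g x) = I f + I g.
Hypothesis IZ : forall (c : R) f, cc f -> I (fun x => c * f x) = c * I f.
Hypothesis I0 : forall f, ccp f -> 0 <= I f.

(** On a compact neighbourhood of any point, [proper_support] confines the integrand to one compact
    subset of [G], so [haar_usm] applies. *)
Lemma haar_smooth (F : G -> M -> R) (C : set M) : psmooth [set: G * M] F -> compact C ->
  (forall a x, ~ C (rho a^-1%g x) -> F a x = 0) -> smooth_fun (fun x => I (F ^~ x)).
Proof.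
move=> sF cC FC c Mc; apply/smooth_on_RP; first exact: crange_open'.
apply: usm_local => p cp.
have [N [cN Nx _]] := @locally_compactM R n M (cinv c p) setT filterT.
have [K cK HK] := proper_support cN cC.
have [Z [oO Zp ZN]] := near_open_nbhs Nx.
have oU := open_chart_set1 c oO.
exists [set p | crange c p /\ Z (cinv c p)] => //.
apply: (haar_usm ID IZ I0 oU cK (F := fun a p => F a (cinv c p))).
  by apply: psm_sub (sF c Mc) => -[a q] [].
move=> a q [cq Zq] nK; apply: FC => Cq; apply: nK; apply: HK Cq; exact: ZN.
Qed.

End integrals.

Lemma translate_cc (F : G -> M -> R) (C : set M) x : psmooth [set: G * M] F -> compact C ->
  (forall a x, ~ C (rho a^-1%g x) -> F a x = 0) -> cc (F ^~ x).
Proof.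
move=> sF cC FC; have [K cK HK] := proper_support (@compact_set1 _ x) cC; split.
  move=> a; apply: (@continuous_comp _ _ _ (fun a => (a, x) : G * M) (fun z => F z.1 z.2)).
    by apply: pair_continuous; [exact: cvg_id|exact: cvg_cst].
  exact: (psmooth_cont sF).
by exists K => // a nK; apply: FC => Cq; apply: nK; exact: HK Cq.
Qed.

(** Continuity into C^oo(M, R) is the input for integration over [G]: by [Cinf_psmooth] it yields
    smoothness on [M] with [G] as a continuous parameter. *)
Lemma cochain_continuous (l : cochain (G:=G) (M:=M) 1) : smooth_cochain l ->
  continuous (fun a => l (fun=> a)).
Proof.
move=> sl a; have [c Gc ca] := chart_at a.
have [cl _] := sl (fun=> c) (fun=> Gc) 0%N.
have cp : [set p : 'M[R]_(1, m) | forall i, crange c (row i p)] (c a).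
  by move=> i /=; rewrite (ord1 i) row_id; exact: crange_cmap.
have cl' := cl _ cp.
apply: (@continuous_near_eq _ _ (fun b => l (fun i => cinv c (row i (c b))))).
  apply: filterS (near_cdom ca) => b cb; congr l; apply/funext => i.
  by rewrite (ord1 i) row_id cmapK.
apply: (@continuous_comp _ _ _ (cmap c) (fun p : 'M[R]_(1, m) => l (fun i => cinv c (row i p)))).
  exact: cmap_continuous.
exact: cl'.
Qed.

Lemma proper_vanishes : Hd_vanishes rho 1.
Proof.
move=> l sl lc; pose L a x := l (fun=> a) x.
have lE a : l a = l (fun=> a ord0).
  by congr l; apply/funext => i; rewrite (ord1 i).
have LM a b x : L (a * b)%g x = L b (rho a^-1%g x) + L a x.
  pose A (i : 'I_2) := if i == ord0 then a else b.
  have E1 : l (fun j => A (lift ord0 j)) = l (fun=> b) by rewrite lE.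
  have E2 : l (merge_at ord0 A) = l (fun=> (a * b)%g) by rewrite lE.
  have E3 : l (fun j => A (widen_ord (leqnSn 1) j)) = l (fun=> a) by rewrite lE.
  have := lc A x; rewrite /coboundary /Defs.act big_ord1 /= !expr1 sqrrN expr1n mul1r mulN1r.
  rewrite E1 E2 E3 /L => /eqP; rewrite addrAC subr_eq0 => /eqP <-.
  by congr (l _ _ + l _ _).
have sL : psmooth [set: G * M] L by exact: Cinf_psmooth (cochain_continuous sl).
have [I [ID IZ I0 Ip IS]] := @haar_functional R m G.
have [phi [sphi phi0 phiK phi_cover]] := countable_bumps.
pose f i a x := phi i (rho a^-1%g x); pose g i a x := - L a x * f i a x.
have sf i : psmooth [set: G * M] (f i) by exact: psmooth_translate.
have sg i : psmooth [set: G * M] (g i).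
  by apply: psmoothM => //; [exact: openT|apply: psmoothN => //; exact: openT].
pose Phi i x := I (f i ^~ x); pose K i x := I (g i ^~ x).
have sPhi i : smooth_fun (Phi i).
  have [C cC HC] := phiK i; apply: (haar_smooth ID IZ I0 (sf i) cC) => a x; exact: HC.
have sK i : smooth_fun (K i).
  have [C cC HC] := phiK i; apply: (haar_smooth ID IZ I0 (sg i) cC) => a x /HC.
  by rewrite /g /f => ->; rewrite mulr0.
have cf i x : cc (f i ^~ x).
  by have [C cC HC] := phiK i; apply: (translate_cc x (sf i) cC) => a y; exact: HC.
have cg i x : cc (g i ^~ x).
  have [C cC HC] := phiK i; apply: (translate_cc x (sg i) cC) => a y /HC.
  by rewrite /g /f => ->; rewrite mulr0.
(* Moving the point by [b^-1] is a left translation of the variable of integration, so left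
   invariance of [I] applies. *)
have fS i a b x : f i a (rho b^-1%g x) = f i (b * a)%g x.
  by rewrite /f invMg (rho_mul G_closed).
have PhiS i b x : Phi i (rho b^-1%g x) = Phi i x.
  rewrite /Phi -(IS b _ (cf i x)); congr I; apply/funext => a; exact: fS.
have KS i b x : K i (rho b^-1%g x) = K i x + L b x * Phi i x.
  rewrite /K /Phi -IZ// -ID//; last exact: ccZ.
  rewrite -[RHS](IS b); last by apply: ccD => //; exact: ccZ.
  congr I; apply/funext => a; rewrite /g fS LM; ring.
have Phi0 i x : 0 <= Phi i x by apply: I0; split=> // a; exact: phi0.
have Phip i x : 0 < phi i x -> 0 < Phi i x.
  move=> px; apply: Ip; first by split=> // a; exact: phi0.
  by exists 1%g; rewrite /f monoid.invg1 (rho_one G_closed).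
(* Invariant weights, locally finite: near a point where Phi j > 0, the factor
   of index j kills w i for all large i. *)
pose w i x := \prod_(j < i) theta 0 (i.+1%:R^-1 - Phi j x).
have sw i : smooth_fun (w i).
  apply/smooth_funP; apply: psmooth_prod; first exact: openT.
  move=> j _; apply: psmooth_theta; first exact: openT.
  apply: psmoothD; [exact: openT|exact: psmooth_cst openT|].
  by apply: psmoothN; [exact: openT|apply/smooth_funP].
have w_fin (x : M) : exists N : nat, \forall y \near x, forall i, (N <= i)%N -> w i y = 0.
  have [j /Phip Pj] := phi_cover x.
  (* From this index on [1 / (i + 1)] is at most half of [Phi j x], hence below [Phi j y] for [y]
     near [x]. *)
  have [N HN] : exists N : nat, forall i, (N <= i)%N -> (i.+1%:R^-1 : R) <= Phi j x / 2.
    have P2 : 0 < Phi j x / 2 by rewrite divr_gt0.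
    exists (Num.truncn (Phi j x / 2)^-1) => i Ni.
    rewrite -[leRHS]invrK lef_pV2 ?posrE ?invr_gt0//.
    apply/ltW/(lt_le_trans (truncnS_gt _)); by rewrite ler_nat.
  exists (maxn N j.+1).
  have : nbhs x [set y | ball (Phi j x) (Phi j x / 2) (Phi j y)].
    by apply: (smooth_fun_cont (sPhi j)); apply: nbhsx_ballx; rewrite divr_gt0.
  apply: filterS => y /= yb i; rewrite geq_max => /andP[/HN Ni ji].
  rewrite /w (bigD1 (Ordinal ji))//= /theta [X in X * _](_ : _ = 0) ?mul0r//.
  rewrite ifF//; apply/negbTE; rewrite -leNgt subr_le0; apply: le_trans Ni _.
  by move: yb; rewrite /ball /= ltr_norml => /andP[]; lra.
have w0 i x : 0 <= w i x by apply: prodr_ge0 => j _; exact: theta_ge0.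
have wS i b x : w i (rho b^-1%g x) = w i x.
  by apply: eq_bigr => j _; rewrite PhiS.
pose S1 := local_sum w_fin K; pose S2 := local_sum w_fin Phi.
have trunc x : exists N, forall i, (N <= i)%N -> w i x = 0.
  by have [N HN] := w_fin x; exists N; exact: nbhs_singleton HN.
have S2_gt0 x : 0 < S2 x.
  (* At the least such index all earlier [Phi j x] vanish, so every factor of [w i x] is [theta 0]
     of a positive number. *)
  have ex_i : exists i, 0 < Phi i x by have [i /Phip Pi] := phi_cover x; exists i.
  have := ex_minnP ex_i => -[i Pi imin].
  have wi : 0 < w i x.
    apply: prodr_gt0 => j _; rewrite theta_gt0 subr_gt0.
    suff -> : Phi j x = 0 by rewrite invr_gt0.
    apply/eqP; rewrite eq_le Phi0 andbT leNgt; apply/negP => /imin.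
    by rewrite leqNgt ltn_ord.
  have [N HN] := trunc x; rewrite /S2 (local_sumE _ _ HN).
  have iN : (i < N)%N by rewrite ltnNge; apply/negP => /HN wi0; rewrite wi0 ltxx in wi.
  rewrite (bigD1 (Ordinal iN))//= ltr_pwDl ?mulr_gt0//.
  by apply: sumr_ge0 => j _; rewrite mulr_ge0.
have S2S b x : S2 (rho b^-1%g x) = S2 x.
  have [N HN] := trunc x.
  have HN' i : (N <= i)%N -> w i (rho b^-1%g x) = 0 by rewrite wS; exact: HN.
  rewrite /S2 (local_sumE _ _ HN) (local_sumE _ _ HN').
  by apply: eq_bigr => i _; rewrite wS PhiS.
have S1S b x : S1 (rho b^-1%g x) = S1 x + L b x * S2 x.
  have [N HN] := trunc x.
  have HN' i : (N <= i)%N -> w i (rho b^-1%g x) = 0 by rewrite wS; exact: HN.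
  rewrite /S1 /S2 !(local_sumE _ _ HN) (local_sumE _ _ HN').
  rewrite mulr_sumr -big_split; apply: eq_bigr => i _ /=; rewrite wS KS; ring.
have sk : (fun x => S1 x * (S2 x)^-1) \in @smooth_pred R n M.
  apply/asboolP/smooth_funP/psmoothM; first exact: openT.
    by apply/smooth_funP; exact: local_sum_smooth.
  apply: psmooth_inv; first exact: openT.
    by move=> z _; rewrite gt_eqF.
  by apply/smooth_funP; exact: local_sum_smooth.
exists (fun=> MkCinf sk).
  (* With no group argument the chart domain is the whole space of matrices with no rows, and
     smoothness is that of a function independent of the first variable. *)
  move=> c _; rewrite (_ : [set p | _] = setT); last by apply/seteqP; split=> // p _ [].
  apply: jointly_smooth_on; first exact: openT.
  move=> d Md; apply: usm_sub (usm_snd (crange_open' d) (smooth_fun_usm (Cinf_smooth (MkCinf sk)) Md)).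
  by move=> z [].
move=> a x; rewrite lE -/(L _ x) /coboundary /Defs.act big_ord0 /= expr1 addr0 mulN1r.
rewrite S1S S2S mulrDl -mulrA mulfV ?gt_eqF// mulr1; ring.
Qed.

End proper_action.

Theorem theorem8 (R : realType) (n m : nat) (M : manifoldType R n)
    (G : lieGroupType R m) (rho : G -> Diff M)
    (M_connected : connected [set: M]%classic)
    (G_closed : closed_lie_subgroup rho)
    (G_preserves :
       preserves_CR_structure rho \/ preserves_conformal_structure rho) :
  acts_properly rho <-> Hd_vanishes rho 1.
Proof.
split=> [|H1]; first exact: proper_vanishes.
case: G_preserves => [[w [J [ph pCR]]]|[g [rg pc]]].
  exact: (CR_acts_properly G_closed ph pCR M_connected) H1.
exact: (conformal_acts_properly G_closed rg M_connected pc) H1.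
Qed.
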